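(* Let $E$ be a separated bornological locally convex topological vector space over $\mathbb{R}$. Then $E$ is convenient if and only if the diffeological vector space $(E,\Pi L^*(E))$ is tangent-stable.
   Context: $L^*(E)$ is the set of continuous linear functionals $E\to\mathbb{R}$. $\Pi L^*(E)$ is the diffeology on $E$ whose plots are the maps $p\colon U\to E$ ($U$ open in some $\mathbb{R}^n$) such that $l\circ p$ is smooth for all $l\in L^*(E)$; ''$E$ viewed as a diffeological space'' means $(E,\Pi L^*(E))$. A locally convex topological vector space (lctvs) is separated if the seminorms defining its topology separate points, and bornological if every bounded seminorm on it is continuous. For a separated lctvs $E$, a curve $c\colon U\to E$ ($U\subseteq\mathbb{R}$ open) is differentiable if $c'(t)=\lim_{h\to0}(c(t+h)-c(t))/h$ exists for all $t$, and is $\mathscr{D}_c(E)$-smooth if all iterated derivatives $c^{(k)}$ exist. $\mathscr{D}_c(E)$ is the diffeology whose plots are the maps $p\colon U\to E$ ($U$ open in some $\mathbb{R}^n$) such that $p\circ c$ is $\mathscr{D}_c(E)$-smooth for every smooth curve $c\colon V\to U$ ($V \subseteq \mathbb{R}$ open). A separated lctvs $E$ is convenient (Kriegl–Michor) if $\mathscr{D}_c(E)=\Pi L^*(E)$. Tangent functor on diffeological spaces: $TX$ is the quotient (with quotient diffeology) of $\coprod_{p\colon U\to X\text{ plot},\,U\subseteq\mathbb{R}^n\text{ open}}U\times\mathbb{R}^n$ by the equivalence relation generated by $(p,(u,v))\sim(p',(f(u),D_uf(v)))$ whenever $f\colon U\to U'$ is smooth with $p=p'\circ f$. The class of $(p,(u,v))$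 is written $p_*(u,v)$. A diffeological vector space is a real vector space with a diffeology for which addition $V\times V\to V$ and scalar multiplication $\mathbb{R}\times V\to V$ are smooth. It is tangent-stable if the map $\ell\colon V\times V\to TV$, $\ell(u,v)=[t\mapsto u+tv]_*(0,1)$, is an isomorphism of diffeological spaces. *)

(* Defs.v *)
From HB Require Import structures.
From mathcomp Require Import all_boot all_order all_algebra.
From mathcomp Require Import generic_quotient.
From mathcomp Require Import all_classical all_reals all_analysis.
From Stdlib Require Import Relation_Operators.
Set Implicit Arguments.
Unset Strict Implicit.
Unset Printing Implicit Defensive.
Import Order.TTheory GRing.Theory Num.Theory.
Import numFieldNormedType.Exports.
Local Open Scope classical_set_scope.
Local Open Scope ring_scope.

(* Maps on open sets are encoded as total functions together with their       *)
(* domain U; their values outside U are irrelevant.                           *)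

Section Smooth.
Context {R : realType}.

(* k-fold differentiability on an open set U of a finite-dimensional V: f is  *)
(* Fréchet differentiable on U and each x |-> 'd f x v is (k-1)-fold          *)
(* differentiable on U.                                                       *)
Fixpoint diff_upto (V W : normedModType R) (k : nat) (U : set V) (f : V -> W) :
    Prop :=
  if k is k'.+1 then
    (forall x, U x -> differentiable f x) /\
    (forall v, diff_upto k' U (fun x => 'd f x v))
  else True.

Definition smooth_on (V W : normedModType R) (U : set V) (f : V -> W) : Prop :=
  forall k, diff_upto k U f.

Section Theory.
Variables V W : normedModType R.
Implicit Types (U : set V) (f g h : V -> W).

Let near0_diff h (x : V) : (\forall y \near x, h y = 0) ->
  continuous (0 : V -> W) /\ h \o shift x = cst (h x) + (0 : V -> W) +o_ 0 id.
Proof.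
move=> h0; split; first exact: cst_continuous.
apply/eqaddoP => e e0.
have hx : h x = 0 by exact: (nbhs_singleton h0).
have := h0; rewrite (near_shift 0 x) => h0'.
near=> y.
rewrite !fctE /= hx [X in _ - X](_ : _ = 0) ?subr0; last exact: addr0.
have -> : h (y + x) = 0; last by rewrite normr0 mulr_ge0// ltW.
suff : h (y + (x - 0)) = 0 by rewrite subr0.
by near: y; exact: h0'.
Unshelve. all: by end_near. Qed.

Lemma near_eq_differentiable f g (x : V) : {near x, f =1 g} ->
  differentiable f x -> differentiable g x /\ 'd f x = 'd g x :> (V -> W).
Proof.
move=> fg df.
have /near0_diff [c0 h0] : \forall y \near x, (g \- f) y = 0.
  by apply: filterS fg => y /= ->; rewrite subrr.
have d0 : 'd (g \- f) x = 0 :> (V -> W).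
  exact: (diff_unique (df := \0%R : {linear V -> W}) c0 h0).
have dh : differentiable (g \- f) x by apply/diff_locallyP; rewrite d0.
have -> : g = f + (g \- f).
  by apply/funext => y; rewrite !fctE/= addrC subrK.
split; first exact: differentiableD.
rewrite diffD//; apply/funext => y /=.
by rewrite [X in _ + X](_ : _ = 0) ?addr0// d0.
Qed.

Lemma diff_upto_eq k U f g : open U -> (forall x, U x -> f x = g x) ->
  diff_upto k U f -> diff_upto k U g.
Proof.
move=> oU; elim: k f g => [//|k IH] f g fg [df ddf].
have nfg x : U x -> {near x, f =1 g}.
  by move=> Ux; apply: filterS (open_nbhs_nbhs (conj oU Ux)) => y; exact: fg.
split=> [x Ux|v].
  by have [] := near_eq_differentiable (nfg _ Ux) (df _ Ux).
apply: IH (ddf v) => x Ux.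
by have [_ ->] := near_eq_differentiable (nfg _ Ux) (df _ Ux).
Qed.

Lemma diff_uptoS k U f : diff_upto k.+1 U f -> diff_upto k U f.
Proof.
elim: k f => [//|k IH] f [df ddf]; split=> // v; exact/IH/ddf.
Qed.

Lemma diff_upto_sub k U U' f : U' `<=` U -> diff_upto k U f -> diff_upto k U' f.
Proof.
move=> U'U; elim: k f => [//|k IH] f [df ddf]; split=> [x /U'U|v]; first exact: df.
exact/IH/ddf.
Qed.

Lemma diff_upto_loc k U f :
  (forall x, U x -> exists U', [/\ open U', U' x & diff_upto k U' f]) ->
  diff_upto k U f.
Proof.
elim: k f => [//|k IH] f loc; split=> [x /loc[U' [_ U'x [+ _]]]|v]; first exact.
by apply: IH => x /loc[U' [oU' U'x [_ +]]] => /(_ v); exists U'.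
Qed.

Lemma diff_upto_cst k U (a : W) : diff_upto k U (fun=> a).
Proof.
elim: k a => [//|k IH] a; split=> [x _|v]; first exact: differentiable_cst.
rewrite (_ : (fun _ => _) = fun=> 0) //.
by apply/funext => x; rewrite diff_cst.
Qed.

Lemma diff_uptoD k U f g : open U ->
  diff_upto k U f -> diff_upto k U g -> diff_upto k U (fun x => f x + g x).
Proof.
move=> oU; elim: k f g => [//|k IH] f g [df ddf] [dg ddg].
split=> [x Ux|v]; first exact: differentiableD (df _ Ux) (dg _ Ux).
apply: diff_upto_eq (IH _ _ (ddf v) (ddg v)) => // x Ux.
by rewrite [in RHS](diffD (df _ Ux) (dg _ Ux)).
Qed.

Lemma diff_upto_sum k U (I : Type) (s : seq I) (F : I -> V -> W) : open U ->
  (forall i, diff_upto k U (F i)) ->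
  diff_upto k U (fun x => \sum_(i <- s) F i x).
Proof.
move=> oU dF; elim: s => [|i s IH].
  by rewrite (_ : (fun _ => _) = fun=> 0); [exact: diff_upto_cst|
    apply/funext => x; rewrite big_nil].
rewrite (_ : (fun _ => _) = fun x => F i x + \sum_(j <- s) F j x).
  exact: diff_uptoD.
by apply/funext => x; rewrite big_cons.
Qed.

Lemma diff_upto_lin k U (L : {linear V -> W}) :
  continuous L -> diff_upto k U L.
Proof.
move=> cL; case: k => [//|k]; split=> [x _|v]; first exact: linear_differentiable.
rewrite (_ : (fun _ => _) = fun=> L v); first exact: diff_upto_cst.
by apply/funext => x; rewrite diff_lin.
Qed.

End Theory.

Lemma diff_upto_lin_comp (V W W' : normedModType R) k (U : set V)
    (f : V -> W) (L : {linear W -> W'}) :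
  open U -> continuous L -> diff_upto k U f -> diff_upto k U (L \o f).
Proof.
move=> oU cL; elim: k f => [//|k IH] f [df ddf].
have dL y : differentiable L y by exact: linear_differentiable.
split=> [x Ux|v]; first exact: differentiable_comp (df _ Ux) (dL _).
apply: diff_upto_eq (IH _ (ddf v)) => // x Ux.
by rewrite [in RHS](diff_comp (df _ Ux) (dL _)) /= diff_lin.
Qed.

Section Scale.
Variables V W : normedModType R.
Implicit Types (U : set V) (f : V -> W).

Let scale_bilin : bilinear_for
  (GRing.Scale.Law.clone _ _ *:%R _) (GRing.Scale.Law.clone _ _ *:%R _)
  ( *:%R : R^o -> W -> W).
Proof.
split=> [w|a] b x y /=; first by rewrite scalerDl scalerA.
by rewrite scalerDr !scalerA mulrC.
Qed.

Let scaleLM := bilinear_isBilinear.Build _ _ _ _ _ _ _ scale_bilin.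
Let scaleL : {bilinear R^o -> W -> W} := HB.pack ( *:%R : R^o -> W -> W) scaleLM.

Lemma is_diff_scale (a : V -> R^o) f x :
  differentiable a x -> differentiable f x ->
  differentiable (fun y => a y *: f y) x /\
  'd (fun y => a y *: f y) x = (fun v => a x *: 'd f x v + 'd a x v *: f x)
    :> (V -> W).
Proof.
move=> da df.
have cs : continuous (fun p : R^o * W => scaleL p.1 p.2) by exact: scale_continuous.
have dp := differentiable_pair da df.
have ds : differentiable (fun p : R^o * W => scaleL p.1 p.2) (a x, f x).
  exact: differentiable_bilin.
split; first exact: differentiable_comp dp ds.
rewrite -[X in 'd X _]/((fun p : R^o * W => scaleL p.1 p.2) \o (fun y => (a y, f y))).
by rewrite diff_comp// diff_bilin// diff_pair.
Qed.

Lemma diff_upto_scale k U (a : V -> R^o) f : open U ->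
  diff_upto k U a -> diff_upto k U f -> diff_upto k U (fun x => a x *: f x).
Proof.
move=> oU; elim: k a f => [//|k IH] a f daf dff.
have [da dda] := daf; have [df ddf] := dff.
split=> [x Ux|v]; first by have [] := is_diff_scale (da _ Ux) (df _ Ux).
have H := diff_uptoD oU (IH _ _ (diff_uptoS daf) (ddf v))
  (IH _ _ (dda v) (diff_uptoS dff)).
apply: diff_upto_eq H => // x Ux.
by have [_ ->] := is_diff_scale (da _ Ux) (df _ Ux).
Qed.

End Scale.

Section Coord.
Variable n : nat.
Variable i : 'I_n.

Let coord_is_linear : linear ((fun M => M 0 i) : 'rV[R]_n -> R^o).
Proof. by move=> a x y; rewrite !mxE. Qed.
Let coordLM := GRing.isLinear.Build _ _ _ _ _ coord_is_linear.
Definition coordL : {linear 'rV[R]_n -> R^o} :=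
  HB.pack ((fun M => M 0 i) : 'rV[R]_n -> R^o) coordLM.

Lemma coordL_continuous : continuous coordL.
Proof. exact: coord_continuous. Qed.

End Coord.

Lemma lin_row (W : normedModType R) n (L : {linear 'rV[R]_n -> W}) w :
  L w = \sum_j w 0 j *: L (delta_mx 0 j).
Proof.
rewrite {1}(row_sum_delta w) (@linear_sum R _ _ _ L); apply: eq_bigr => j _.
exact: linearZ.
Qed.

Lemma diff_upto_comp (V W : normedModType R) n k (U : set V) (U' : set 'rV[R]_n)
    (f : V -> 'rV[R]_n) (g : 'rV[R]_n -> W) :
  open U -> open U' -> (forall x, U x -> U' (f x)) ->
  diff_upto k U f -> diff_upto k U' g -> diff_upto k U (g \o f).
Proof.
move=> oU oU' fU; elim: k g => [//|k IH] g dff [dg ddg].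
have [df ddf] := dff.
split=> [x Ux|v]; first exact: differentiable_comp (df _ Ux) (dg _ (fU _ Ux)).
have dj j : diff_upto k U (fun x => coordL j ('d f x v) *:
    ((fun y => 'd g y (delta_mx 0 j)) \o f) x).
  apply: diff_upto_scale => //.
    apply: diff_upto_lin_comp (ddf v) => //; exact: coordL_continuous.
  by apply: IH (ddg _); exact: diff_uptoS.
apply: diff_upto_eq (diff_upto_sum (index_enum _) oU dj) => // x Ux.
have -> : 'd (g \o f) x v = 'd g (f x) ('d f x v).
  by rewrite (diff_comp (df _ Ux) (dg _ (fU _ Ux))).
exact: esym (lin_row ('d g (f x)) ('d f x v)).
Qed.

Section Smooth_lemmas.
Variables V W : normedModType R.
Implicit Types (U : set V) (f g : V -> W).

Lemma smooth_on_eq U f g : open U -> (forall x, U x -> f x = g x) ->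
  smooth_on U f -> smooth_on U g.
Proof. by move=> oU fg sf k; exact: diff_upto_eq fg _. Qed.

Lemma smooth_on_sub U U' f : U' `<=` U -> smooth_on U f -> smooth_on U' f.
Proof. by move=> U'U sf k; exact: diff_upto_sub U'U _. Qed.

Lemma smooth_on_loc U f :
  (forall x, U x -> exists U', [/\ open U', U' x & smooth_on U' f]) ->
  smooth_on U f.
Proof.
by move=> H k; apply: diff_upto_loc => x /H[U' [? ? sf]]; exists U'.
Qed.

Lemma smooth_on_cst U (a : W) : smooth_on U (fun=> a).
Proof. by move=> k; exact: diff_upto_cst. Qed.

Lemma smooth_on_lin (L : {linear V -> W}) U : continuous L -> smooth_on U L.
Proof. by move=> cL k; exact: diff_upto_lin. Qed.

Lemma smooth_onD U f g : open U ->
  smooth_on U f -> smooth_on U g -> smooth_on U (fun x => f x + g x).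
Proof. by move=> ? sf sg k; exact: diff_uptoD. Qed.

Lemma smooth_on_scale U (a : V -> R^o) f : open U ->
  smooth_on U a -> smooth_on U f -> smooth_on U (fun x => a x *: f x).
Proof. by move=> ? sa sf k; exact: diff_upto_scale. Qed.

Lemma smooth_on_continuous U f x : smooth_on U f -> U x ->
  {for x, continuous f}.
Proof. by move=> /(_ 1)[df _] /df; exact: differentiable_continuous. Qed.

Lemma smooth_on_comp n U (U' : set 'rV[R]_n) (f : V -> 'rV[R]_n)
    (g : 'rV[R]_n -> W) :
  open U -> open U' -> (forall x, U x -> U' (f x)) ->
  smooth_on U f -> smooth_on U' g -> smooth_on U (g \o f).
Proof. by move=> ? ? fU sf sg k; exact: diff_upto_comp fU _ _. Qed.

End Smooth_lemmas.

End Smooth.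

Section Diffeology.
Context {R : realType}.

(* plot U p: the map p restricted to U is a plot of the diffeology. *)
Record diffeology (X : Type) := Diffeology {
  plot : forall n : nat, set 'rV[R]_n -> ('rV[R]_n -> X) -> Prop;
  plot_open : forall n (U : set 'rV[R]_n) p, plot U p -> open U;
  plot_eq : forall n (U : set 'rV[R]_n) p q, (forall u, U u -> p u = q u) ->
    plot U p -> plot U q;
  plot_cst : forall n (U : set 'rV[R]_n) (x : X), open U -> plot U (fun=> x);
  plot_loc : forall n (U : set 'rV[R]_n) p, open U ->
    (forall u, U u -> exists U', [/\ U' u, U' `<=` U & plot U' p]) -> plot U p;
  plot_comp : forall m n (V : set 'rV[R]_m) (U : set 'rV[R]_n) f p,
    open V -> smooth_on V f -> (forall v, V v -> U (f v)) ->
    plot U p -> plot V (p \o f)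
}.

Lemma diffeology_eqP (X : Type) (D1 D2 : diffeology X) :
  D1 = D2 <->
  forall n (U : set 'rV[R]_n) p, plot D1 U p <-> plot D2 U p.
Proof.
split=> [-> //|]; case: D1 D2 => [P1 a1 b1 c1 d1 e1] [P2 a2 b2 c2 d2 e2]/= H.
have E : P1 = P2.
  apply: functional_extensionality_dep => n.
  by apply/funext => U; apply/funext => p; exact/propext.
by subst P2; congr Diffeology; exact: Prop_irrelevance.
Qed.

Definition smooth_map (X Y : Type) (DX : diffeology X) (DY : diffeology Y)
    (f : X -> Y) : Prop :=
  forall n (U : set 'rV[R]_n) p, plot DX U p -> plot DY U (f \o p).

Definition diffeo (X Y : Type) (DX : diffeology X) (DY : diffeology Y)
    (f : X -> Y) : Prop :=
  exists g : Y -> X,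
    [/\ cancel f g, cancel g f, smooth_map DX DY f & smooth_map DY DX g].

Lemma plot_sub (X : Type) (D : diffeology X) n (U V : set 'rV[R]_n) p :
  open V -> V `<=` U -> plot D U p -> plot D V p.
Proof.
move=> oV VU pp; rewrite -[p]/(p \o idfun).
apply: plot_comp pp => //; apply: smooth_on_lin => x; exact: cvg_id.
Qed.

Section Euclidean.
Variable W : normedModType R.

Definition euclid_plot n (U : set 'rV[R]_n) (p : 'rV[R]_n -> W) : Prop :=
  open U /\ smooth_on U p.

Program Definition euclid : diffeology W :=
  @Diffeology W euclid_plot _ _ _ _ _.
Next Obligation. by move=> n U p []. Qed.
Next Obligation.
by move=> n U p q pq [oU sp]; split=> //; exact: smooth_on_eq pq sp.
Qed.
Next Obligation. by move=> n U x oU; split=> //; exact: smooth_on_cst. Qed.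
Next Obligation.
move=> n U p oU loc; split=> //; apply: smooth_on_loc => x Ux.
by have [U' [U'x _ [? ?]]] := loc _ Ux; exists U'.
Qed.
Next Obligation.
move=> m n V U f p oV sf fVU [oU sp]; split=> //.
exact: smooth_on_comp fVU sf sp.
Qed.

End Euclidean.

Section Constructions.
Variables (X Y : Type) (DX : diffeology X) (DY : diffeology Y).

Definition prod_plot n (U : set 'rV[R]_n) (p : 'rV[R]_n -> X * Y) : Prop :=
  plot DX U (fst \o p) /\ plot DY U (snd \o p).

Program Definition prod_diffeology : diffeology (X * Y) :=
  @Diffeology _ prod_plot _ _ _ _ _.
Next Obligation. by move=> n U p [/plot_open]. Qed.
Next Obligation.
move=> n U p q pq [p1 p2].
by split; [apply: plot_eq p1|apply: plot_eq p2] => u Uu /=; rewrite pq.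
Qed.
Next Obligation. by move=> n U [x y] oU; split; exact: plot_cst. Qed.
Next Obligation.
move=> n U p oU loc; split; apply: plot_loc => // u /loc[U' [? ? [? ?]]];
  by exists U'.
Qed.
Next Obligation.
move=> m n V U f p oV sf fVU [p1 p2].
by split; [exact: plot_comp fVU p1|exact: plot_comp fVU p2].
Qed.

Variable A : set X.

Definition sub_plot n (U : set 'rV[R]_n) (p : 'rV[R]_n -> {x | A x}) : Prop :=
  plot DX U (fun u => sval (p u)).

Program Definition sub_diffeology : diffeology {x | A x} :=
  @Diffeology _ sub_plot _ _ _ _ _.
Next Obligation. by move=> n U p /plot_open. Qed.
Next Obligation.
by move=> n U p q pq; apply: plot_eq => u Uu; rewrite pq.
Qed.
Next Obligation. by move=> n U x oU; exact: plot_cst. Qed.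
Next Obligation. by move=> n U p oU loc; exact: plot_loc. Qed.
Next Obligation.
by move=> m n V U f p oV sf fVU pp; exact: plot_comp sf fVU pp.
Qed.

End Constructions.

(* Plots of a coproduct lie locally in a single summand. *)
Section Coproduct.
Variables (I : Type) (X : I -> Type) (D : forall i, diffeology (X i)).

Definition coprod_plot n (U : set 'rV[R]_n) (p : 'rV[R]_n -> {i & X i}) : Prop :=
  open U /\ forall u, U u -> exists U' i (q : 'rV[R]_n -> X i),
    [/\ U' u, U' `<=` U, plot (D i) U' q &
        forall w, U' w -> p w = existT X i (q w)].

Program Definition coprod_diffeology : diffeology {i & X i} :=
  @Diffeology _ coprod_plot _ _ _ _ _.
Next Obligation. by move=> n U p []. Qed.
Next Obligation.
move=> n U p q pq [oU loc]; split=> // u /loc[U' [i [r [? U'U ? pr]]]].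
by exists U', i, r; split=> // w U'w; rewrite -pq ?pr//; exact: U'U.
Qed.
Next Obligation.
move=> n U [i x] oU; split=> // u Uu; exists U, i, (fun=> x).
by split=> //; exact: plot_cst.
Qed.
Next Obligation.
move=> n U p oU loc; split=> // u /loc[U' [U'u U'U [_ /(_ _ U'u)]]].
move=> [U'' [i [r [? U''U' ? ?]]]]; exists U'', i, r; split=> //.
exact: subset_trans U'U.
Qed.
Next Obligation.
move=> m n V U f p oV sf fVU [oU loc]; split=> // v Vv.
have [U' [i [r [U'fv U'U rp pr]]]] := loc _ (fVU _ Vv).
pose V' := (V `&` f @^-1` U')^°.
have V'V : V' `<=` V `&` f @^-1` U' by exact: interior_subset.
have oV' : open V' by exact: open_interior.
exists V', i, (r \o f); split.
- apply: filterI; first exact: open_nbhs_nbhs.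
  apply: (smooth_on_continuous sf Vv); apply: open_nbhs_nbhs; split=> //.
  exact: plot_open rp.
- by move=> w /V'V[].
- apply: plot_comp rp => // [|w /V'V[]//].
  by apply: smooth_on_sub sf => w /V'V[].
- by move=> w /V'V[_ /pr].
Qed.

End Coproduct.

(* Plots of a quotient are the maps that lift locally along pi. *)
Section Quotient.
Variables (X Y : Type) (D : diffeology X) (pi : X -> Y).

Definition quot_plot n (U : set 'rV[R]_n) (p : 'rV[R]_n -> Y) : Prop :=
  open U /\ forall u, U u -> exists U' (q : 'rV[R]_n -> X),
    [/\ U' u, U' `<=` U, plot D U' q & forall w, U' w -> p w = pi (q w)].

Hypothesis pi_surj : forall y, exists x, pi x = y.

Program Definition quot_diffeology : diffeology Y :=
  @Diffeology _ quot_plot _ _ _ _ _.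
Next Obligation. by move=> n U p []. Qed.
Next Obligation.
move=> n U p q pq [oU loc]; split=> // u /loc[U' [r [? U'U ? pr]]].
by exists U', r; split=> // w U'w; rewrite -pq ?pr//; exact: U'U.
Qed.
Next Obligation.
move=> n U y oU; split=> // u Uu; have [x <-] := pi_surj y.
by exists U, (fun=> x); split=> //; exact: plot_cst.
Qed.
Next Obligation.
move=> n U p oU loc; split=> // u /loc[U' [U'u U'U [_ /(_ _ U'u)]]].
move=> [U'' [r [? U''U' ? ?]]]; exists U'', r; split=> //.
exact: subset_trans U'U.
Qed.
Next Obligation.
move=> m n V U f p oV sf fVU [oU loc]; split=> // v Vv.
have [U' [r [U'fv U'U rp pr]]] := loc _ (fVU _ Vv).
pose V' := (V `&` f @^-1` U')^°.
have V'V : V' `<=` V `&` f @^-1` U' by exact: interior_subset.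
have oV' : open V' by exact: open_interior.
exists V', (r \o f); split.
- apply: filterI; first exact: open_nbhs_nbhs.
  apply: (smooth_on_continuous sf Vv); apply: open_nbhs_nbhs; split=> //.
  exact: plot_open rp.
- by move=> w /V'V[].
- apply: plot_comp rp => // [|w /V'V[]//].
  by apply: smooth_on_sub sf => w /V'V[].
- by move=> w /V'V[_ /pr].
Qed.

End Quotient.

Section Tangent.
Variables (X : Type) (D : diffeology X).

Record plots := Plots {
  plot_dim : nat;
  plot_dom : set 'rV[R]_plot_dim;
  plot_map : 'rV[R]_plot_dim -> X;
  plot_mapP : plot D plot_dom plot_map
}.

Arguments plot_dom : clear implicits.
Arguments plot_map : clear implicits.

Definition pretangent : Type :=
  {p : plots & ({u | plot_dom p u} * 'rV[R]_(plot_dim p))%type}.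

HB.instance Definition _ := gen_eqMixin pretangent.
HB.instance Definition _ := gen_choiceMixin pretangent.

Definition pretangent_diffeology : diffeology pretangent :=
  coprod_diffeology (fun p : plots =>
    prod_diffeology (sub_diffeology (euclid 'rV[R]_(plot_dim p)) (plot_dom p))
                    (euclid 'rV[R]_(plot_dim p))).

Definition mkpretangent (p : plots) (u : 'rV[R]_(plot_dim p)) (pu : plot_dom p u)
    (v : 'rV[R]_(plot_dim p)) : pretangent :=
  existT (fun p : plots => ({u | plot_dom p u} * 'rV[R]_(plot_dim p))%type) p
    (exist (plot_dom p) u pu, v).

Variant tangent_step : pretangent -> pretangent -> Prop :=
  TangentStep (p p' : plots) (f : 'rV[R]_(plot_dim p) -> 'rV[R]_(plot_dim p'))
      (u : 'rV[R]_(plot_dim p)) (pu : plot_dom p u) (pfu : plot_dom p' (f u))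
      (v : 'rV[R]_(plot_dim p)) of
    smooth_on (plot_dom p) f &
    (forall w, plot_dom p w -> plot_dom p' (f w)) &
    (forall w, plot_dom p w -> plot_map p w = plot_map p' (f w)) :
  tangent_step (mkpretangent pu v) (mkpretangent pfu ('d f u v)).

Definition tangent_rel (a b : pretangent) : bool :=
  `[< clos_refl_sym_trans _ tangent_step a b >].

Lemma tangent_rel_refl : reflexive tangent_rel.
Proof. by move=> a; apply/asboolP; exact: rst_refl. Qed.

Lemma tangent_rel_sym : symmetric tangent_rel.
Proof. by move=> a b; apply/asboolP/asboolP; exact: rst_sym. Qed.

Lemma tangent_rel_trans : transitive tangent_rel.
Proof.
move=> b a c /asboolP ab /asboolP bc; apply/asboolP; exact: rst_trans ab bc.
Qed.

Canonical tangent_equiv :=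
  EquivRel tangent_rel tangent_rel_refl tangent_rel_sym tangent_rel_trans.

Definition tangent : Type := {eq_quot tangent_equiv}%qT.

Definition tangent_class (a : pretangent) : tangent :=
  (\pi_({eq_quot tangent_equiv}) a)%qT.

Lemma tangent_classP (a b : pretangent) :
  tangent_class a = tangent_class b <->
  clos_refl_sym_trans _ tangent_step a b.
Proof.
split=> [/eqmodP/asboolP //|ab].
by apply/eqmodP; apply/asboolP.
Qed.

Lemma tangent_class_surj (z : tangent) : exists a, tangent_class a = z.
Proof. by exists (repr z); exact: reprK. Qed.

Definition tangent_diffeology : diffeology tangent :=
  quot_diffeology pretangent_diffeology tangent_class_surj.

End Tangent.

End Diffeology.
Arguments diffeology : clear implicits.

Section DiffVectSpace.
Context {R : realType}.

Record diff_vect_space (V : lmodType R) := DiffVectSpace {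
  dvs_diffeology :> diffeology R V;
  dvs_add_smooth : smooth_map (prod_diffeology dvs_diffeology dvs_diffeology)
    dvs_diffeology (fun z : V * V => z.1 + z.2);
  dvs_scale_smooth : smooth_map (prod_diffeology (euclid R^o) dvs_diffeology)
    dvs_diffeology (fun z : R^o * V => z.1 *: z.2)
}.

Section TangentStable.
Variables (V : lmodType R) (D : diff_vect_space V).

(* R is identified with 'rV_1 through the coordinate t 0 0. *)
Lemma plot_line (u v : V) :
  plot D setT (fun t : 'rV[R]_1 => u + t 0 0 *: v).
Proof.
have oT : open [set: 'rV[R]_1] by exact: openT.
have sv : plot D setT (fun t : 'rV[R]_1 => t 0 0 *: v).
  apply: (dvs_scale_smooth (n := 1) (p := fun t : 'rV[R]_1 => (t 0 0 : R^o, v))).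
  split; last exact: plot_cst.
  by split=> //; exact/(smooth_on_lin (L := coordL 0))/coordL_continuous.
apply: (dvs_add_smooth (n := 1) (p := fun t : 'rV[R]_1 => (u, t 0 0 *: v))).
by split=> //=; exact: plot_cst.
Qed.

(* l(u, v) = [t |-> u + t v]_*(0, 1) *)
Definition ell (z : V * V) : tangent D :=
  tangent_class (@mkpretangent _ _ D (Plots (plot_line z.1 z.2)) 0 I (const_mx 1)).

Definition tangent_stable : Prop :=
  diffeo (prod_diffeology D D) (tangent_diffeology D) ell.

End TangentStable.
End DiffVectSpace.

Section LocallyConvex.
Context {R : realType}.
Variable E : tvsType R.

Definition seminorm (q : E -> R) : Prop :=
  (forall x y, q (x + y) <= q x + q y) /\
  (forall (a : R) x, q (a *: x) = `|a| * q x).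

(* The topology of E is the one defined by its continuous seminorms. *)
Definition lctvs_separated : Prop :=
  forall x : E, (forall q, seminorm q -> continuous q -> q x = 0) -> x = 0.

(* von Neumann boundedness: B is absorbed by every neighbourhood of 0. *)
Definition tvs_bounded (B : set E) : Prop :=
  forall U : set E, nbhs 0 U ->
    \forall r \near +oo, B `<=` ( *:%R (r : R)) @` U.

Definition bounded_seminorm (q : E -> R) : Prop :=
  forall B, tvs_bounded B -> exists M : R, forall x, B x -> q x <= M.

Definition bornological : Prop :=
  forall q, seminorm q -> bounded_seminorm q -> continuous q.

Definition Pi_dual_plot n (U : set 'rV[R]_n) (p : 'rV[R]_n -> E) : Prop :=
  open U /\
  forall l : {linear E -> R^o}, continuous l -> smooth_on U (l \o p).

Program Definition Pi_dual_diffeology : diffeology R E :=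
  @Diffeology _ _ Pi_dual_plot _ _ _ _ _.
Next Obligation. by move=> n U p []. Qed.
Next Obligation.
move=> n U p q pq [oU sp]; split=> // l cl.
by apply: smooth_on_eq (sp l cl) => // u Uu /=; rewrite pq.
Qed.
Next Obligation. by move=> n U x oU; split=> // l _; exact: smooth_on_cst. Qed.
Next Obligation.
move=> n U p oU loc; split=> // l cl; apply: smooth_on_loc => u Uu.
by have [U' [? _ [? /(_ l cl)]]] := loc _ Uu; exists U'.
Qed.
Next Obligation.
move=> m n V U f p oV sf fVU [oU sp]; split=> // l cl.
exact: (smooth_on_comp oV oU fVU sf (sp l cl)).
Qed.

Lemma Pi_dual_add_smooth :
  smooth_map (prod_diffeology Pi_dual_diffeology Pi_dual_diffeology)
    Pi_dual_diffeology (fun z : E * E => z.1 + z.2).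
Proof.
move=> n U p [[oU s1] [_ s2]]; split=> // l cl.
apply: smooth_on_eq (smooth_onD oU (s1 l cl) (s2 l cl)) => // u _.
by rewrite /= linearD.
Qed.

Lemma Pi_dual_scale_smooth :
  smooth_map (prod_diffeology (euclid R^o) Pi_dual_diffeology)
    Pi_dual_diffeology (fun z : R^o * E => z.1 *: z.2).
Proof.
move=> n U p [[oU s1] [_ s2]]; split=> // l cl.
apply: smooth_on_eq (smooth_on_scale oU s1 (s2 l cl)) => // u _.
by rewrite /= linearZ.
Qed.

Definition Pi_dual : diff_vect_space E :=
  DiffVectSpace Pi_dual_add_smooth Pi_dual_scale_smooth.

Definition curve_slope (c : R -> E) (t h : R) : E := h^-1 *: (c (t + h) - c t).

Definition curve_differentiable (c : R -> E) (t : R) : Prop :=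
  exists l : E, curve_slope c t h @[h --> 0^'] --> l.

(* c'(t), with the junk value 0 when the limit does not exist *)
Definition curve_derivative (c : R -> E) (t : R) : E :=
  xget 0 [set l : E | curve_slope c t h @[h --> 0^'] --> l].

Definition smooth_curve (U : set R) (c : R -> E) : Prop :=
  forall k t, U t -> curve_differentiable (iter k curve_derivative c) t.

Lemma curve_slope_cst (x : E) t : curve_slope (fun=> x) t = fun=> 0.
Proof. by apply/funext => h; rewrite /curve_slope subrr scaler0. Qed.

Lemma smooth_curve_cst U (x : E) : smooth_curve U (fun=> x).
Proof.
move=> k t _.
have [y ->] : exists y, iter k curve_derivative (fun=> x) = fun=> y.
  elim: k => [|k [y IH]]; first by exists x.
  rewrite iterS IH /curve_derivative.
  eexists; apply/funext => s; rewrite curve_slope_cst; reflexivity.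
by exists 0; rewrite curve_slope_cst; exact: cvg_cst.
Qed.

Lemma near_eq_curve_slope (c d : R -> E) (t : R) : {near t, c =1 d} ->
  \forall h \near 0^', curve_slope c t h = curve_slope d t h.
Proof.
move=> cd; apply: cvg_within; have := cd; rewrite (near_shift 0 t) => cd'.
apply: filterS cd' => h /=; rewrite subr0 addrC /curve_slope => ->.
by rewrite (nbhs_singleton cd).
Qed.

Lemma near_eq_curve_cvg (c d : R -> E) (t : R) (l : E) : {near t, c =1 d} ->
  curve_slope c t h @[h --> 0^'] --> l -> curve_slope d t h @[h --> 0^'] --> l.
Proof.
move=> cd cl; apply: cvg_trans cl; apply: near_eq_cvg.
exact: near_eq_curve_slope.
Qed.

Lemma smooth_curve_eq U (c d : R -> E) : open U ->
  (forall t, U t -> c t = d t) -> smooth_curve U c -> smooth_curve U d.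
Proof.
move=> oU cd sc k t Ut.
have E1 : forall s, U s ->
    iter k curve_derivative c s = iter k curve_derivative d s.
  elim: k => [|k IH] s Us; first exact: cd.
  rewrite !iterS /curve_derivative; congr xget.
  have N : {near s, iter k curve_derivative c =1 iter k curve_derivative d}.
    by apply: filterS (open_nbhs_nbhs (conj oU Us)); exact: IH.
  apply/seteqP; split=> l /=; apply: near_eq_curve_cvg => //.
  by apply: filterS N => r ->.
have [l cl] := sc k t Ut; exists l; apply: near_eq_curve_cvg cl.
by apply: filterS (open_nbhs_nbhs (conj oU Ut)); exact: E1.
Qed.

Lemma smooth_curve_sub (U V : set R) c :
  V `<=` U -> smooth_curve U c -> smooth_curve V c.
Proof. by move=> VU sc k t /VU; exact: sc. Qed.

Definition Dc_plot n (U : set 'rV[R]_n) (p : 'rV[R]_n -> E) : Prop :=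
  open U /\
  forall (V : set R) (c : R -> 'rV[R]_n),
    open V -> smooth_on (V : set R^o) (c : R^o -> 'rV[R]_n) ->
    (forall t, V t -> U (c t)) -> smooth_curve V (p \o c).

Program Definition Dc : diffeology R E := @Diffeology _ _ Dc_plot _ _ _ _ _.
Next Obligation. by move=> n U p []. Qed.
Next Obligation.
move=> n U p q pq [oU sp]; split=> // V c oV sc cVU.
by apply: smooth_curve_eq (sp V c oV sc cVU) => // t Vt /=; rewrite pq//; exact: cVU.
Qed.
Next Obligation.
by move=> n U x oU; split=> // V c _ _ _; exact: smooth_curve_cst.
Qed.
Next Obligation.
move=> n U p oU loc; split=> // V c oV sc cVU k t Vt.
have [U' [U'ct U'U [oU' sp]]] := loc _ (cVU _ Vt).
pose V' : set R := (V `&` c @^-1` U')^°.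
have V'V : V' `<=` V `&` c @^-1` U' by exact: interior_subset.
have V't : V' t.
  apply: filterI; first exact: open_nbhs_nbhs.
  apply: (smooth_on_continuous sc Vt); exact: open_nbhs_nbhs.
apply: (sp V' c) => //; first exact: open_interior.
  by apply: smooth_on_sub sc => w /V'V[].
by move=> w /V'V[].
Qed.
Next Obligation.
move=> m n V U f p oV sf fVU [oU sp]; split=> // W c oW sc cWV.
apply: (sp W (f \o c)) => // [|t /cWV/fVU//].
exact: (smooth_on_comp oW oV cWV sc sf).
Qed.

(* Convenience; as in the literature, meant for separated E only. *)
Definition convenient : Prop := Dc = Pi_dual.

End LocallyConvex.

(* Main.v *)
From HB Require Import structures.
Require Import Defs.
From mathcomp Require Import all_boot all_order all_algebra.
From mathcomp Require Import all_classical all_reals all_analysis.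
From mathcomp Require Import ring lra.
From Stdlib Require Import Relation_Operators.

(* Call a map into E weakly smooth when it is smooth after composition with every
   continuous functional. Both properties are equivalent to: every weakly smooth
   curve has a derivative in E, tested against the continuous functionals.

   From weak derivatives to convenience. Boman's theorem shows that a plot of Dc is
   weakly smooth. Conversely the second-order remainders of a weakly smooth curve
   are weakly bounded, hence bounded for every continuous seminorm, so that the
   difference quotients converge in E.

   Tangent vectors. The velocity of a tangent vector, tested against a functional,
   only depends on its class; hence ell is injective by Hahn-Banach, and ell being
   surjective produces weak derivatives. If weak derivatives exist, a curve can be
   written c(t) = x + t y + t^2 h(t) with h weakly smooth; it is the restriction of
   (b, s) |-> x + s y + b h(s) to (t^2, t), which is tangent at the origin to (0, t).
   So c and its tangent line define the same class, and ell is onto.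

   Boman's theorem. Let f be smooth along smooth curves. A smooth curve running
   through a fast converging sequence of points with tiny prescribed velocities shows
   that the iterated derivatives of f in one direction are locally bounded. Apply
   this to F(t, s) = f(c(t) + s v): the quotients G_h = (F(., h) - F(., 0)) / h are
   at distance O(h) from d_v f o c, and their derivatives of any order are O(1 / h).
   Landau's inequality interpolates between the two, and all the derivatives of
   G_(2^-n) converge geometrically. So d_v f is smooth along smooth curves again. *)

Set Implicit Arguments.
Unset Strict Implicit.
Unset Printing Implicit Defensive.
Import Order.TTheory GRing.Theory Num.Theory.
Import numFieldNormedType.Exports.
Local Open Scope classical_set_scope.
Local Open Scope ring_scope.
Local Notation "f ^` ()" := (derive1 f) : ring_scope.
Local Notation "f ^` ( n )" := (derive1n n f) : ring_scope.

(** * Smooth functions of one variable *)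

Section Calculus.
Context {R : realType}.

(** Induction on the order of differentiation. The principle spares formulas for iterated
    derivatives: it is enough to name a class of functions that is closed under differentiation up
    to values outside [U]. *)
Lemma smooth_on_coind (V W : normedModType R) (U : set V)
    (P : (V -> W) -> Prop) : open U ->
  (forall f, P f -> (forall x, U x -> differentiable f x) /\
    forall v, exists g, P g /\ forall x, U x -> 'd f x v = g x) ->
  forall f, P f -> smooth_on U f.
Proof.
move=> oU PS f + k; elim: k f => [//|k IH] f /PS[df ddf]; split=> // v.
have [g [/IH sg fg]] := ddf v.
by apply: diff_upto_eq sg => // x /fg ->.
Qed.

Section OneVariable.
Variable W : normedModType R.
Implicit Types (U : set R) (f g : R -> W).

Lemma diff_derive1 f (t v : R) : derivable f t 1 -> 'd f t v = v *: f^`() t.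
Proof.
move=> /derivable1_diffP df; rewrite derive1E'// -[X in 'd f t X]mulr1.
exact: linearZ.
Qed.

(** In one variable the differential at [t] is [v *: g t], so that closure under the ordinary
    derivative suffices. *)
Lemma smooth_on_coind1 U (P : (R -> W) -> Prop) : open U ->
  (forall f, P f -> exists g, P g /\ forall t, U t -> is_derive t 1 f (g t)) ->
  forall f, P f -> smooth_on (U : set R^o) (f : R^o -> W).
Proof.
move=> oU PS f + k; elim: k f => [//|k IH] f /PS[g [/IH sg df]].
split=> [t /df[dft _]|v]; first exact/derivable1_diffP.
apply: (@diff_upto_eq R R^o W _ _ (fun t => v *: g t)) => //.
  move=> t /df[dft gt]; rewrite diff_derive1// derive1E gt //.
by apply: diff_upto_scale => //; exact: diff_upto_cst.
Qed.

Lemma smooth_on_derive1 U f : open U ->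
  smooth_on (U : set R^o) (f : R^o -> W) -> smooth_on (U : set R^o) (f^`() : R^o -> W).
Proof.
move=> oU sf k; have [df /(_ 1)] := sf k.+1.
apply: diff_upto_eq => // t /df dft.
by rewrite derive1E'.
Qed.

Lemma smooth_on_derive1n U f k : open U ->
  smooth_on (U : set R^o) (f : R^o -> W) -> smooth_on (U : set R^o) (f^`(k) : R^o -> W).
Proof. by move=> oU sf; elim: k => // k IH; apply: smooth_on_derive1. Qed.

Lemma smooth_on_derivable U f t : smooth_on (U : set R^o) (f : R^o -> W) -> U t ->
  derivable f t 1.
Proof. by move=> /(_ 1)[df _] /df/derivable1_diffP. Qed.

Lemma smooth_on_is_derive U f k t : open U ->
  smooth_on (U : set R^o) (f : R^o -> W) -> U t ->
  is_derive t 1 (f^`(k)) (f^`(k.+1) t).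
Proof.
move=> oU sf Ut; rewrite derive1nS derive1E; apply/derivableP.
exact: smooth_on_derivable (smooth_on_derive1n k oU sf) Ut.
Qed.

Lemma eq_derive1n U f g k : open U -> (forall t, U t -> f t = g t) ->
  forall t, U t -> f^`(k) t = g^`(k) t.
Proof.
move=> oU fg; elim: k => [//|k IH] t Ut.
rewrite !derive1nS !derive1E; apply: near_eq_derive.
by apply: filterS (open_nbhs_nbhs (conj oU Ut)) => s /IH.
Qed.

End OneVariable.

End Calculus.

(** * Taylor estimates and Landau's inequality *)

Section Interpolation.
Context {R : realType}.

(** The difference quotient is within [|B h|] of [l]. This serves where a derivative comes from an
    estimate and not from a formula: at the origin for [flat], [bumps] and the Euler solutions, and
    for limits of sequences. *)
Lemma is_derive_quadratic (W : normedModType R) (f : R -> W) (t r B : R) (l : W) :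
  0 < r ->
  (forall h, `|h| < r -> `|f (t + h) - f t - h *: l| <= B * h ^+ 2) ->
  is_derive t 1 f l.
Proof.
move=> r0 fB.
have cl : h^-1 *: ((f \o shift t) (h *: (1 : R)) - f t) @[h --> 0^'] --> l.
  apply/cvgrPdist_le => e e0.
  have B0 : 0 < `|B| + 1 by rewrite ltr_wpDl.
  near=> h.
  have hn0 : h != 0 by near: h; exact: nbhs_dnbhs_neq.
  have hr : `|h| < r.
    near: h; apply: dnbhs0_lt => //.
  have hB : `|h| <= e / (`|B| + 1).
    near: h; apply: dnbhs0_le; exact: divr_gt0.
  rewrite /= [h *: 1]mulr1 [h + t]addrC distrC.
  have -> : h^-1 *: (f (t + h) - f t) - l = h^-1 *: (f (t + h) - f t - h *: l).
    by rewrite [RHS]scalerBr scalerA mulVf// scale1r.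
  rewrite normrZ normfV ler_pdivrMl ?normr_gt0//.
  apply: le_trans (fB h hr) _.
  rewrite ler_pdivlMr// in hB.
  apply: le_trans (_ : `|h| * (`|h| * (`|B| + 1)) <= _); last by rewrite ler_wpM2l.
  rewrite mulrA -expr2 real_normK ?num_real// mulrC ler_wpM2l ?sqr_ge0//.
  by rewrite (le_trans (ler_norm _))// lerDl.
split; first by apply/cvg_ex; exists l.
exact/cvg_lim.
Unshelve. all: by end_near. Qed.

Lemma smooth_on_MVT (U : set R) (f : R -> R) (s t : R) : open U ->
  smooth_on (U : set R^o) (f : R^o -> R^o) ->
  (forall x, s <= x <= t \/ t <= x <= s -> U x) ->
  exists x, (s <= x <= t \/ t <= x <= s) /\ f t - f s = f^`() x * (t - s).
Proof.
move=> oU sf.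
wlog st : s t / s <= t => [th|] stU.
  have [/th|ts] := leP s t; first exact.
  have [x [xst e]] : exists x, (t <= x <= s \/ s <= x <= t) /\
      f s - f t = f^`() x * (s - t).
    by apply: th (ltW ts) _ => x [|] ?; apply: stU; [right|left].
  exists x; split; first by case: xst; [right|left].
  by rewrite -opprB e; ring.
have [||x xst e] := @MVT_segment R f f^`() s t st.
- move=> x xst; apply: (smooth_on_is_derive 0 oU sf).
  by apply: stU; left; move: xst; rewrite in_itv/= => /andP[/ltW -> /ltW ->].
- apply: derivable_within_continuous => x; rewrite in_itv/= => xst.
  by apply: smooth_on_derivable sf _; apply: stU; left.
by exists x; split=> //; left; rewrite in_itv/= in xst.
Qed.

(** Two applications of the mean value theorem. They yield the constant [B] instead of the sharp
    [B / 2]; only the quadratic order matters later. *)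
Lemma smooth_on_taylor (U : set R) (f : R -> R) (s t B : R) : open U ->
  smooth_on (U : set R^o) (f : R^o -> R^o) ->
  (forall x, s <= x <= t \/ t <= x <= s -> U x /\ `|f^`(2) x| <= B) ->
  `|f t - f s - (t - s) * f^`() s| <= B * (t - s) ^+ 2.
Proof.
move=> oU sf fB.
have [|x [xst ex]] := smooth_on_MVT (s := s) (t := t) oU sf.
  by move=> x /fB[].
have sub y : s <= y <= x \/ x <= y <= s -> s <= y <= t \/ t <= y <= s.
  by case: xst => /andP[? ?] [|] /andP[? ?]; [left|left|right|right];
    apply/andP; split; lra.
have [|y [yx ey]] :=
    smooth_on_MVT (s := s) (t := x) oU (smooth_on_derive1 oU sf).
  by move=> y /sub/fB[].
have [_ fyB] := fB y (sub y yx); rewrite derive1nS derive1n1 in fyB.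
have -> : f t - f s - (t - s) * f^`() s = f^`()^`() y * ((x - s) * (t - s)).
  by rewrite ex mulrA -ey; ring.
rewrite normrM; apply: ler_pM => //.
rewrite -[leRHS]real_normK ?num_real// expr2 normrM ler_wpM2r//.
case: xst => /andP[sx xt]; first by rewrite !ger0_norm ?subr_ge0 ?lerD2r//; exact: le_trans xt.
by rewrite !ler0_norm ?subr_le0 ?lerN2 ?lerD2r//; exact: le_trans xt.
Qed.

Section Segment.
Variables (a b : R) (U : set R).
Hypotheses (ab : a < b) (oU : open U) (abU : forall x, a <= x <= b -> U x).

Let between_ab (s t x : R) : a <= s <= b -> a <= t <= b ->
  s <= x <= t \/ t <= x <= s -> a <= x <= b.
Proof. by move=> /andP[? ?] /andP[? ?] [|] /andP[? ?]; apply/andP; split; lra. Qed.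

(** The slope of [f] over a step of length [d] is a value [f' x], at most [2 A0 / d]; going from [x]
    back to [t] costs at most [d A2]. *)
Lemma landau_first (f : R -> R) (A0 A2 d : R) :
  smooth_on (U : set R^o) (f : R^o -> R^o) -> 0 < d <= (b - a) / 2 ->
  (forall t, a <= t <= b -> `|f t| <= A0) ->
  (forall t, a <= t <= b -> `|f^`(2) t| <= A2) ->
  forall t, a <= t <= b -> `|f^`() t| <= 2 * A0 / d + d * A2.
Proof.
move=> sf /andP[d0 dab] fA0 fA2 t tab.
(* Since [d] is at most half the length of the segment, one of [t + d] and [t - d] stays inside,
   according to the half that contains [t]. *)
have [s [sab sd]] : exists s, a <= s <= b /\ `|s - t| = d.
  have [tm|tm] := leP t ((a + b) / 2).
    exists (t + d); split; first by move: tab => /andP[? ?]; apply/andP; split; lra.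
    by rewrite [t + d]addrC addrK gtr0_norm.
  exists (t - d); split; first by move: tab => /andP[? ?]; apply/andP; split; lra.
  by rewrite [t - d]addrC addrK normrN gtr0_norm.
have [x [xts fx]] := smooth_on_MVT oU sf
  (fun x xts => abU (between_ab tab sab xts)).
have xab := between_ab tab sab xts.
have [y [ytx fy]] := smooth_on_MVT oU (smooth_on_derive1 oU sf)
  (fun y ytx => abU (between_ab tab xab ytx)).
have yab := between_ab tab xab ytx.
have -> : f^`() t = f^`() x - f^`(2) y * (x - t).
  by rewrite derive1nS derive1n1 -fy; ring.
apply: le_trans (ler_normB _ _) _; apply: lerD.
  rewrite ler_pdivlMr// -sd -normrM -fx.
  by apply: le_trans (ler_normB _ _) _; rewrite mulr_natl mulr2n lerD// fA0.
rewrite normrM mulrC; apply: ler_pM => //; last exact: fA2.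
have : `|x - t| <= `|s - t|.
  case: xts => /andP[tx xs]; [rewrite !ger0_norm ?subr_ge0//|].
  - by rewrite lerD2r.
  - exact: le_trans xs.
  - by rewrite !ler0_norm ?subr_le0 ?lerN2 ?lerD2r//; exact: le_trans xs.
by rewrite sd.
Qed.

(** The bound is an attained value, because the interpolation below is carried out at the point [c]
    where [|f'|] is maximal: the same maximum then occurs on both sides of the inequality. *)
Lemma smooth_on_bounded (f : R -> R) : smooth_on (U : set R^o) (f : R^o -> R^o) ->
  exists2 c, a <= c <= b & forall t, a <= t <= b -> `|f t| <= `|f c|.
Proof.
move=> sf.
have cf : {within `[a, b], continuous (fun t => `|f t|)}.
  have cf : {within `[a, b], continuous f}.
    apply: derivable_within_continuous => x; rewrite in_itv/= => xst.
    by apply: smooth_on_derivable sf _; apply: abU.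
  by move=> x; apply: continuous_comp; [exact: cf|exact: norm_continuous].
have [c cab fc] := EVT_max (ltW ab) cf.
exists c; first by rewrite in_itv/= in cab.
by move=> t tab; apply: fc; rewrite in_itv.
Qed.

(* Landau's inequality for [f] at step [d / (2 K)] bounds [f'] through [f''], and the
   inductive bound of [f''] through [f'] is absorbed with the factor [1 / 2]. *)
Lemma landau_interpolation k (f : R -> R) (A0 Ak d : R) :
  smooth_on (U : set R^o) (f : R^o -> R^o) -> 0 < d <= (b - a) / 2 ->
  (forall t, a <= t <= b -> `|f t| <= A0) ->
  (forall t, a <= t <= b -> `|f^`(k.+2) t| <= Ak) ->
  forall t, a <= t <= b -> `|f^`() t| <= 8 ^+ k.+1 * (A0 / d + d ^+ k.+1 * Ak).
Proof.
elim: k f A0 Ak d => [|k IH] f A0 Ak d sf dab fA0 fAk t tab.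
  have A00 : 0 <= A0 by apply: le_trans (fA0 t tab).
  have Ak0 : 0 <= Ak by apply: le_trans (fAk t tab).
  have d0 : 0 < d by case/andP: dab.
  apply: le_trans (landau_first sf dab fA0 fAk tab) _.
  have := divr_ge0 A00 (ltW d0); have := mulr_ge0 (ltW d0) Ak0.
  by rewrite expr1 -mulrA !expr1; lra.
have d0 : 0 < d by case/andP: dab.
have A00 : 0 <= A0 by apply: le_trans (fA0 t tab).
have Ak0 : 0 <= Ak by apply: le_trans (fAk t tab).
have [c cab fc] := smooth_on_bounded (smooth_on_derive1 oU sf).
apply: le_trans (fc t tab) _.
pose K : R := 8 ^+ k.+1.
have K1 : 1 <= K by apply: exprn_ege1; rewrite ler1n.
have K0 : 0 < K by apply: lt_le_trans K1.
have fA2 s : a <= s <= b -> `|f^`(2) s| <= K * (`|f^`() c| / d + d ^+ k.+1 * Ak).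
  move=> sab; rewrite derive1nS derive1n1.
  have fAk' u : a <= u <= b -> `|f^`()^`(k.+2) u| <= Ak.
    by rewrite -derive1Sn; exact: fAk.
  exact: (IH f^`() _ _ _ (smooth_on_derive1 oU sf) dab fc fAk' s sab).
have d'ab : 0 < d / (2 * K) <= (b - a) / 2.
  rewrite divr_gt0 ?mulr_gt0//=; apply: le_trans (proj2 (andP dab)).
  rewrite ler_pdivrMr ?mulr_gt0// ler_peMr ?(ltW d0)//; lra.
have := landau_first sf d'ab fA0 fA2 cab.
have -> : 2 * A0 / (d / (2 * K)) = 4 * (K * (A0 / d)).
  by field; rewrite (gt_eqF d0) (gt_eqF K0).
have -> : d / (2 * K) * (K * (`|f^`() c| / d + d ^+ k.+1 * Ak)) =
    `|f^`() c| / 2 + d ^+ k.+2 * Ak / 2.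
  by rewrite [d ^+ k.+2]exprS; field; rewrite (gt_eqF d0) (gt_eqF K0).
have -> : (8 : R) ^+ k.+2 = 8 * K by rewrite exprS.
(* Here [|f' c| <= 4 K A0 / d + |f' c| / 2 + d ^+ (k + 2) Ak / 2]; solve for [|f' c|] and use
   [1 <= K]. *)
move=> H.
have d2 : 0 <= d ^+ k.+2 * Ak by rewrite mulr_ge0// exprn_ge0// ltW.
have : 1 * (d ^+ k.+2 * Ak) <= K * (d ^+ k.+2 * Ak) by rewrite ler_wpM2r.
rewrite -mulrA mulrDr; lra.
Qed.

Definition geometric_bound (g : nat -> R -> R) : Prop :=
  exists C s, [/\ 0 < s, s < 1 &
    forall n t, a <= t <= b -> `|g n t| <= C * s ^+ n].

(** Interpolate with the step [s ^+ n * d0], where [s] is the square root of the rate [r]. The term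
    of order 0 becomes [(C / d0) s ^+ n]. The term of order [k + 2], which may grow like [2 ^+ n],
    carries the factor [s ^+ n * (s ^+ k * 2) ^+ n], and [k] is chosen with [s ^+ k * 2 <= 1]. *)
Lemma geometric_bound_derive1 (g : nat -> R -> R) :
  (forall n, smooth_on (U : set R^o) (g n : R^o -> R^o)) ->
  (forall k, exists C : R, forall n t, a <= t <= b ->
    `|(g n)^`(k) t| <= C * 2 ^+ n) ->
  geometric_bound g -> geometric_bound (fun n => (g n)^`()).
Proof.
move=> sg gk [C [r [r0 r1 gC]]].
pose s := Num.sqrt r.
have s0 : 0 < s by rewrite sqrtr_gt0.
have rs : r = s ^+ 2 by rewrite sqr_sqrtr// ltW.
have s1 : s < 1 by rewrite -sqrtr1 ltr_sqrt.
have [k sk] : exists k, s ^+ k * 2 <= 1.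
  have : (fun k => s ^+ k) @ \oo --> 0 by apply: cvg_expr; rewrite gtr0_norm.
  move=> /cvgrPdist_le /(_ 2^-1)[]; first by rewrite invr_gt0.
  move=> k _ /(_ k (leqnn k)); rewrite sub0r normrN ger0_norm; last first.
    by rewrite exprn_ge0// ltW.
  by move=> ?; exists k; lra.
have [Ck gCk] := gk k.+2.
pose d0 := (b - a) / 2.
have d00 : 0 < d0 by rewrite divr_gt0// subr_gt0.
exists (8 ^+ k.+1 * (C / d0 + d0 ^+ k.+1 * Ck)), s; split=> // n t tab.
have C0 : 0 <= C.
  by have := le_trans (normr_ge0 _) (gC 0%N t tab); rewrite expr0 mulr1.
have Ck0 : 0 <= Ck.
  by have := le_trans (normr_ge0 _) (gCk 0%N t tab); rewrite expr0 mulr1.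
have sn0 : 0 < s ^+ n by rewrite exprn_gt0.
have dn : 0 < s ^+ n * d0 <= (b - a) / 2.
  rewrite mulr_gt0//= -/d0 ger_pMl// exprn_ile1// ltW//.
have := landau_interpolation (sg n) dn (gC n) (gCk n) tab.
move=> /le_trans; apply; rewrite -!mulrA ler_wpM2l ?exprn_ge0//.
rewrite mulrDl; apply: lerD.
  have -> : C * (r ^+ n / (s ^+ n * d0)) = C / d0 * s ^+ n.
    by rewrite rs -exprM mulnC exprM; field; rewrite (gt_eqF sn0) (gt_eqF d00).
  by [].
have -> : (s ^+ n * d0) ^+ k.+1 * (Ck * 2 ^+ n) =
    d0 ^+ k.+1 * Ck * s ^+ n * (s ^+ k * 2) ^+ n.
  by rewrite !exprMn -!exprM mulnS [(k * n)%N]mulnC exprD; ring.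
rewrite -[leRHS]mulr1 ler_wpM2l//; last first.
  by rewrite exprn_ile1// mulr_ge0// exprn_ge0// ltW.
by rewrite !mulr_ge0// ?exprn_ge0// ltW.
Qed.

End Segment.
End Interpolation.

(** * Smooth limits of geometrically convergent sequences *)

Section SmoothLimit.
Context {R : realType}.

Lemma smooth_on_scaleB (U : set R) (f g : R -> R) (c : R) : open U ->
  smooth_on (U : set R^o) (f : R^o -> R^o) ->
  smooth_on (U : set R^o) (g : R^o -> R^o) ->
  smooth_on (U : set R^o) ((fun t => c * (f t - g t)) : R^o -> R^o).
Proof.
move=> oU sf sg; apply: (@smooth_on_scale R R^o R^o U (fun=> c)) => //.
  exact: smooth_on_cst.
apply: (@smooth_onD R R^o R^o) => //.
rewrite (_ : (fun x => - g x) = (fun x => (-1 : R^o) *: (g x : R^o))); last first.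
  by apply/funext => x; rewrite scaleN1r.
by apply: (@smooth_on_scale R R^o R^o U (fun=> -1)) => //; exact: smooth_on_cst.
Qed.

Lemma derive1n_scaleB (U : set R) (f g : R -> R) (c : R) k t : open U ->
  smooth_on (U : set R^o) (f : R^o -> R^o) ->
  smooth_on (U : set R^o) (g : R^o -> R^o) -> U t ->
  (fun t => c * (f t - g t))^`(k) t = c * (f^`(k) t - g^`(k) t).
Proof.
move=> oU sf sg; elim: k t => [//|k IH] t Ut.
have -> : (fun t => c * (f t - g t))^`(k.+1) t =
    (fun t => c * (f^`(k) t - g^`(k) t))^`() t.
  by rewrite derive1nS -!derive1n1; exact: (eq_derive1n 1 oU IH Ut).
have df := smooth_on_is_derive k oU sf Ut.
have dg := smooth_on_is_derive k oU sg Ut.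
by rewrite derive1E derive_val.
Qed.

Lemma geometric_increments_bound (x : nat -> R) (C s : R) : 0 < s -> s < 1 ->
  (forall n, `|x n.+1 - x n| <= C * s ^+ n) ->
  forall n m, `|x (n + m)%N - x n| <= C / (1 - s) * s ^+ n.
Proof.
move=> s0 s1 xC n m.
have C0 : 0 <= C by have := le_trans (normr_ge0 _) (xC 0%N); rewrite expr0 mulr1.
have s1' : 0 < 1 - s by rewrite subr_gt0.
(* The factor [1 - s ^+ m] of the finite geometric sum makes the induction on [m] go through. *)
suff H : `|x (n + m)%N - x n| <= C / (1 - s) * s ^+ n * (1 - s ^+ m).
  apply: le_trans H _; rewrite ler_piMr//.
    by rewrite !mulr_ge0// ?invr_ge0 ?exprn_ge0// ltW.
  by rewrite gerBl exprn_ge0// ltW.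
elim: m => [|m IH]; first by rewrite addn0 subrr normr0 expr0 subrr mulr0.
have -> : x (n + m.+1)%N - x n = (x (n + m).+1 - x (n + m)%N) + (x (n + m)%N - x n).
  by rewrite addnS; ring.
apply: le_trans (ler_normD _ _) _.
apply: le_trans (lerD (xC _) IH) _.
rewrite le_eqVlt; apply/orP; left; apply/eqP.
by rewrite exprD exprS; field; rewrite gt_eqF.
Qed.

Lemma geometric_increments_cvg (x : nat -> R) (C s : R) : 0 < s -> s < 1 ->
  (forall n, `|x n.+1 - x n| <= C * s ^+ n) -> cvgn x.
Proof.
move=> s0 s1 xC; apply/cauchy_cvgP/cauchy_exP => e e0.
pose K := C / (1 - s).
have K0 : 0 < `|K| + 1 by rewrite ltr_wpDl.
have : (fun k => s ^+ k) @ \oo --> 0 by apply: cvg_expr; rewrite gtr0_norm.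
move=> /cvgrPdist_lt /(_ (e / (`|K| + 1)))[]; first exact: divr_gt0.
move=> N _ /(_ N (leqnn N)).
rewrite sub0r normrN ger0_norm ?exprn_ge0 ?(ltW s0)// ltr_pdivlMr// => sN.
exists (x N); exists N => // n Nn; rewrite -ball_normE/= distrC.
rewrite -(subnKC Nn); apply: le_lt_trans (geometric_increments_bound s0 s1 xC _ _) _.
apply: le_lt_trans sN; rewrite mulrC ler_wpM2l ?exprn_ge0 ?(ltW s0)//.
by rewrite (le_trans (ler_norm _))// lerDl.
Qed.

Variables (a b : R) (U : set R) (G_ : nat -> R -> R) (G : R -> R).
Hypotheses (ab : a < b) (oU : open U) (abU : forall x, a <= x <= b -> U x).
Hypothesis sG : forall n, smooth_on (U : set R^o) (G_ n : R^o -> R^o).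
Hypothesis G_cvg : exists C : R, forall n t, a <= t <= b ->
  `|G_ n t - G t| <= C * 2^-1 ^+ n.
Hypothesis G_bound : forall k, exists C : R, forall n t, a <= t <= b ->
  `|(G_ n)^`(k) t| <= C * 2 ^+ n.

(** The factor 1 puts the increment in the form [c * (f t - g t)] handled by [smooth_on_scaleB] and
    [derive1n_scaleB]. *)
Let g n t := 1 * (G_ n.+1 t - G_ n t).

Let sg n : smooth_on (U : set R^o) (g n : R^o -> R^o).
Proof. exact: smooth_on_scaleB. Qed.

Let gE n k t : a <= t <= b -> (g n)^`(k) t = (G_ n.+1)^`(k) t - (G_ n)^`(k) t.
Proof.
move=> /abU Ut; rewrite (derive1n_scaleB _ _ oU (sG _) (sG _) Ut); exact: mul1r.
Qed.

Let g_bound k : exists C : R, forall n t, a <= t <= b -> `|(g n)^`(k) t| <= C * 2 ^+ n.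
Proof.
have [C GC] := G_bound k; exists (3 * C) => n t tab; rewrite gE//.
apply: le_trans (ler_normB _ _) _; have := GC n.+1 t tab; have := GC n t tab.
rewrite exprS; lra.
Qed.

Let g_geometric k : geometric_bound a b (fun n => (g n)^`(k)).
Proof.
elim: k => [|k IH].
  have [C GC] := G_cvg; exists (3 / 2 * C), 2^-1; split; [lra|lra|move=> n t tab].
  rewrite derive1n0; have -> : g n t = (G_ n.+1 t - G t) - (G_ n t - G t) by rewrite /g; ring.
  apply: le_trans (ler_normB _ _) _; have := GC n.+1 t tab; have := GC n t tab.
  rewrite exprS; lra.
have := geometric_bound_derive1 ab oU abU
  (fun n => smooth_on_derive1n k oU (sg n)) _ IH.
apply=> j; have [C gC] := g_bound (k + j); exists C => n t tab.
by rewrite /derive1n -iterD addnC; exact: gC.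
Qed.

Let H k t := lim ((G_ n)^`(k) t @[n --> \oo]).

Let H_cvg k t : a <= t <= b -> (G_ n)^`(k) t @[n --> \oo] --> H k t.
Proof.
move=> tab; have [C [s [s0 s1 gC]]] := g_geometric k.
apply: (geometric_increments_cvg s0 s1 (C := C)) => n.
by rewrite -gE//; exact: gC.
Qed.

Let GH_bound k : exists B, forall n t, a <= t <= b -> `|(G_ n)^`(k) t| <= B.
Proof.
have [C [s [s0 s1 gC]]] := g_geometric k; have [D GD] := G_bound k.
exists (D + C / (1 - s)) => n t tab.
have := @geometric_increments_bound (fun n => (G_ n)^`(k) t) C s s0 s1 _ 0 n.
rewrite add0n expr0 mulr1 => H1; have := GD 0%N t tab; rewrite expr0 mulr1 => H2.
rewrite -[X in `|X|](subrK ((G_ 0%N)^`(k) t)) addrC.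
apply: le_trans (ler_normD _ _) _; apply: lerD => //; apply: H1 => m.
by rewrite -gE//; exact: gC.
Qed.

(** The Taylor estimate of [(G_ n)^(k)] has a constant uniform in [n], since the derivatives of
    order [k + 2] are uniformly bounded; hence it survives the limit and identifies [H k.+1] as the
    derivative of [H k]. *)
Let H_quadratic k : exists B, forall t h, a <= t <= b -> a <= t + h <= b ->
  `|H k (t + h) - H k t - h * H k.+1 t| <= B * h ^+ 2.
Proof.
have [B GB] := GH_bound k.+2; exists B => t h tab thab.
pose u n := (G_ n)^`(k) (t + h) - (G_ n)^`(k) t - h * (G_ n)^`(k.+1) t.
have uc : `|u n| @[n --> \oo] --> `|H k (t + h) - H k t - h * H k.+1 t|.
  apply: cvg_norm; apply: cvgB; first by apply: cvgB; exact: H_cvg.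
  by apply: cvgMl_tmp; exact: H_cvg.
apply: (cvgr_to_le uc); apply: nearW => n.
have bw x y z : a <= x <= b -> a <= y <= b -> x <= z <= y \/ y <= z <= x ->
    a <= z <= b.
  by move=> /andP[? ?] /andP[? ?] [|] /andP[? ?]; apply/andP; split; lra.
have := @smooth_on_taylor _ U ((G_ n)^`(k)) t (t + h) B oU
  (smooth_on_derive1n k oU (sG n)).
rewrite [t + h]addrC addrK [h + t]addrC; apply=> x xt; have xab := bw _ _ _ tab thab xt.
by split; [exact: abU|exact: GB].
Qed.

(** The increments decay geometrically at every order by repeated interpolation, so all the
    derivatives converge. The limits [H k] form a class closed under differentiation, and [H 0]
    agrees with [G]. *)
Lemma smooth_limit : smooth_on ([set t | a < t < b] : set R^o) (G : R^o -> R^o).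
Proof.
have oab : open [set t : R | a < t < b].
  rewrite (_ : [set _ | _] = [set` `]a, b[%R]); first exact: itv_open.
  by apply/seteqP; split=> t /=; rewrite in_itv.
apply: (@smooth_on_eq R R^o R^o _ (H 0)) => //.
  move=> t /= /andP[ta tb].
  have tab : a <= t <= b by rewrite !ltW.
  apply/cvg_lim => //; have [C GC] := G_cvg.
  apply/cvgrPdist_le => e e0.
  have K0 : 0 < `|C| + 1 by rewrite ltr_wpDl.
  have : (fun k => 2^-1 ^+ k : R) @ \oo --> 0.
    by apply: cvg_expr; rewrite gtr0_norm; lra.
  move=> /cvgrPdist_lt /(_ (e / (`|C| + 1))) /(_ (divr_gt0 e0 K0)).
  apply: filterS => n; rewrite sub0r normrN ger0_norm ?exprn_ge0//.
  rewrite ltr_pdivlMr// => nC; rewrite derive1n0 distrC.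
  apply: le_trans (GC n t tab) _; apply: le_trans (ltW nC).
  rewrite mulrC ler_wpM2l ?exprn_ge0//.
  by rewrite (le_trans (ler_norm _))// lerDl.
apply: (smooth_on_coind1 (P := fun f => exists k, f = H k)) => //; last by exists 0%N.
move=> _ [k ->]; exists (H k.+1); split; first by exists k.+1.
move=> t /= /andP[ta tb].
have [B HB] := H_quadratic k.
apply: (@is_derive_quadratic _ _ _ t (Num.min (t - a) (b - t)) B).
  by rewrite lt_min !subr_gt0 ta.
move=> h; rewrite lt_min !ltr_norml => /andP[/andP[? ?] /andP[? ?]].
by apply: HB; apply/andP; split; lra.
Qed.

End SmoothLimit.

(** * A special curve *)

Section FlatFunctions.
Context {R : realType}.

Lemma diff_upto_comp1 (V W : normedModType R) k (U : set V) (U' : set R)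
    (f : V -> R^o) (g : R -> W) : open U -> open U' -> (forall x, U x -> U' (f x)) ->
  diff_upto k U f -> diff_upto k (U' : set R^o) (g : R^o -> W) ->
  diff_upto k U (g \o f).
Proof.
move=> oU oU' fU; elim: k g => [//|k IH] g dff [dg ddg].
have [df ddf] := dff.
split=> [x Ux|v]; first exact: differentiable_comp (df _ Ux) (dg _ (fU _ Ux)).
have H : diff_upto k U (fun x => ('d f x v : R^o) *: ((fun y : R^o => 'd g y 1) \o f) x).
  apply: diff_upto_scale => //; first exact: ddf.
  by apply: IH (ddg 1); exact: diff_uptoS.
apply: diff_upto_eq H => // x Ux.
rewrite (diff_comp (df _ Ux) (dg _ (fU _ Ux))) /=.
rewrite -[in RHS](mulr1 ('d f x v : R)); exact/esym/linearZ.
Qed.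

Lemma smooth_on_comp1 (V W : normedModType R) (U : set V) (U' : set R)
    (f : V -> R^o) (g : R -> W) : open U -> open U' -> (forall x, U x -> U' (f x)) ->
  smooth_on U f -> smooth_on (U' : set R^o) (g : R^o -> W) -> smooth_on U (g \o f).
Proof. by move=> oU oU' fU sf sg k; exact: diff_upto_comp1 fU _ _. Qed.

Lemma is_derive_scalel (W : normedModType R) (f : R -> R) (t df : R) (w : W) :
  is_derive t 1 f df -> is_derive t 1 (fun s => f s *: w) (df *: w).
Proof.
move=> [dft dfE].
have [ds sE] := is_diff_scale (proj1 (derivable1_diffP _ _) dft)
  (differentiable_cst w t).
split; first exact/derivable1_diffP.
rewrite deriveE// sE diff_cst /= scaler0 add0r -dfE deriveE//.
exact/derivable1_diffP.
Qed.

(** The exponent [m] is there to make the family stable under differentiation, up to linear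
    combinations. *)
Definition flat (m : nat) (t : R) : R :=
  if 0 < t then t ^- m * expR (- t^-1) else 0.

Lemma flat_le0 m t : t <= 0 -> flat m t = 0.
Proof. by rewrite /flat leNgt => /negbTE ->. Qed.

Lemma flat_ge0 m t : 0 <= flat m t.
Proof.
rewrite /flat; case: ifP => // t0.
by rewrite mulr_ge0 ?expR_ge0// invr_ge0 exprn_ge0// ltW.
Qed.

Lemma expR_ge_monomial n (x : R) : 0 <= x -> x ^+ n / n`!%:R <= expR x.
Proof.
move=> x0; case: n => [|n].
  by rewrite expr0 divr1; apply: le_trans (expR_ge1Dx x); rewrite lerDl.
by apply: le_trans (expR_ge1Dxn n x0); rewrite lerDr.
Qed.

(** The exponential series gives [(1 / t) ^+ (m + j) <= (m + j)! * exp (1 / t)] for positive [t]. *)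
Lemma flat_bound m j : exists2 B, 0 <= B & forall t, 0 <= t -> flat m t <= B * t ^+ j.
Proof.
exists (m + j)`!%:R => [//|t].
rewrite le_eqVlt => /predU1P[<-|t0].
  by rewrite flat_le0// mulr_ge0// exprn_ge0.
have tV : 0 <= t^-1 by rewrite invr_ge0 ltW.
have f0 : 0 < (m + j)`!%:R :> R by rewrite ltr0n fact_gt0.
have := expR_ge_monomial (m + j) tV; rewrite ler_pdivrMr// => H.
have -> : (m + j)`!%:R * t ^+ j = (m + j)`!%:R / t^-1 ^+ j by rewrite exprVn invrK.
rewrite /flat t0 expRN -(exprVn t m) ler_pdivlMr ?exprn_gt0 ?invr_gt0//.
by rewrite mulrAC -exprD ler_pdivrMr ?expR_gt0// mulrC.
Qed.

(** Away from 0 this is the product rule; at 0 the bound by [B * t ^+ 2] forces the derivative 0. *)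
Lemma is_derive_flat m (t : R) :
  is_derive t 1 (flat m) (- m%:R * flat m.+1 t + flat m.+2 t).
Proof.
have [t0|t0|->] := ltgtP t 0.
- rewrite !flat_le0 ?ltW// mulr0 addr0.
  apply: near_eq_is_derive (is_derive_cst 0 t 1).
  near=> s; rewrite flat_le0// ltW//; near: s; exact: lt_nbhsl.
- rewrite /flat t0; have tn0 : t != 0 by rewrite gt_eqF.
  have dV : is_derive t 1 (fun s : R => s^-1) (- t ^- 2).
    apply: is_derive_eq (is_deriveV tn0 (is_derive_id t 1)) _.
    by rewrite /GRing.scale /= mulr1.
  have dE : is_derive t 1 (fun s : R => expR (- s^-1)) (expR (- t^-1) * t ^- 2).
    apply: (@is_derive1_comp _ expR); apply: is_derive_eq; exact: opprK.
  apply: near_eq_is_derive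
    (_ : is_derive t 1 (fun s : R => s^-1 ^+ m * expR (- s^-1)) _).
    by near=> s; rewrite exprVn ifT//; near: s; exact: lt_nbhsr.
  rewrite (_ : (fun s => _) =
      (fun s : R => s^-1) ^+ m * (fun s : R => expR (- s^-1))); last first.
    by apply/funext => s; rewrite !fctE.
  apply: (is_derive_eq (is_deriveM (is_deriveX m dV) dE)).
  rewrite /GRing.scale /= exprfctE.
  case: m => [|m]; rewrite -!exprVn ?expr0 ?exprS /=; ring.
- rewrite !flat_le0// mulr0 addr0.
  have [B B0 HB] := flat_bound m 2.
  apply: (@is_derive_quadratic _ _ _ 0 1 B) => // h _.
  rewrite add0r (flat_le0 _ (lexx 0)) scaler0 !subr0 ger0_norm ?flat_ge0//.
  have [h0|h0] := leP 0 h; first exact: HB.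
  by rewrite (flat_le0 _ (ltW h0)) mulr_ge0// sqr_ge0.
Unshelve. all: by end_near. Qed.

Lemma smooth_on_flat m : smooth_on (setT : set R^o) (flat m : R^o -> R^o).
Proof.
move=> k; elim: k m => [//|k IH] m; split=> [t _|v].
  by apply/derivable1_diffP; have [] := is_derive_flat m t.
have H : diff_upto k (setT : set R^o) ((fun t => (v : R^o) *:
    ((- m%:R : R^o) *: (flat m.+1 t : R^o) + flat m.+2 t)) : R^o -> R^o).
  apply: diff_upto_scale; [exact: openT|exact: diff_upto_cst|].
  apply: diff_uptoD; [exact: openT| |exact: IH].
  by apply: diff_upto_scale; [exact: openT|exact: diff_upto_cst|exact: IH].
apply: diff_upto_eq H => // [|t _]; first exact: openT.
have [dt E] := is_derive_flat m t.
by rewrite diff_derive1// derive1E E.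
Qed.

(* [e * exp (- 1 / (1 - K * flat 0 (s ^+ 2 - 1 / 4)))], with [K] making the inner
   difference negative for [|s| > 3 / 4]. *)
Lemma bump_exists : exists phi : R -> R,
  [/\ smooth_on (setT : set R^o) (phi : R^o -> R^o),
      forall s, `|s| <= 1 / 2 -> phi s = 1 &
      forall s, 3 / 4 < `|s| -> phi s = 0].
Proof.
have oT : open (setT : set R^o) by exact: openT.
(* For [|s| > 3 / 4] one has [s ^+ 2 - 1 / 4 > 5 / 16], where [flat 0] exceeds [exp (- 16 / 5)], the
   inverse of [K]. *)
pose K : R := expR (16 / 5).
pose sq (s : R) : R := s * s - 1 / 4.
pose g (s : R) : R := 1 - K * flat 0 s.
exists (fun s => expR 1 * flat 0 (g (sq s))); split.
- apply: (@smooth_on_scale R R^o R^o _ (fun=> expR 1)) => //.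
    exact: smooth_on_cst.
  apply: (@smooth_on_comp1 R^o R^o _ setT (g \o sq) (flat 0)) => //.
    apply: (@smooth_on_comp1 R^o R^o _ setT sq g) => //.
      apply: (@smooth_onD R R^o R^o) => //; last exact: smooth_on_cst.
      by apply: (@smooth_on_scale R R^o R^o) => //;
        apply: (@smooth_on_lin R R^o R^o idfun) => x; exact: cvg_id.
    apply: (@smooth_onD R R^o R^o) => //; first exact: smooth_on_cst.
    rewrite (_ : (fun x => - (K * flat 0 x)) =
      (fun x => (- K : R^o) *: (flat 0 x : R^o))); last first.
      by apply/funext => x; rewrite -mulNr.
    apply: (@smooth_on_scale R R^o R^o _ (fun=> - K)) => //.
      exact: smooth_on_cst.
    exact: smooth_on_flat.
  exact: smooth_on_flat.
- move=> s s2; rewrite /g [flat 0 (sq s)]flat_le0; last first.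
    rewrite /sq -expr2 -real_normK ?num_real// subr_le0.
    by have := normr_ge0 s; rewrite expr2; nra.
  rewrite mulr0 subr0 /flat ltr01 expr0 invr1 mul1r -expRD.
  by rewrite subrr expR0.
- move=> s s2; have sq0 : 5 / 16 < sq s.
    rewrite /sq -expr2 -[s ^+ 2]real_normK ?num_real// expr2; nra.
  rewrite [flat 0 (g _)]flat_le0 ?mulr0// /g subr_le0.
  have sq1 : 0 < sq s by apply: lt_trans sq0; lra.
  rewrite /flat sq1 expr0 invr1 mul1r -expRD -[leLHS]expR0 ler_expR subr_ge0.
  have e0 : (0 : R) < 5 / 16 by lra.
  by rewrite -(invf_div 5 16) lef_pV2 ?posrE// ltW.
Qed.

End FlatFunctions.

Section SpecialCurve.
Context {R : realType}.

(** The centres accumulate at 0. With radii [tau k / 8], even the doubled interval around one centre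
    misses the intervals around all the others. *)
Definition tau (k : nat) : R := 2^-1 ^+ k.
Definition rho (k : nat) : R := tau k / 8.

Lemma tau_gt0 k : 0 < tau k.
Proof. by rewrite exprn_gt0// invr_gt0. Qed.

Lemma rho_gt0 k : 0 < rho k.
Proof. by rewrite divr_gt0// tau_gt0. Qed.

Lemma tau_le1 k : tau k <= 1.
Proof. by rewrite exprn_ile1//; lra. Qed.

Lemma tau_lt k j : (k < j)%N -> 2 * tau j <= tau k.
Proof.
move=> kj; rewrite /tau -(subnKC kj) addSn exprS mulrA divff// mul1r exprD.
by rewrite ler_piMr ?exprn_ge0// exprn_ile1//; lra.
Qed.

Lemma tau_cvg : tau k @[k --> \oo] --> (0 : R).
Proof. by apply: cvg_expr; rewrite gtr0_norm//; lra. Qed.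

Lemma tau_disjoint t k j : `|t - tau k| < 2 * rho k -> `|t - tau j| < rho j -> j = k.
Proof.
have := tau_gt0 k; have := tau_gt0 j; rewrite /rho !ltr_norml => j0 k0.
move=> /andP[? ?] /andP[? ?].
by have [/tau_lt|/tau_lt|//] := ltngtP j k => ?; exfalso; lra.
Qed.

Section Bumps.
Variable W : normedModType R.
Implicit Types (psi : R -> R) (al : nat -> W).

(* [sum_k psi ((t - tau k) / rho k) *: al k]; at most one term is nonzero. *)
Definition bumps psi al (t : R) : W :=
  let k := xget 0%N [set k | `|t - tau k| < rho k] in
  psi ((t - tau k) / rho k) *: al k.

(** The vanishing is required on an open set, so that it passes to the derivative, and it begins
    before the radius 1 of the intervals. *)
Definition bump_profile psi : Prop :=
  smooth_on (setT : set R^o) (psi : R^o -> R^o) /\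
  forall s, 3 / 4 < `|s| -> psi s = 0.

(** Decay faster than every power of [tau k] survives the division by [rho k] that each
    differentiation produces. *)
Definition rapid al : Prop :=
  forall m, exists C : R, forall k, `|al k| <= C * tau k ^+ m.

Lemma bump_profile_out psi t k : bump_profile psi -> rho k <= `|t - tau k| ->
  psi ((t - tau k) / rho k) = 0.
Proof.
move=> [_ p0] tk; apply: p0; have rk := rho_gt0 k.
rewrite normrM normfV (gtr0_norm rk).
have : 1 <= `|t - tau k| / rho k by rewrite ler_pdivlMr// mul1r.
lra.
Qed.

(** Outside all intervals [xget] falls back on the index 0, whose term vanishes there as well. *)
Lemma bumps_out psi al t : bump_profile psi ->
  (forall k, rho k <= `|t - tau k|) -> bumps psi al t = 0.
Proof. by move=> pp tk; rewrite /bumps bump_profile_out// scale0r. Qed.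

Lemma bumpsE psi al t k : bump_profile psi -> `|t - tau k| < 2 * rho k ->
  bumps psi al t = psi ((t - tau k) / rho k) *: al k.
Proof.
move=> pp tk; rewrite /bumps; case: xgetP => [j _ /= tj|tn].
  by rewrite (tau_disjoint tk tj).
have out j : rho j <= `|t - tau j| by rewrite leNgt; apply/negP/tn.
by rewrite !bump_profile_out// !scale0r.
Qed.

Lemma bump_profile_derive1 psi : bump_profile psi -> bump_profile psi^`().
Proof.
move=> [sp p0]; split; first exact: smooth_on_derive1 openT sp.
have oU : open [set s : R | 3 / 4 < `|s|].
  apply: (@open_comp _ _ (fun s : R => `|s|) [set y | 3 / 4 < y]).
    by move=> x _; exact: norm_continuous.
  exact: open_gt.
move=> s s0; rewrite -derive1n1 (eq_derive1n 1 oU (g := fun=> 0) p0 s0).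
by rewrite derive1n1 derive1_cst.
Qed.

Lemma rapid_rho al : rapid al -> rapid (fun k => (rho k)^-1 *: al k).
Proof.
move=> ra m; have [C aC] := ra m.+1; exists (8 * C) => k.
have tk := tau_gt0 k; have rk := rho_gt0 k.
rewrite normrZ normfV gtr0_norm// ler_pdivrMl//.
have -> : rho k * (8 * C * tau k ^+ m) = C * tau k ^+ m.+1.
  by rewrite /rho exprS; field.
exact: aC.
Qed.

Lemma bump_profile_bounded psi : bump_profile psi ->
  exists2 M, 0 <= M & forall s, `|psi s| <= M.
Proof.
move=> [sp p0].
have [||c _ cM] := @smooth_on_bounded R (-1) 1 setT _ _ psi sp; [lra|by []|].
exists `|psi c| => // s; have [s1|s1] := leP `|s| 1; first by apply: cM; rewrite -ler_norml.
by rewrite p0 ?normr0//; apply: lt_trans s1; lra.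
Qed.

(** Three cases: in a doubled interval the sum is a single term; at 0 the rapid decay gives a
    quadratic bound; at any other point the sum vanishes nearby. *)
Lemma bumps_is_derive psi al (t : R) : bump_profile psi -> rapid al ->
  is_derive t 1 (bumps psi al) (bumps psi^`() (fun k => (rho k)^-1 *: al k) t).
Proof.
move=> pp ra; have pp' := bump_profile_derive1 pp.
have [[k tk]|tN] := pselect (exists k, `|t - tau k| < 2 * rho k).
  have rk := rho_gt0 k; have rn0 : rho k != 0 by rewrite gt_eqF.
  rewrite (bumpsE _ pp' tk) scalerA.
  have oU : open [set s : R | `|s - tau k| < 2 * rho k].
    rewrite (_ : [set _ | _] = ball (tau k) (2 * rho k)); first exact: ball_open.
    by apply/seteqP; split=> s; rewrite -ball_normE /= distrC.
  apply: near_eq_is_derive (_ : is_derive t 1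
      (fun s => psi ((s - tau k) / rho k) *: al k) _).
    by apply: filterS (open_nbhs_nbhs (conj oU tk)) => s sk; rewrite (bumpsE _ pp sk).
  apply: is_derive_scalel.
  have da : is_derive t 1 (fun s : R => (s - tau k) / rho k) (rho k)^-1.
    rewrite (_ : (fun s => _) = (rho k)^-1 *: (id - cst (tau k))); last first.
      by apply/funext => s; rewrite mulrC.
    by apply: is_derive_eq; rewrite subr0 /GRing.scale /= mulr1.
  have [sp _] := pp.
  exact: is_derive1_comp (smooth_on_is_derive 0 openT sp I) da.
have [->|t0] := eqVneq t 0.
  have out0 k : rho k <= `|0 - tau k|.
    by rewrite sub0r normrN gtr0_norm ?tau_gt0// /rho; have := tau_gt0 k; lra.
  have [M M0 pM] := bump_profile_bounded pp; have [C aC] := ra 2.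
  have C0 : 0 <= C.
    by have := le_trans (normr_ge0 _) (aC 0%N); rewrite /tau expr0 expr1n mulr1.
  rewrite (bumps_out _ pp' out0).
  (* In the doubled interval around [tau k] one has [h > 3 / 4 * tau k], hence
     [tau k ^+ 2 <= 4 * h ^+ 2]. *)
  apply: (@is_derive_quadratic _ _ _ 0 1 (M * C * 4)) => // h _.
  rewrite (bumps_out _ pp out0) scaler0 !subr0 add0r.
  have [[k hk]|hN] := pselect (exists k, `|h - tau k| < 2 * rho k); last first.
    rewrite bumps_out// => [|k]; first by rewrite normr0 mulr_ge0 ?sqr_ge0// !mulr_ge0.
    rewrite leNgt; apply/negP => hk; apply: hN; exists k.
    by have := rho_gt0 k; lra.
  rewrite (bumpsE _ pp hk) normrZ -!mulrA ler_pM// (le_trans (aC k))//.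
  rewrite ler_wpM2l//; move: hk; rewrite /rho ltr_norml; have := tau_gt0 k.
  rewrite !expr2; nra.
(* If [|t - s| < |t| / 10] and [|s - tau k| < tau k / 8], then [x = |t - tau k|] satisfies
   [x < (x + tau k) / 10 + tau k / 8], that is [x < tau k / 4 = 2 * rho k], which is excluded. *)
have e0 : 0 < `|t| / 10 by rewrite divr_gt0// normr_gt0.
have far s : `|t - s| < `|t| / 10 -> forall k, rho k <= `|s - tau k|.
  move=> ts k; rewrite leNgt; apply/negP => sk; apply: tN; exists k.
  have tk : `|t - tau k| <= `|t - s| + `|s - tau k|.
    by apply: le_trans (ler_normD _ _); rewrite subrKA.
  have tt : `|t| <= `|t - tau k| + tau k.
    rewrite -[X in _ <= _ + X]gtr0_norm ?tau_gt0//.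
    by apply: le_trans (ler_normD _ _); rewrite subrK.
  move: sk tk tt ts; rewrite /rho; have := tau_gt0 k; lra.
rewrite bumps_out//; last by apply: far; rewrite subrr normr0.
apply: near_eq_is_derive (is_derive_cst (0 : W) t 1).
near=> s; rewrite bumps_out//; apply: far.
by near: s; have := nbhsx_ballx t _ e0; apply: filterS => s; rewrite -ball_normE.
Unshelve. all: by end_near. Qed.

Lemma smooth_on_bumps psi al : bump_profile psi -> rapid al ->
  smooth_on (setT : set R^o) (bumps psi al : R^o -> W).
Proof.
move=> pp ra; apply: (smooth_on_coind1
    (P := fun f => exists psi al, [/\ bump_profile psi, rapid al & f = bumps psi al])).
- exact: openT.
- move=> _ [p [a [pp' ra' ->]]].
  exists (bumps p^`() (fun k => (rho k)^-1 *: a k)); split.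
    exists p^`(), (fun k => (rho k)^-1 *: a k).
    by split=> //; [exact: bump_profile_derive1|exact: rapid_rho].
  by move=> t _; exact: bumps_is_derive.
- by exists psi, al.
Qed.

End Bumps.

Lemma flat_tau_gt0 k : 0 < flat 0 (tau k) :> R.
Proof. by rewrite /flat tau_gt0 expr0 invr1 mul1r expR_gt0. Qed.

(** Two sums of bumps are added to [x]: a plateau [phi] carries the displacements [y k - x], and
    [psi s = s * phi s], equal to [s] for [|s| <= 1 / 2], carries the velocities. The factor [rho k]
    in the second sum cancels the rescaling of time. All coefficients are rapid because [flat 0] is
    flat at 0. *)
Lemma special_curve (W : normedModType R) (x v : W) (y : nat -> W) :
  (forall k, `|y k - x| <= flat 0 (tau k)) ->
  exists c : R -> W,
  [/\ smooth_on (setT : set R^o) (c : R^o -> W), c 0 = x &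
      forall k t, `|t - tau k| < rho k / 2 ->
        c t = y k + (t - tau k) *: (flat 0 (tau k) *: v)].
Proof.
move=> yx; have [phi [sphi phi1 phi0]] := @bump_exists R.
have pp : bump_profile phi by split.
pose psi (s : R) := s * phi s.
have pp' : bump_profile psi.
  split=> [|s s0]; last by rewrite /psi phi0// mulr0.
  apply: (@smooth_on_scale R R^o R^o) => //; first exact: openT.
  by apply: (@smooth_on_lin R R^o R^o idfun) => z; exact: cvg_id.
have r1 : rapid (fun k => y k - x).
  move=> m; have [B B0 HB] := @flat_bound R 0 m; exists B => k.
  by apply: le_trans (yx k) _; apply: HB; rewrite ltW// tau_gt0.
have r2 : rapid (fun k => rho k *: (flat 0 (tau k) *: v)).
  move=> m; have [B B0 HB] := @flat_bound R 0 m; exists (B * `|v|) => k.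
  rewrite /= normrZ (gtr0_norm (rho_gt0 k)) normrZ ger0_norm ?flat_ge0//.
  rewrite mulrA [leRHS]mulrAC ler_wpM2r//.
  apply: le_trans (_ : flat 0 (tau k) <= _); last by apply: HB; rewrite ltW// tau_gt0.
  rewrite ler_piMl ?flat_ge0// /rho; have := tau_le1 k; lra.
exists (fun t => x + (bumps phi (fun k => y k - x) t +
  bumps psi (fun k => rho k *: (flat 0 (tau k) *: v)) t)); split.
- apply: (@smooth_onD R R^o W); [exact: openT|exact: smooth_on_cst|].
  by apply: (@smooth_onD R R^o W);
    [exact: openT|exact: smooth_on_bumps|exact: smooth_on_bumps].
- have out0 k : rho k <= `|0 - tau k|.
    by rewrite sub0r normrN gtr0_norm ?tau_gt0// /rho; have := tau_gt0 k; lra.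
  by rewrite !bumps_out// !addr0.
- move=> k t tk; have rk := rho_gt0 k.
  have tk' : `|t - tau k| < 2 * rho k by apply: lt_trans tk _; lra.
  rewrite (bumpsE _ pp tk') (bumpsE _ pp' tk') /psi.
  rewrite phi1; last first.
    by rewrite normrM normfV (gtr0_norm rk) ler_pdivrMr// ltW// mul1r mulrC.
  rewrite mulr1 scale1r (scalerA ((t - tau k) / rho k)) divfK ?gt_eqF//.
  by rewrite addrA [x + _]addrC subrK.
Qed.

End SpecialCurve.

(** * Boman's theorem *)

Section ArcSmooth.
Context {R : realType}.

(** With [e = 1] this moves the base point of a line; with [e = flat 0 (tau k)] it computes
    derivatives along the special curve. *)
Lemma smooth_on_affine (W : normedModType R) (U : set R) (g : R -> W) (e a : R) :
  open U -> smooth_on (U : set R^o) (g : R^o -> W) ->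
  smooth_on ([set t | U (e * (t - a))] : set R^o)
    ((fun t => g (e * (t - a))) : R^o -> W) /\
  open [set t | U (e * (t - a))] /\
  forall m t, U (e * (t - a)) ->
    (fun t => g (e * (t - a)))^`(m) t = e ^+ m *: g^`(m) (e * (t - a)).
Proof.
move=> oU sg.
have sa : smooth_on (setT : set R^o) ((fun t => e * (t - a)) : R^o -> R^o).
  apply: (@smooth_on_scale R R^o R^o _ (fun=> e)); first exact: openT.
    exact: smooth_on_cst.
  apply: (@smooth_onD R R^o R^o); [exact: openT| |exact: smooth_on_cst].
  by apply: (@smooth_on_lin R R^o R^o idfun) => z; exact: cvg_id.
have oU' : open [set t | U (e * (t - a))].
  apply: (@open_comp R R (fun t => e * (t - a))) => // t _.
  exact: (smooth_on_continuous sa).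
split; last split=> // m.
  apply: (@smooth_on_comp1 R R^o W _ U (fun t => e * (t - a)) g) => //.
  by apply: smooth_on_sub sa.
elim: m => [|m IH] t Ut; first by rewrite expr0 scale1r.
rewrite derive1nS -derive1n1 (eq_derive1n 1 oU' IH Ut) derive1n1 derive1E.
have da : is_derive t 1 (fun s : R => e * (s - a)) e.
  rewrite (_ : (fun s => _) = e *: (id - cst a)); last exact/funext.
  by apply: is_derive_eq; rewrite subr0 /GRing.scale /= mulr1.
have dg := smooth_on_is_derive m oU sg Ut.
have dga : is_derive t 1 (fun s => g^`(m) (e * (s - a))) (e *: g^`(m.+1) (e * (t - a))).
  have [dgd dgE] := dg; have [dad daE] := da.
  have dgd' := proj1 (derivable1_diffP _ _) dgd.
  have dad' := proj1 (derivable1_diffP _ _) dad.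
  have dc := differentiable_comp dad' dgd'.
  split; first exact/derivable1_diffP.
  rewrite deriveE// (diff_comp dad' dgd') /= -[X in 'd _ _ X]deriveE// daE.
  by rewrite diff_derive1// -derive1nS.
have dga' : is_derive t 1 (fun s => e ^+ m *: g^`(m) (e * (s - a)))
    (e ^+ m *: (e *: g^`(m.+1) (e * (t - a)))).
  exact: is_deriveZ.
by rewrite derive_val scalerA -exprSr.
Qed.

Section General.
Variable V : normedModType R.
Implicit Types (U : set V) (f : V -> R).

Definition arc_smooth U f : Prop := forall (I : set R) (c : R -> V), open I ->
  smooth_on (I : set R^o) (c : R^o -> V) -> (forall t, I t -> U (c t)) ->
  smooth_on (I : set R^o) ((f \o c) : R^o -> R^o).

Definition dirder m f (v x : V) : R := (fun t => f (x + t *: v))^`(m) 0.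

Lemma smooth_on_line (U : set R) (x v : V) :
  smooth_on (U : set R^o) ((fun t => x + t *: v) : R^o -> V).
Proof.
apply: (smooth_on_sub (U := setT)) => //.
apply: (@smooth_onD R R^o V); [exact: openT|exact: smooth_on_cst|].
apply: (@smooth_on_scale R R^o V); [exact: openT| |exact: smooth_on_cst].
by apply: (@smooth_on_lin R R^o R^o idfun) => z; exact: cvg_id.
Qed.

Lemma open_smooth_preimage (T : normedModType R) (U' : set T) U (p : T -> V) :
  open U' -> open U -> smooth_on U' p -> open (U' `&` p @^-1` U).
Proof.
move=> oU' oU sp; rewrite openE => x [U'x Upx]; apply: filterI.
  exact: open_nbhs_nbhs.
by apply: (smooth_on_continuous sp U'x); exact: open_nbhs_nbhs.
Qed.

Lemma open_line U (x v : V) : open U -> open [set t : R | U (x + t *: v)].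
Proof.
move=> oU; have := open_smooth_preimage (@openT R^o) oU (@smooth_on_line setT x v).
by rewrite setTI.
Qed.

Lemma arc_smooth_line U f (x v : V) : open U -> arc_smooth U f ->
  smooth_on ([set t | U (x + t *: v)] : set R^o) ((fun t => f (x + t *: v)) : R^o -> R^o).
Proof.
move=> oU sf; apply: (sf _ (fun t => x + t *: v)) => //; first exact: open_line.
exact: smooth_on_line.
Qed.

Lemma dirder_line U f m (x v : V) (t : R) : open U -> arc_smooth U f ->
  U (x + t *: v) -> dirder m f v (x + t *: v) = (fun s => f (x + s *: v))^`(m) t.
Proof.
move=> oU sf Ut; have sl := arc_smooth_line x v oU sf.
have oL : open [set t : R | U (x + t *: v)] := open_line oU.
have [_ [_ /(_ m 0)]] := smooth_on_affine 1 (- t) oL sl.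
rewrite opprK add0r mul1r => /(_ Ut); rewrite expr1n scale1r => <-.
congr (derive1n m _ 0); apply/funext => s.
by rewrite mul1r scalerDl [s *: v + _]addrC addrA.
Qed.

(** The counterexamples are chosen so close to [x] that [special_curve] can run through them. *)
Lemma not_near_sequence U (P : V -> nat -> Prop) x : open U -> U x ->
  (forall k, ~ \forall y \near x, P y k) ->
  exists y : nat -> V, forall k,
    [/\ U (y k), `|y k - x| <= flat 0 (tau k) & ~ P (y k) k].
Proof.
move=> oU Ux nP; suff /choice[y Hy] : forall k, exists y,
    [/\ U y, `|y - x| <= flat 0 (tau k) & ~ P y k] by exists y.
move=> k; apply: contrapT => H; apply: (nP k); near=> y.
apply: contrapT => nPy; apply: H; exists y; split=> //.
  by near: y; exact: open_nbhs_nbhs.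
rewrite distrC; near: y.
have := nbhsx_ballx x _ (@flat_tau_gt0 R k).
by apply: filterS => y; rewrite -ball_normE => /ltW.
Unshelve. all: by end_near. Qed.

(** A discontinuity would give bad points [y k]; the special curve through them with velocity 0
    reaches [y k] at time [tau k], against the continuity of [f \o c] at 0. *)
Lemma arc_smooth_continuous U f x : open U -> arc_smooth U f -> U x ->
  {for x, continuous f}.
Proof.
move=> oU sf Ux; apply/cvgrPdist_lt => e e0; apply: contrapT => nf.
have [y Hy] := not_near_sequence oU Ux (fun=> nf).
have yx k : `|y k - x| <= flat 0 (tau k) by case: (Hy k).
have [c [sc c0 cy]] := special_curve 0 yx.
have oI := open_smooth_preimage (@openT R^o) oU sc; rewrite setTI in oI.
have sfc : smooth_on (c @^-1` U : set R^o) ((f \o c) : R^o -> R^o).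
  by apply: sf => //; apply: smooth_on_sub sc.
have I0 : (c @^-1` U) 0 by rewrite /= c0.
have := smooth_on_continuous sfc I0.
move=> /cvgrPdist_lt /(_ e e0) /tau_cvg [k _ /(_ k (leqnn k))] /=.
have -> : c (tau k) = y k.
  have k2 : 0 < rho k / 2 :> R by apply: divr_gt0 (rho_gt0 k) _.
  by rewrite (cy k) subrr ?normr0// scale0r addr0.
rewrite c0 => fe.
by have [_ _] := Hy k; apply.
Qed.

(* If not, a smooth curve passes with velocity [eps_k] along [v] through points [y k]
   where the derivative exceeds [k / eps_k ^+ m], with [eps_k = flat 0 (tau k)]. *)
Lemma dirder_locally_bounded U f m x v : open U -> arc_smooth U f -> U x ->
  exists B : R, \forall y \near x, `|dirder m f v y| <= B.
Proof.
move=> oU sf Ux; apply: contrapT => nB.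
have [k nk|y Hy] := not_near_sequence
    (P := fun y k => `|dirder m f v y| <= k%:R / flat 0 (tau k) ^+ m) oU Ux.
  by apply: nB; exists (k%:R / flat 0 (tau k) ^+ m).
have yx k : `|y k - x| <= flat 0 (tau k) by case: (Hy k).
have [c [sc c0 cy]] := special_curve v yx.
have oI := open_smooth_preimage (@openT R^o) oU sc; rewrite setTI in oI.
have sfc : smooth_on (c @^-1` U : set R^o) ((f \o c) : R^o -> R^o).
  by apply: sf => //; apply: smooth_on_sub sc.
have I0 : (c @^-1` U) 0 by rewrite /= c0.
(* The derivative of order [m] of [f \o c] is continuous at 0, hence bounded by [B] at late times
   [tau k]; a late [k] above [B] contradicts the choice of [y k]. *)
have := smooth_on_continuous (smooth_on_derive1n m oI sfc) I0.
move=> /cvgrPdist_lt /(_ 1 ltr01) /tau_cvg near1.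
pose B := `|(f \o c)^`(m) 0| + 1.
have [k [k1 kB]] : exists k, `|(f \o c)^`(m) 0 - (f \o c)^`(m) (tau k)| < 1 /\ B <= k%:R.
  have [N _ HN] := near1; have [M MB] : exists M : nat, B <= M%:R.
    by exists (Num.bound B); rewrite ltW// archi_boundP// addr_ge0.
  exists (maxn N M); split; first by apply: HN; exact: leq_maxl.
  by apply: le_trans MB _; rewrite ler_nat leq_maxr.
have [Uy _] := Hy k; apply; have fk := @flat_tau_gt0 R k.
rewrite ler_pdivlMr ?exprn_gt0//.
(* Near [tau k] the curve is a line with velocity [flat 0 (tau k) *: v], so that [m] derivatives
   bring out the factor [flat 0 (tau k) ^+ m]. *)
have <- : `|(f \o c)^`(m) (tau k)| = `|dirder m f v (y k)| * flat 0 (tau k) ^+ m.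
  have sl := arc_smooth_line (y k) v oU sf.
  have [_ [_ /(_ m (tau k))]] := smooth_on_affine (flat 0 (tau k)) (tau k) (open_line oU) sl.
  rewrite subrr mulr0 /= scale0r addr0 => /(_ Uy) E.
  rewrite mulrC -[X in X * _]gtr0_norm ?exprn_gt0// -normrM; congr (`|_|).
  rewrite -[RHS]E.
  have oJ : open (ball (tau k : R) (rho k / 2)) by exact: ball_open.
  apply: (eq_derive1n m oJ); last first.
    by apply: ballxx; exact: divr_gt0 (rho_gt0 k) _.
  move=> t; rewrite -ball_normE /= distrC => /cy ->.
  by rewrite scalerA mulrC.
apply: le_trans kB; rewrite /B -[X in `|X|](subrK ((f \o c)^`(m) 0)) addrC.
by apply: le_trans (ler_normD _ _) _; rewrite lerD2l distrC ltW.
Qed.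

End General.

End ArcSmooth.

(** * Smoothness of directional derivatives along curves *)

Section DirectionalDerivative.
Context {R : realType}.

Lemma compact_locally_bounded (T : topologicalType) (K : set T) (g : T -> R) :
  compact K -> (forall x, K x -> exists B : R, \forall y \near x, `|g y| <= B) ->
  exists B : R, forall y, K y -> `|g y| <= B.
Proof.
move=> /compact_near_coveringP cK gB.
have [|B [_ HB]] := cK R +oo%R (fun i y => `|g y| <= i) _.
  move=> x /gB[B gB']; exists ([set y | `|g y| <= B], [set i | B <= i]).
    by split=> //=; exact: nbhs_pinfty_ge (num_real B).
  by move=> [y i] /= [gy iB]; exact: le_trans gy iB.
exists (B + 1); by apply: HB; rewrite ltrDl.
Qed.

Variables (V : normedModType R) (U : set V) (f : V -> R).
Hypotheses (oU : open U) (sf : arc_smooth U f).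

Section Curve.
Variables (I : set R) (c : R -> V) (v : V).
Hypotheses (oI : open I) (sc : smooth_on (I : set R^o) (c : R^o -> V)).

Let F (w : R^o * R^o) : R := f (c w.1 + w.2 *: v).
Let I2 : set (R^o * R^o) := [set w | I w.1].
Let p (w : R^o * R^o) : V := c w.1 + w.2 *: v.
Let W : set (R^o * R^o) := I2 `&` p @^-1` U.

Let smooth_on_pair (J : set R) (g : R -> R^o * R^o) : open J ->
  smooth_on (J : set R^o) (g : R^o -> R^o * R^o) ->
  (forall t, J t -> W (g t)) ->
  smooth_on (J : set R^o) ((F \o g) : R^o -> R^o).
Proof.
move=> oJ sg JW.
have cfst : continuous (fst : R^o * R^o -> R^o) by move=> x; exact: cvg_fst.
have csnd : continuous (snd : R^o * R^o -> R^o) by move=> x; exact: cvg_snd.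
have s1 : smooth_on (J : set R^o) ((fun t => (g t).1) : R^o -> R^o).
  by move=> k; exact: (diff_upto_lin_comp (L := fst) oJ cfst (sg k)).
have s2 : smooth_on (J : set R^o) ((fun t => (g t).2) : R^o -> R^o).
  by move=> k; exact: (diff_upto_lin_comp (L := snd) oJ csnd (sg k)).
apply: (sf (c := fun t => c (g t).1 + (g t).2 *: v)) => //; last first.
  by move=> t /JW[].
apply: (@smooth_onD R R^o V) => //.
  by apply: (@smooth_on_comp1 R R^o V _ I (fun t => (g t).1) c) => // t /JW[].
by apply: (@smooth_on_scale R R^o V) => //; exact: smooth_on_cst.
Qed.

Let oW : open W.
Proof.
have oI2 : open I2 by apply: open_comp => // w _; exact: cvg_fst.
apply: open_smooth_preimage => //.
apply: (@smooth_onD R _ V) => //.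
  apply: (@smooth_on_comp1 R (R^o * R^o)%type V _ I fst c) => //.
  by apply: smooth_on_lin => w; exact: cvg_fst.
apply: (@smooth_on_scale R (R^o * R^o)%type V) => //; last exact: smooth_on_cst.
by apply: (smooth_on_lin (L := snd)) => w; exact: cvg_snd.
Qed.

Let sF : arc_smooth W F.
Proof. by move=> J g oJ sg JW; exact: smooth_on_pair. Qed.

(** [smooth_limit] is applied to the quotients in [s] of [F]. Bounds on its second derivative in [s]
    control the distance to the limit, and bounds on its derivatives in [t], divided by [h n],
    control the growth. *)
Lemma smooth_on_dirder1_curve t0 : I t0 -> U (c t0) ->
  exists2 d, 0 < d & smooth_on ([set t | t0 - d < t < t0 + d] : set R^o)
    ((fun t => dirder 1 f v (c t)) : R^o -> R^o).
Proof.
move=> It0 Ut0.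
have W0 : W (t0, 0) by split=> //=; rewrite /p /= scale0r addr0.
have /nbhs_ballP[r /= r0 rW] : nbhs (t0 : R^o, 0 : R^o) W.
  by apply: open_nbhs_nbhs; split.
have {}rW t s : `|t0 - t| < r -> `|s| < r -> W (t, s).
  move=> tr sr; apply: rW; split; rewrite /= -ball_normE//=.
  by rewrite sub0r normrN.
pose d := r / 2; have d0 : 0 < d by rewrite divr_gt0.
have dr : d < r by rewrite /d; lra.
exists d => //; set a := t0 - d; set b := t0 + d.
have ab : a < b by rewrite /a /b; lra.
pose J := [set t : R | `|t0 - t| < r].
have JE : J = ball t0 r by apply/seteqP; split=> t; rewrite /J -ball_normE.
have oJ : open J by rewrite JE; exact: ball_open.
have abJ t : a <= t <= b -> J t.
  by rewrite /a /b /J /= => /andP[? ?]; apply: le_lt_trans dr; rewrite ler_norml; lra.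
(* On this compact rectangle the local bounds of the directional derivatives of [F] become
   uniform. *)
pose Q := [set w : R^o * R^o | [set` `[a, b]%R] w.1 /\ [set` `[0, d]%R] w.2].
have cQ : compact Q.
  exact: (compact_setX (@segment_compact R a b) (@segment_compact R 0 d)).
have QW w : Q w -> W w.
  case: w => t s [/=]; rewrite !in_itv /= => tab /andP[s0 sd].
  by apply: rW; [exact: abJ|rewrite ger0_norm//; exact: le_lt_trans dr].
have bound m u : exists B : R, forall t s, a <= t <= b -> 0 <= s <= d ->
    `|dirder m F u (t, s)| <= B.
  have [|B HB] := compact_locally_bounded (g := dirder m F u) cQ.
    by move=> x /QW Wx; exact: dirder_locally_bounded oW sF Wx.
  by exists B => t s tab sd; apply: HB; split; rewrite /= in_itv.
pose e1 : R^o * R^o := (1, 0); pose e2 : R^o * R^o := (0, 1).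
have ptE (t s : R) : (0, s) + t *: e1 = (t, s) :> R^o * R^o.
  by congr pair; rewrite /= ?add0r ?scaler0 ?addr0//; exact: mulr1.
have ptE' (t s : R) : (t, 0) + s *: e2 = (t, s) :> R^o * R^o.
  by congr pair; rewrite /= ?add0r ?scaler0 ?addr0//; exact: mulr1.
have sJ s : `|s| < r -> smooth_on (J : set R^o) ((fun t => F (t, s)) : R^o -> R^o).
  move=> sr; have sl := arc_smooth_line ((0, s) : R^o * R^o) e1 oW sF.
  have -> : (fun t => F (t, s)) = (fun t => F ((0, s) + t *: e1)).
    by apply/funext => t; rewrite ptE.
  by apply: smooth_on_sub sl => t tr /=; rewrite ptE; exact: rW.
have dJ m t s : J t -> `|s| < r ->
    dirder m F e1 (t, s) = (fun t => F (t, s))^`(m) t.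
  move=> Jt sr; rewrite -{1}ptE (dirder_line _ oW sF); last first.
    by rewrite ptE; exact: rW.
  by congr (derive1n m _ t); apply/funext => t'; rewrite ptE.
pose J' := [set s : R | `|s| < r].
have JE' : J' = ball 0 r.
  by apply/seteqP; split=> s; rewrite /J' -ball_normE /= sub0r normrN.
have oJ' : open J' by rewrite JE'; exact: ball_open.
have sJ' t : J t -> smooth_on (J' : set R^o) ((fun s => F (t, s)) : R^o -> R^o).
  move=> Jt; have sl := arc_smooth_line ((t, 0) : R^o * R^o) e2 oW sF.
  have -> : (fun s => F (t, s)) = (fun s => F ((t, 0) + s *: e2)).
    by apply/funext => s; rewrite ptE'.
  by apply: smooth_on_sub sl => s sr /=; rewrite ptE'; exact: rW.
have dJ' m t s : J t -> `|s| < r ->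
    dirder m F e2 (t, s) = (fun s => F (t, s))^`(m) s.
  move=> Jt sr; rewrite -{1}ptE' (dirder_line _ oW sF); last first.
    by rewrite ptE'; exact: rW.
  by congr (derive1n m _ s); apply/funext => s'; rewrite ptE'.
(* These steps stay in [[0, d]], and halving them matches the rates [2^-n] and [2^n] of
   [smooth_limit]. *)
pose h n : R := d * 2^-1 ^+ n.
have h0 n : 0 < h n by rewrite mulr_gt0// exprn_gt0// invr_gt0.
have hd n : h n <= d by rewrite ler_piMr ?(ltW d0)// exprn_ile1//; lra.
have hr n : `|h n| < r by rewrite gtr0_norm//; exact: le_lt_trans dr.
have r0' : `|0 : R| < r by rewrite normr0.
pose G_ n t := (h n)^-1 * (F (t, h n) - F (t, 0)).
apply: (@smooth_limit R a b J G_) => //.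
- by move=> n; apply: smooth_on_scaleB => //; exact: sJ.
- have [B HB] := bound 2%N e2; exists (B * d) => n t tab.
  have Jt := abJ t tab.
  have bw x : 0 <= x <= h n -> 0 <= x <= d.
    by move=> /andP[-> xh]; exact: le_trans (hd n).
  have bw' x : 0 <= x <= h n -> J' x.
    by move=> /bw/andP[x0 xd]; rewrite /J' /= ger0_norm//; exact: le_lt_trans dr.
  have E : G_ n t - dirder 1 f v (c t) =
      (h n)^-1 * (F (t, h n) - F (t, 0) - h n * (fun s => F (t, s))^`() 0).
    by rewrite mulrBr mulKf ?gt_eqF.
  rewrite E normrM normfV (gtr0_norm (h0 n)) ler_pdivrMl//.
  have -> : h n * (B * d * 2^-1 ^+ n) = B * h n ^+ 2.
    by rewrite /h; ring.
  have := @smooth_on_taylor _ J' (fun s => F (t, s)) 0 (h n) B oJ' (sJ' t Jt).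
  rewrite [h n - 0]subr0; apply=> x xh.
  have {}xh : 0 <= x <= h n.
    case: xh => // /andP[hx x0].
    by have := lt_le_trans (h0 n) (le_trans hx x0); rewrite ltxx.
  have J'x := bw' x xh; split=> //.
  by rewrite -dJ'//; apply: HB => //; exact: bw.
- move=> k; have [B HB] := bound k e1; exists (2 * B / d) => n t tab.
  have Jt := abJ t tab.
  rewrite (derive1n_scaleB _ _ oJ (sJ _ (hr n)) (sJ _ r0') Jt).
  rewrite -(dJ k t _ Jt (hr n)) -(dJ k t _ Jt r0') normrM normfV.
  rewrite (gtr0_norm (h0 n)) ler_pdivrMl//.
  have -> : h n * (2 * B / d * 2 ^+ n) = B + B.
    rewrite /h exprVn; field.
    by rewrite (gt_eqF d0) expf_eq0 pnatr_eq0 andbF.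
  apply: le_trans (ler_normB _ _) _; apply: lerD; apply: HB => //.
    by rewrite ltW//= hd.
  by rewrite lexx ltW.
Qed.

End Curve.

Lemma arc_smooth_dirder1 v : arc_smooth U (dirder 1 f v).
Proof.
move=> I c oI sc cU; apply: smooth_on_loc => t It.
have [d d0 sd] := smooth_on_dirder1_curve v oI sc It (cU t It).
exists [set s | t - d < s < t + d]; split=> //=; last by apply/andP; split; lra.
rewrite (_ : [set _ | _] = [set` `]t - d, t + d[%R]); first exact: itv_open.
by apply/seteqP; split=> s /=; rewrite in_itv.
Qed.

End DirectionalDerivative.

(** * From continuous partial derivatives to smoothness *)

Section Boman.
Context {R : realType}.

Lemma differentiable_approx (V W : normedModType R) (f : V -> W)
    (L : {linear V -> W}) (x : V) : continuous L ->
  (forall e : R, 0 < e -> \forall h \near 0, `|f (x + h) - f x - L h| <= e * `|h|) ->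
  differentiable f x /\ 'd f x = L :> (V -> W).
Proof.
move=> cL fL.
have fLo : f \o shift x = cst (f x) + L +o_ 0 id.
  apply/eqaddoP => e /fL; apply: filterS => h.
  rewrite !fctE /= [h + x]addrC.
  by rewrite (_ : f x + L h = L h + f x) ?opprD ?addrA 1?addrAC// addrC.
have dL : 'd f x = L :> (V -> W) by exact: diff_unique.
by split=> //; apply/diff_locallyP; rewrite dL.
Qed.

Variable n : nat.
Implicit Types (U : set 'rV[R]_n) (f : 'rV[R]_n -> R) (x h : 'rV[R]_n).

Lemma norm_coord_le h (i : 'I_n) : `|h 0 i| <= `|h|.
Proof.
rewrite [leRHS]mx_normrE; exact: (le_bigmax _ (fun ij => `|h ij.1 ij.2|) (0, i)).
Qed.

Lemma norm_row_le h (e : R) : 0 <= e -> (forall i, `|h 0 i| <= e) -> `|h| <= e.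
Proof.
move=> e0 he; have [h0|/mx_norm_neq0[[i j] hE]] := eqVneq (mx_norm h) 0.
  by rewrite [leLHS]h0.
by rewrite [leLHS]hE /= (ord1 i).
Qed.

Lemma near_forall_ord (P : 'I_n -> 'rV[R]_n -> Prop) x :
  (forall i, \forall y \near x, P i y) -> \forall y \near x, forall i, P i y.
Proof.
move=> nP; suff H : forall s : seq 'I_n, \forall y \near x, forall i, i \in s -> P i y.
  by apply: filterS (H (enum 'I_n)) => y Py i; apply: Py; rewrite mem_enum.
elim=> [|i s IH]; first by apply: (@filterE _ (nbhs x)) => y i; rewrite in_nil.
apply: filterS2 (nP i) IH => y Pi Ps j; rewrite inE => /predU1P[->//|]; exact: Ps.
Qed.

(** As [k] grows these are the corners of a path from 0 to [h] that changes one coordinate at a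
    time. *)
Definition truncate (k : nat) h : 'rV[R]_n := \row_i (if (i < k)%N then h 0 i else 0).

Lemma truncate0 h : truncate 0 h = 0.
Proof. by apply/rowP => i; rewrite !mxE. Qed.

Lemma truncate_full h : truncate n h = h.
Proof. by apply/rowP => i; rewrite !mxE ltn_ord. Qed.

Lemma truncateS h (j : 'I_n) :
  truncate j.+1 h = truncate j h + h 0 j *: delta_mx 0 j.
Proof.
apply/rowP => i; rewrite !mxE eqxx /=; have [->|ij] := eqVneq i j.
  by rewrite ltnSn ltnn add0r mulr1.
by rewrite mulr0 addr0 ltnS leq_eqVlt (inj_eq val_inj) (negbTE ij).
Qed.

Lemma truncate_norm h (j : 'I_n) (s : R) : `|s| <= `|h 0 j| ->
  `|truncate j h + s *: delta_mx 0 j| <= `|h|.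
Proof.
move=> sh; apply: norm_row_le => // i; rewrite !mxE eqxx /=.
have [->|_] := eqVneq i j.
  by rewrite ltnn add0r mulr1; apply: le_trans sh (norm_coord_le _ _).
by rewrite mulr0 addr0; case: ifP => _; rewrite ?normr0//; exact: norm_coord_le.
Qed.

(** The partial derivatives are again arc-smooth, hence continuous. The increment of [f] telescopes
    along the coordinate path, and the mean value theorem on each edge compares it with the partial
    derivative at [x]. *)
Lemma arc_smooth_differentiable U f x : open U -> arc_smooth U f -> U x ->
  differentiable (f : 'rV[R]_n -> R^o) x /\
  forall v, 'd (f : 'rV[R]_n -> R^o) x v = dirder 1 f v x.
Proof.
move=> oU sf Ux.
pose g (j : 'I_n) := dirder 1 f (delta_mx 0 j).
pose L h : R^o := \sum_j h 0 j * g j x.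
have L_linear : linear L.
  move=> a h k; rewrite /L scaler_sumr -big_split; apply: eq_bigr => j _.
  by rewrite !mxE /GRing.scale /= mulrDl mulrA.
pose LM := GRing.isLinear.Build _ _ _ _ _ L_linear.
pose Ll : {linear 'rV[R]_n -> R^o} := HB.pack L LM.
have Lc : continuous Ll.
  apply: (continuous_big (P := xpredT) (@add_continuous R^o)) => j _ h.
  exact: (cvgMr_tmp (b := g j x) (@coordL_continuous R n j h)).
have [df dL] : differentiable (f : 'rV[R]_n -> R^o) x /\
    'd (f : 'rV[R]_n -> R^o) x = L :> ('rV[R]_n -> R^o).
  apply: (differentiable_approx (L := Ll) Lc) => e e0.
  (* The error is shared among [n] edges; dividing by [n.+1] also covers [n = 0]. *)
  pose e' := e / n.+1%:R; have e'0 : 0 < e' by rewrite divr_gt0.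
  have : \forall y \near x, U y /\ forall j, `|g j x - g j y| < e'.
    apply: filterI; first exact: open_nbhs_nbhs.
    apply: near_forall_ord => j.
    have sg := arc_smooth_dirder1 oU sf (delta_mx 0 j).
    by move: (arc_smooth_continuous oU sg Ux) => /cvgrPdist_lt /(_ e' e'0).
  move=> /nbhs_ballP[r /= r0 rU].
  near=> h.
  have hr : `|h| < r.
    near: h; have := nbhsx_ballx (0 : 'rV[R]_n) _ r0; apply: filterS => h.
    by rewrite -ball_normE /= sub0r normrN.
  suff : `|f (x + h) - f x - (L h : R)| <= e * `|h| by [].
  have -> : f (x + h) - f x - (L h : R) = \sum_(j < n)
      (f (x + truncate j.+1 h) - f (x + truncate j h) - h 0 j * g j x).
    rewrite sumrB -(big_mkord xpredT (fun j => f (x + truncate j.+1 h) - f (x + truncate j h))).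
    rewrite telescope_sumr// truncate0 truncate_full addr0.
    by [].
  apply: le_trans (ler_norm_sum _ _ _) _.
  apply: le_trans (_ : \sum_(j < n) e' * `|h| <= _); last first.
    rewrite sumr_const card_ord -mulr_natr mulrAC ler_wpM2r//.
    rewrite /e' -mulrA ler_piMr ?(ltW e0)// mulrC ler_pdivrMr// mul1r ler_nat.
    exact: leqnSn.
  apply: ler_sum => j _; rewrite truncateS addrA.
  set z := x + truncate j h; set s := h 0 j.
  have zU t : `|t| <= `|s| -> ball x r (z + t *: delta_mx 0 j).
    move=> ts; rewrite -ball_normE /= /z -addrA opprD addrA subrr sub0r normrN.
    by apply: le_lt_trans hr; exact: truncate_norm.
  have bw t : 0 <= t <= s \/ s <= t <= 0 -> `|t| <= `|s|.
    case=> /andP[t0 t1]; first by rewrite !ger0_norm//; exact: le_trans t1.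
    by rewrite !ler0_norm ?lerN2//; exact: le_trans t0 t1.
  have oL : open [set t : R | U (z + t *: delta_mx 0 j)] := open_line oU.
  have [|t [ts et]] := smooth_on_MVT (s := 0) (t := s) oL (arc_smooth_line z (delta_mx 0 j) oU sf).
    by move=> t /bw /zU /rU[].
  have [Uz gz] := rU _ (zU _ (bw _ ts)).
  rewrite scale0r addr0 subr0 in et.
  rewrite et -derive1n1 -(dirder_line 1 oU sf Uz) mulrC -mulrBr normrM mulrC.
  apply: ler_pM => //; last by exact: norm_coord_le.
  by rewrite distrC; exact: ltW (gz j).
split=> // v; rewrite -deriveE// /dirder derive1n1 derive1E.
rewrite /derive; set d := (fun _ : R => _); set d' := (fun _ : R => _).
suff -> : d = d' by [].
apply/funext => t; rewrite /d /d' /=.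
by rewrite addr0 scale0r addr0 [t *: 1]mulr1 [t *: v + x]addrC.
Unshelve. all: by end_near. Qed.

(** Arc-smooth functions are differentiable, and their directional derivatives are arc-smooth:
    [smooth_on_coind] concludes. *)
Theorem Boman U f : open U -> arc_smooth U f ->
  smooth_on U (f : 'rV[R]_n -> R^o).
Proof.
move=> oU sf; apply: (smooth_on_coind (P := arc_smooth U)) => // g sg; split.
  by move=> x Ux; have [] := arc_smooth_differentiable oU sg Ux.
move=> v; exists (dirder 1 g v); split; first exact: arc_smooth_dirder1.
by move=> x Ux; have [_] := arc_smooth_differentiable oU sg Ux.
Qed.

End Boman.

(** * Hadamard's lemma *)

Section Hadamard.
Context {R : realType}.
Variable r : R.
Hypothesis r0 : 0 < r.

Let J := [set t : R | `|t| < r].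

Let oJ : open J.
Proof.
rewrite (_ : J = ball 0 r); first exact: ball_open.
by apply/seteqP; split=> s; rewrite /J -ball_normE /= sub0r normrN.
Qed.

Let half_lt : r / 2 < r. Proof. by move: r0; lra. Qed.

Let J0 : J 0. Proof. by rewrite /J /= normr0. Qed.

Let near0_le (e : R) : 0 < e -> \forall t \near (0 : R), `|t| <= e.
Proof.
move=> e0; have := nbhsx_ballx (0 : R) _ e0; apply: filterS => t.
by rewrite -ball_normE /= sub0r normrN => /ltW.
Qed.

(** The mean value theorem only uses derivatives between 0 and [t], so that it applies before the
    derivative at 0 is known to exist. *)
Lemma MVT_at0 (f df : R -> R) t : t != 0 -> J t ->
  (forall x, J x -> x != 0 -> is_derive x 1 f (df x)) -> {for 0, continuous f} ->
  exists x, [/\ x != 0, `|x| <= `|t| & f t - f 0 = df x * t].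
Proof.
move=> t0 Jt fdf f0.
have cf x : J x -> {for x, continuous f}.
  have [->//|x0] := eqVneq x 0; move=> Ix; have [dfx _] := fdf x Ix x0.
  exact/differentiable_continuous/derivable1_diffP.
have cfw a b : (forall x, a <= x <= b -> J x) -> {within `[a, b], continuous f}.
  move=> abI; apply: continuous_in_subspaceT => x.
  by rewrite inE /= in_itv /= => /abI; exact: cf.
have [tn|tp] := ltP t 0.
  have tI x : t <= x <= 0 -> J x.
    move=> /andP[tx x0]; rewrite /J /= ler0_norm//; apply: le_lt_trans Jt.
    by rewrite ltr0_norm// lerN2.
  have [x|x] := MVT (df := df) tn _ (cfw _ _ tI).
    by rewrite in_itv/= => /andP[tx x0]; apply: fdf; [apply: tI; rewrite !ltW|rewrite lt_eqF].
  rewrite in_itv/= => /andP[tx x0] e; exists x; split; first by rewrite lt_eqF.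
    by rewrite !ltr0_norm// lerN2 ltW.
  by rewrite -opprB e sub0r mulrN opprK.
have {}tp : 0 < t by rewrite lt_neqAle eq_sym t0.
have tI x : 0 <= x <= t -> J x.
  move=> /andP[x0 xt]; rewrite /J /= ger0_norm//; apply: le_lt_trans Jt.
  by rewrite gtr0_norm.
have [x|x] := MVT (df := df) tp _ (cfw _ _ tI).
  by rewrite in_itv/= => /andP[x0 xt]; apply: fdf; [apply: tI; rewrite !ltW|rewrite gt_eqF].
rewrite in_itv/= => /andP[x0 xt] e; exists x; split; first by rewrite gt_eqF.
  by rewrite !gtr0_norm// ltW.
by rewrite e subr0.
Qed.

Lemma taylor_at0 (g : R -> R) : smooth_on (J : set R^o) (g : R^o -> R^o) ->
  exists2 C, 0 <= C &
    forall t, `|t| <= r / 2 -> `|g t - g 0 - t * g^`() 0| <= C * t ^+ 2.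
Proof.
move=> sg.
have rI t : - (r / 2) <= t <= r / 2 -> J t.
  by rewrite -ler_norml /J /= => tr; exact: le_lt_trans tr half_lt.
have r2 : - (r / 2) < r / 2 by move: r0; lra.
have [c _ cB] := smooth_on_bounded r2 rI (smooth_on_derive1n 2 oJ sg).
exists `|g^`(2) c| => // t tr.
have := @smooth_on_taylor _ J g 0 t `|g^`(2) c| oJ sg.
rewrite [t - 0]subr0; apply=> x xt.
have xr : - (r / 2) <= x <= r / 2.
  move: r0 tr; rewrite ler_norml => ? /andP[? ?].
  by case: xt => /andP[? ?]; apply/andP; split; lra.
by split; [exact: rI|exact: cB].
Qed.

(* The regular solution of [t y' + (k + 1) y = g]; then [y'] is the one of
   [t z' + (k + 2) z = g'], so these functions are smooth. *)
Definition euler_solution (k : nat) (g y : R -> R) : Prop :=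
  [/\ smooth_on (J : set R^o) (g : R^o -> R^o),
      {for 0, continuous y}, y 0 = g 0 / k.+1%:R &
      forall t, J t -> t != 0 -> is_derive t 1 y ((g t - k.+1%:R * y t) / t)].

(** The equation predicts the slope [g' 0 / (k + 2)] at 0. If [z] is the remainder of [y] after that
    linear part, then [t ^+ (k + 1) * z t] has derivative [t ^+ k * (g t - g 0 - t * g' 0)], of
    order [k + 2] at 0; the mean value theorem gives [z t = O(t ^+ 2)]. *)
Lemma euler_solution_at0 k g y : euler_solution k g y ->
  exists2 C, 0 <= C & forall t, `|t| <= r / 2 ->
    `|y t - y 0 - t * (g^`() 0 / k.+2%:R)| <= C * t ^+ 2.
Proof.
move=> [sg cy y0 dy]; have [C C0 gC] := taylor_at0 sg.
exists C => // t tr.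
have [->|t0] := eqVneq t 0; first by rewrite subrr mul0r subrr normr0 mulr_ge0// sqr_ge0.
pose z s := y s - y 0 - s * (g^`() 0 / k.+2%:R).
have Jt : J t by rewrite /J /=; exact: le_lt_trans tr half_lt.
pose dZ s := s ^+ k * (g s - g 0 - s * g^`() 0).
have k1 : k.+1%:R != 0 :> R by rewrite pnatr_eq0.
have k2 : k.+2%:R != 0 :> R by rewrite pnatr_eq0.
have k21 : k.+2%:R = k.+1%:R + 1 :> R by rewrite -natr1.
have dz x : J x -> x != 0 -> is_derive x 1 (fun s => s ^+ k.+1 * z s) (dZ x).
  move=> Ix x0; have dyx := dy x Ix x0.
  have dzx : is_derive x 1 z ((g x - k.+1%:R * y x) / x - g^`() 0 / k.+2%:R).
    rewrite (_ : z = (y - cst (y 0)) - (g^`() 0 / k.+2%:R) *: id); last first.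
      by apply/funext => s; rewrite /z !fctE /= /GRing.scale /= [s * _]mulrC.
    by apply: is_derive_eq; rewrite subr0 /GRing.scale /= mulr1.
  rewrite (_ : (fun s => _) = (id : R -> R) ^+ k.+1 * z); last first.
    by apply/funext => s; rewrite !fctE.
  apply: (is_derive_eq (is_deriveM (is_deriveX k.+1 (is_derive_id x 1)) dzx)).
  rewrite /GRing.scale /= exprfctE mulr1 /dZ /z y0 exprS k21.
  by field; rewrite nat1r natr1 k2 k1 x0.
have cz : {for 0, continuous (fun s : R => s ^+ k.+1 * z s)}.
  apply: cvgM; first exact: exprn_continuous.
  apply: cvgB; first by apply: cvgB => //; exact: cvg_cst.
  by apply: cvgMr_tmp; exact: cvg_id.
have [x [x0 xt]] := MVT_at0 t0 Jt dz cz.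
rewrite expr0n /= mul0r subr0 -/(z t) => e.
have tk : 0 < `|t| ^+ k.+1 by rewrite exprn_gt0// normr_gt0.
rewrite -(ler_pM2l tk) -normrX -normrM e /dZ normrM mulrC normrX exprS -mulrA.
apply: ler_pM => //.
rewrite normrM normrX; apply: ler_pM; rewrite ?exprn_ge0//.
  by rewrite lerXn2r ?nnegrE.
apply: le_trans (gC x (le_trans xt tr)) _; apply: ler_wpM2l => //.
by rewrite -[x ^+ 2]real_normK ?num_real// -[t ^+ 2]real_normK ?num_real// lerXn2r ?nnegrE.
Qed.

(** Off 0 the derivative is read from the equation. Its distance to the predicted value at 0 is a
    combination of the quadratic remainders of [g] and [y] divided by [t], so it is [O(t)] and [y']
    is continuous there. *)
Lemma euler_solution_derive k g y : euler_solution k g y ->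
  exists y', euler_solution k.+1 g^`() y' /\
    forall t, J t -> is_derive t 1 y (y' t).
Proof.
move=> E; have [C C0 yC] := euler_solution_at0 E; have [sg cy y0 dy] := E.
have [D D0 gD] := taylor_at0 sg.
pose y' t := if t == 0 then g^`() 0 / k.+2%:R else (g t - k.+1%:R * y t) / t.
have y'0 : y' 0 = g^`() 0 / k.+2%:R by rewrite /y' eqxx.
have dy' t : J t -> is_derive t 1 y (y' t).
  rewrite /y'; have [-> _|t0 Jt] := eqVneq t 0; last exact: dy.
  have r2 : 0 < r / 2 by rewrite divr_gt0.
  apply: (is_derive_quadratic (r := r / 2) (B := C)) => // h /ltW hr.
  by rewrite add0r; exact: yC.
exists y'; split=> //; split.
- exact: smooth_on_derive1.
- apply/cvgrPdist_le => e e0; near=> t.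
  rewrite y'0 distrC /y'; case: ifPn => [_|t0]; first by rewrite subrr normr0 ltW.
  have tr : `|t| <= r / 2 by near: t; apply: near0_le; rewrite divr_gt0.
  have te : `|t| <= e / (D + k.+1%:R * C + 1).
    by near: t; apply: near0_le; rewrite divr_gt0// ltr_wpDl// addr_ge0// mulr_ge0.
  have tp : 0 < `|t| by rewrite normr_gt0.
  have -> : (g t - k.+1%:R * y t) / t - g^`() 0 / k.+2%:R =
      ((g t - g 0 - t * g^`() 0) -
       k.+1%:R * (y t - y 0 - t * (g^`() 0 / k.+2%:R))) / t.
    rewrite y0 -[k.+2%:R]natr1; field.
    by rewrite nat1r natr1 !pnatr_eq0 t0.
  rewrite normrM normfV ler_pdivrMr//.
  apply: le_trans (ler_normB _ _) _.
  rewrite normrM (ger0_norm (ler0n _ _)).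
  apply: le_trans (lerD (gD t tr) (ler_wpM2l (ler0n _ _) (yC t tr))) _.
  rewrite (mulrA k.+1%:R C) -mulrDl -[t ^+ 2]real_normK ?num_real// expr2 mulrA.
  rewrite ler_wpM2r// mulrC.
  apply: le_trans (_ : `|t| * (D + k.+1%:R * C + 1) <= _).
    by rewrite ler_wpM2l// lerDl ler01.
  by rewrite -ler_pdivlMr// ltr_wpDl// addr_ge0// mulr_ge0.
- exact: y'0.
- move=> t Jt t0; have Dt := dy t Jt t0.
  apply: near_eq_is_derive
    (_ : is_derive t 1 (fun s => (g s - k.+1%:R * y s) * s^-1) _).
    near=> s; rewrite /y' ifF//; apply/negbTE; near: s.
    by apply: open_nbhs_nbhs; split=> //; exact: open_neq.
  have dg := smooth_on_is_derive 0 oJ sg Jt; rewrite derive1n1 in dg.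
  have dV : is_derive t 1 (fun s : R => s^-1) (- t ^- 2).
    apply: is_derive_eq (is_deriveV t0 (is_derive_id t 1)) _.
    by rewrite /GRing.scale /= mulr1.
  have dgy : is_derive t 1 (fun s => g s - k.+1%:R * y s)
      (g^`() t - k.+1%:R * y' t).
    rewrite (_ : (fun s => _) = g - k.+1%:R *: y); last first.
      by apply/funext => s; rewrite !fctE.
    by apply: is_derive_eq; rewrite /y' (negbTE t0).
  rewrite (_ : (fun s => _) = (fun s => g s - k.+1%:R * y s) * (fun s => s^-1)) //.
  apply: (is_derive_eq (is_deriveM dgy dV)).
  rewrite /GRing.scale /= /y' (negbTE t0) -[k.+2%:R]natr1; field.
  exact: t0.
Unshelve. all: by end_near. Qed.

Lemma smooth_on_euler_solution k g y : euler_solution k g y ->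
  smooth_on (J : set R^o) (y : R^o -> R^o).
Proof.
move=> E; pose P y := exists k g, euler_solution k g y.
have PS f : P f -> exists f', P f' /\ forall t, J t -> is_derive t 1 f (f' t).
  move=> [j [h /euler_solution_derive[f' [E' df']]]].
  by exists f'; split=> //; exists j.+1, h^`().
by apply: (smooth_on_coind1 oJ PS); exists k, g.
Qed.

Definition slope0 (f : R -> R) (t : R) : R :=
  if t == 0 then f^`() 0 else (f t - f 0) / t.

(** Differentiating [t * slope0 f t = f t - f 0] gives the equation with [k = 0] and right-hand side
    [f']. *)
Lemma euler_solution_slope0 f : smooth_on (J : set R^o) (f : R^o -> R^o) ->
  euler_solution 0 f^`() (slope0 f).
Proof.
move=> sf; have [C C0 fC] := taylor_at0 sf; split.
- exact: smooth_on_derive1.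
- apply/cvgrPdist_le => e e0; near=> t.
  rewrite distrC /slope0 eqxx; case: ifPn => [_|t0]; first by rewrite subrr normr0 ltW.
  have tr : `|t| <= r / 2 by near: t; apply: near0_le; rewrite divr_gt0.
  have te : `|t| <= e / (C + 1).
    by near: t; apply: near0_le; rewrite divr_gt0// ltr_wpDl.
  have -> : (f t - f 0) / t - f^`() 0 = (f t - f 0 - t * f^`() 0) / t.
    by field; exact: t0.
  rewrite normrM normfV ler_pdivrMr ?normr_gt0//.
  apply: le_trans (fC t tr) _.
  rewrite -[t ^+ 2]real_normK ?num_real// expr2 mulrA ler_wpM2r//.
  apply: le_trans (_ : (C + 1) * `|t| <= _); first by rewrite ler_wpM2r// lerDl ler01.
  by rewrite mulrC -ler_pdivlMr// ltr_wpDl.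
- by rewrite /slope0 eqxx divr1.
- move=> t Jt t0.
  apply: near_eq_is_derive (_ : is_derive t 1 (fun s => (f s - f 0) * s^-1) _).
    near=> s; rewrite /slope0 ifF//; apply/negbTE; near: s.
    by apply: open_nbhs_nbhs; split=> //; exact: open_neq.
  have df := smooth_on_is_derive 0 oJ sf Jt; rewrite derive1n1 in df.
  have dV : is_derive t 1 (fun s : R => s^-1) (- t ^- 2).
    apply: is_derive_eq (is_deriveV t0 (is_derive_id t 1)) _.
    by rewrite /GRing.scale /= mulr1.
  have dff : is_derive t 1 (fun s => f s - f 0) (f^`() t).
    rewrite (_ : (fun s => _) = f - cst (f 0)); last by apply/funext => s; rewrite !fctE.
    by apply: is_derive_eq; rewrite subr0.
  rewrite (_ : (fun s => _) = (fun s => f s - f 0) * (fun s => s^-1)) //.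
  apply: (is_derive_eq (is_deriveM dff dV)).
  by rewrite /GRing.scale /= /slope0 (negbTE t0); field; exact: t0.
Unshelve. all: by end_near. Qed.

Lemma smooth_on_slope0 f : smooth_on (J : set R^o) (f : R^o -> R^o) ->
  smooth_on (J : set R^o) (slope0 f : R^o -> R^o).
Proof. by move=> /euler_solution_slope0/smooth_on_euler_solution. Qed.

Lemma derive1_slope0 f : smooth_on (J : set R^o) (f : R^o -> R^o) ->
  (slope0 f)^`() 0 = f^`(2) 0 / 2.
Proof.
move=> /euler_solution_slope0/euler_solution_derive[y' [[_ _ y'0 _] /(_ 0 J0)]].
by rewrite derive1E => dy; rewrite derive_val y'0.
Qed.

Definition taylor2 (f : R -> R) (t : R) : R :=
  if t == 0 then f^`(2) 0 / 2 else t ^- 2 * (f t - f 0 - t * f^`() 0).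

(** The function is the slope at 0 taken twice, [slope0 (slope0 f)]. *)
Lemma smooth_on_taylor2 f : smooth_on (J : set R^o) (f : R^o -> R^o) ->
  smooth_on (J : set R^o) (taylor2 f : R^o -> R^o).
Proof.
move=> sf; have := smooth_on_slope0 (smooth_on_slope0 sf).
apply: smooth_on_eq => // t _.
rewrite /slope0 -/(slope0 f) /taylor2 (derive1_slope0 sf).
case: ifPn => // t0; rewrite /slope0 (negbTE t0) eqxx.
by field; exact: t0.
Qed.

End Hadamard.

(** * Locally convex spaces *)

Section HahnBanach.
Context {R : realType}.
Variables (E : lmodType R) (q : E -> R).
Hypothesis qD : forall x y, q (x + y) <= q x + q y.
Hypothesis qZ : forall a x, q (a *: x) = `|a| * q x.

Lemma seminorm0 : q 0 = 0.
Proof. by rewrite -(scale0r (0 : E)) qZ normr0 mul0r. Qed.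

Lemma seminormN x : q (- x) = q x.
Proof. by rewrite -scaleN1r qZ normrN normr1 mul1r. Qed.

Lemma seminorm_ge0 x : 0 <= q x.
Proof.
have := qD x (- x); rewrite subrr seminorm0 seminormN => H.
by rewrite -(pmulrn_lge0 _ (ltn0Sn 1)) mulr2n.
Qed.

Variable x0 : E.

(* Graphs of linear functionals on subspaces of [E] that are dominated by [q]
   and, unless the graph is empty, send [x0] to [q x0]. *)
Let dominated (G : set (E * R)) : Prop :=
  [/\ forall a x r y s, G (x, r) -> G (y, s) -> G (a *: x + y, a * r + s),
      forall x r, G (x, r) -> r <= q x &
      forall x r, G (x, r) -> G (x0, q x0)].

(** The value [al] at [x] has to lie above all [r - q (y - x)] and below all [q (y + x) - r]; the
    triangle inequality separates the two families, and the supremum of the first is taken.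
    Homogeneity reduces a multiple [t *: x] to the cases of [x] and [- x]. *)
Let dominated_extend (G : set (E * R)) x : dominated G -> G (x0, q x0) ->
  (forall r, ~ G (x, r)) -> exists H, dominated H /\ G `<` H.
Proof.
move=> [Glin Gdom _] Gx0 Gx.
have G00 : G (0, 0).
  by have := Glin (-1) _ _ _ _ Gx0 Gx0; rewrite scaleN1r addNr mulN1r addNr.
have GZ a y r : G (y, r) -> G (a *: y, a * r).
  by move=> Gy; have := Glin a _ _ _ _ Gy G00; rewrite !addr0.
pose S := [set z | exists y r, G (y, r) /\ z = r - q (y - x)].
have Sub y r : G (y, r) -> ubound S (q (y + x) - r).
  move=> Gy _ [z [s [Gz ->]]]; rewrite lerBrDr addrAC lerBlDr.
  have := Glin 1 _ _ _ _ Gz Gy; rewrite scale1r mul1r => /Gdom/le_trans; apply.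
  have -> : z + y = (y + x) + (z - x) by rewrite addrACA [x - x]subrr addr0 addrC.
  exact: qD.
have S0 : S !=set0 by exists (0 - q (0 - x)), 0, 0.
have hS : has_sup S by split=> //; exists (q (0 + x) - 0); exact: Sub.
pose al := sup S.
have al1 y r : G (y, r) -> r + al <= q (y + x).
  by move=> Gy; rewrite addrC -lerBrDr; apply: ge_sup => //; exact: Sub.
have al2 y r : G (y, r) -> r - al <= q (y - x).
  move=> Gy; rewrite lerBlDr -lerBlDl; apply: ub_le_sup; first by case: hS.
  by exists y, r.
pose H := [set w : E * R | exists y r t, G (y, r) /\ w = (y + t *: x, r + t * al)].
exists H; split; last first.
  split; first by move=> [y r] Gy; exists y, r, 0; rewrite scale0r mul0r !addr0.
  move=> HG; apply: (Gx al); apply: HG; exists 0, 0, 1.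
  by rewrite scale1r mul1r !add0r.
split.
- move=> a _ _ _ _ [y1 [r1 [t1 [G1 [-> ->]]]]] [y2 [r2 [t2 [G2 [-> ->]]]]].
  exists (a *: y1 + y2), (a * r1 + r2), (a * t1 + t2); split; first exact: Glin.
  congr pair; last by ring.
  by rewrite scalerDr scalerDl scalerA addrACA.
- move=> _ _ [y [r [t [Gy [-> ->]]]]].
  have [t0|t0|->] := ltgtP t 0; last first.
  + by rewrite scale0r mul0r !addr0; exact: Gdom.
  + have := al1 _ _ (GZ t^-1 _ _ Gy); rewrite -(ler_pM2l t0) mulrDr mulVKf ?gt_eqF//.
    by rewrite -{2}[t]gtr0_norm// -qZ scalerDr scalerA mulfV ?gt_eqF// scale1r.
  + have u0 : 0 < - t by rewrite oppr_gt0.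
    have := al2 _ _ (GZ (- t)^-1 _ _ Gy); rewrite -(ler_pM2l u0) mulrBr mulVKf ?gt_eqF//.
    rewrite mulNr opprK -{1}[- t]gtr0_norm// -qZ scalerBr scalerA mulfV ?gt_eqF// scale1r.
    by rewrite scaleNr opprK.
- by move=> _ _ _; exists x0, (q x0), 0; rewrite scale0r mul0r !addr0.
Qed.

Theorem Hahn_Banach : exists l : {linear E -> R^o},
  (forall x, `|l x| <= q x) /\ l x0 = q x0.
Proof.
(* The empty chain has the empty graph as union, so the empty graph must be admissible; it is ruled
   out as a maximal element afterwards. *)
have [|G [Gd Gmax]] := @Zorn_bigcup (E * R)%type dominated.
  move=> F Fd Ftot; split.
  - move=> a x r y s [A FA Ax] [B FB By].
    have [AB|BA] := Ftot _ _ FA FB.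
      by exists B => //; have [lin _ _] := Fd _ FB; apply: lin By; exact: AB.
    by exists A => //; have [lin _ _] := Fd _ FA; apply: lin => //; exact: BA.
  - by move=> x r [A FA Ax]; have [_ dom _] := Fd _ FA; exact: dom.
  - by move=> x r [A FA Ax]; exists A => //; have [_ _ dom] := Fd _ FA; exact: dom Ax.
have [Glin Gdom Gne] := Gd.
have Gx0 : G (x0, q x0).
  apply: contrapT => nG.
  have Gempty w : ~ G w by case: w => x r /Gne.
  (* The functional on the line of [x0] strictly extends the empty graph. *)
  pose L := [set w : E * R | exists a, w = (a *: x0, a * q x0)].
  apply: (Gmax L).
    split; first by move=> w /Gempty.
    by move=> /(_ (x0, q x0)) LG; apply/(@Gempty (x0, q x0))/LG; exists 1; rewrite scale1r mul1r.
  split.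
  - move=> a _ _ _ _ [b [-> ->]] [c [-> ->]]; exists (a * b + c).
    by rewrite scalerDl scalerA mulrDl mulrA.
  - move=> _ _ [a [-> ->]]; rewrite qZ; apply: ler_wpM2r (ler_norm a).
    exact: seminorm_ge0.
  - by move=> _ _ _; exists 1; rewrite scale1r mul1r.
have Gtot x : exists r, G (x, r).
  apply: contrapT => nG.
  have [|H [Hd GH]] := dominated_extend (x := x) Gd Gx0.
    by move=> r Gr; apply: nG; exists r.
  exact: Gmax H GH Hd.
have /choice[l Gl] := Gtot.
have Gfun x r s : G (x, r) -> G (x, s) -> r = s.
  have le r' s' : G (x, r') -> G (x, s') -> r' <= s'.
    move=> Gr Gs; have := Gdom _ _ (Glin (-1) _ _ _ _ Gs Gr).
    by rewrite scaleN1r addNr seminorm0 mulN1r addrC subr_le0.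
  by move=> Gr Gs; apply/eqP; rewrite eq_le !le.
have l_linear : linear (l : E -> R^o).
  by move=> a x y; apply: Gfun (Gl _) _; exact: Glin.
pose lM := GRing.isLinear.Build _ _ _ _ _ l_linear.
pose ll : {linear E -> R^o} := HB.pack (l : E -> R^o) lM.
exists ll; split; last exact: Gfun (Gl _) Gx0.
move=> x; have lx : ll x <= q x := Gdom _ _ (Gl x).
have lNx : ll (- x) <= q (- x) := Gdom _ _ (Gl (- x)).
by rewrite ler_norml lx andbT lerNl -(seminormN x) -linearN.
Qed.

End HahnBanach.

Section LocallyConvexSpaces.
Context {R : realType}.
Variable E : tvsType R.
Implicit Types (x y : E) (q : E -> R) (l : {linear E -> R^o}).

Lemma seminorm_continuousP q : seminorm q ->
  (forall e : R, 0 < e -> \forall x \near (0 : E), q x <= e) -> continuous q.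
Proof.
move=> [qD qZ] q0 x; apply/cvgrPdist_le => e e0.
have cx : (fun y : E => y - x) y @[y --> x] --> (0 : E).
  rewrite -[X in _ --> X](subrr x).
  apply: (@continuous_comp _ _ _ (fun y : E => (y, x)) (fun z : E * E => z.1 - z.2)).
    by apply: cvg_pair => /=; [exact: cvg_id|exact: cvg_cst].
  exact: sub_continuous.
have qx : \forall y \near x, q (y - x) <= e := cx _ (q0 e e0).
apply: filterS qx => y qyx.
have H1 := qD (y - x) x; have H2 := qD (- (y - x)) y; move: H1 H2.
rewrite (seminormN qZ) subrK opprB subrK => H1 H2.
by rewrite ler_norml; apply/andP; split; lra.
Qed.

Lemma dominated_continuous q l : seminorm q -> continuous q ->
  (forall x, `|l x| <= q x) -> continuous l.
Proof.
move=> [qD qZ] cq lq.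
have sl : seminorm (fun x => `|l x|).
  split=> [x y|a x]; first by rewrite linearD; exact: ler_normD.
  by rewrite linearZ /= normrM.
have cl : continuous (fun x => `|l x| : R).
  apply: (seminorm_continuousP sl) => e e0.
  have := cq 0; rewrite /continuous_at (seminorm0 qZ) => /cvgrPdist_le /(_ e e0).
  apply: filterS => x; rewrite sub0r normrN => /(le_trans (ler_norm _)).
  exact: le_trans.
move=> x; apply/cvgrPdist_le => e e0.
have cx : (fun y : E => y - x) y @[y --> x] --> (0 : E).
  rewrite -[X in _ --> X](subrr x).
  apply: (@continuous_comp _ _ _ (fun y : E => (y, x)) (fun z : E * E => z.1 - z.2)).
    by apply: cvg_pair => /=; [exact: cvg_id|exact: cvg_cst].
  exact: sub_continuous.
have l0 : \forall y \near (0 : E), `|l y| <= e.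
  have := cl 0; rewrite /continuous_at linear0 normr0 => /cvgrPdist_le /(_ e e0).
  by apply: filterS => y; rewrite sub0r normrN normr_id.
have lx : \forall y \near x, `|l (y - x)| <= e := cx _ l0.
apply: filterS lx => y.
by rewrite linearB distrC.
Qed.

Section Gauge.
Variable S : set E.
Hypotheses (S0 : nbhs 0 S) (SN : forall x, S x -> S (- x))
  (Sconv : forall x y (t : R), 0 <= t <= 1 -> S x -> S y -> S (t *: x + (1 - t) *: y)).

Let A x := [set r : R | 0 < r /\ S (r^-1 *: x)].

(** The Minkowski functional of the symmetric convex neighbourhood [S]. *)
Definition gauge x : R := inf (A x).

Let S00 : S 0. Proof. exact: nbhs_singleton. Qed.

Let shrink x (t : R) : 0 <= t <= 1 -> S x -> S (t *: x).
Proof. by move=> t01 Sx; have := Sconv t01 Sx S00; rewrite scaler0 addr0. Qed.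

Let A_nonempty x : A x !=set0.
Proof.
have cx : (fun r : R^o => r *: x) r @[r --> (0 : R^o)] --> (0 : E).
  rewrite -[X in _ --> X](scale0r x).
  apply: (@continuous_comp _ _ _ (fun r : R^o => (r, x)) (fun z : R^o * E => z.1 *: z.2)).
    by apply: (@cvg_pair _ _ _ _ (nbhs (0 : R^o))); [exact: cvg_id|exact: cvg_cst].
  exact: scale_continuous.
have /nbhs_ballP[e /= e0 He] := cx _ S0.
exists (2 / e); split; first by rewrite divr_gt0.
rewrite invf_div; apply: (He (e / 2)).
by rewrite -ball_normE /= sub0r normrN gtr0_norm ?divr_gt0//; lra.
Qed.

Let A_lb x : has_lbound (A x).
Proof. by exists 0 => r [/ltW]. Qed.

Let A_inf x : has_inf (A x).
Proof. by split; [exact: A_nonempty|exact: A_lb]. Qed.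

Lemma gauge_ge0 x : 0 <= gauge x.
Proof. by apply: lb_le_inf => [|r [/ltW]]; first exact: A_nonempty. Qed.

Let gauge_le x r : 0 < r -> S (r^-1 *: x) -> gauge x <= r.
Proof. by move=> r0 Sx; apply: ge_inf. Qed.

Lemma gauge_lt1 x : gauge x < 1 -> S x.
Proof.
move=> /(inf_lt (A_nonempty x))[r [r0 Sx] r1].
rewrite -[x]scale1r -(mulfV (lt0r_neq0 r0)) -scalerA; apply: shrink => //.
by rewrite !ltW.
Qed.

(** Subadditivity: [(x + y) / (r + s)] is the convex combination of [x / r] and [y / s] with weight
    [r / (r + s)]. Homogeneity: one inequality follows from symmetry, the other is the same
    inequality for the inverse scalar. *)
Lemma gauge_seminorm : seminorm gauge.
Proof.
split=> [x y|a x].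
  apply/ler_addgt0Pr => e e0; have e20 : 0 < e / 2 by rewrite divr_gt0.
  have [r [r0 Sx] rx] := inf_adherent e20 (A_inf x).
  have [s [s0 Sy] sy] := inf_adherent e20 (A_inf y).
  have rs0 : 0 < r + s by rewrite addr_gt0.
  apply: (@le_trans _ _ (r + s)); last by move: rx sy; rewrite -/(gauge x) -/(gauge y); lra.
  apply: gauge_le => //.
  have t01 : 0 <= r / (r + s) <= 1.
    by rewrite divr_ge0 ?(ltW r0) ?(ltW rs0)//= ler_pdivrMr// mul1r lerDl ltW.
  have := Sconv t01 Sx Sy; rewrite !scalerA.
  have -> : r / (r + s) / r = (r + s)^-1.
    by field; rewrite !gt_eqF.
  have -> : (1 - r / (r + s)) / s = (r + s)^-1.
    by field; rewrite !gt_eqF.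
  by rewrite scalerDr.
have gle b z : b != 0 -> gauge (b *: z) <= `|b| * gauge z.
  move=> b0; have nb0 : 0 < `|b| by rewrite normr_gt0.
  rewrite mulrC -ler_pdivrMr//; apply: lb_le_inf; first exact: A_nonempty.
  move=> r [r0 Sr]; rewrite ler_pdivrMr//.
  apply: gauge_le; first exact: mulr_gt0.
  rewrite scalerA invfM -mulrA.
  have [bp|bn] := ltP 0 b; first by rewrite gtr0_norm// mulVf ?gt_eqF// mulr1.
  rewrite ler0_norm// invrN mulNr mulVf// mulrN1 scaleNr; exact: SN.
have [->|a0] := eqVneq a 0.
  rewrite scale0r normr0 mul0r; apply/eqP; rewrite eq_le gauge_ge0 andbT.
  by apply/ler_addgt0Pl => e e0; rewrite addr0; apply: gauge_le; rewrite ?scaler0.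
apply/eqP; rewrite eq_le gle//=.
rewrite mulrC -ler_pdivlMr ?normr_gt0//.
have := gle a^-1 (a *: x); rewrite scalerA mulVf// scale1r normfV mulrC.
by apply; rewrite invr_neq0.
Qed.

Lemma gauge_continuous : continuous gauge.
Proof.
apply: (seminorm_continuousP gauge_seminorm) => e e0.
have cx : (fun x : E => e^-1 *: x) x @[x --> (0 : E)] --> (0 : E).
  rewrite -[X in _ --> X](scaler0 _ e^-1).
  apply: (@continuous_comp _ _ _ (fun x : E => (e^-1 : R^o, x)) (fun z : R^o * E => z.1 *: z.2)).
    by apply: (@cvg_pair _ _ _ _ (nbhs (e^-1 : R^o))); [exact: cvg_cst|exact: cvg_id].
  exact: scale_continuous.
have Sx : \forall x \near (0 : E), S (e^-1 *: x) := cx _ S0.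
by apply: filterS Sx => x; exact: gauge_le.
Qed.

End Gauge.

(** Local convexity gives a convex open [C] inside [U]; the gauge of the symmetric set [S], the
    intersection of [C] and its opposite, does it. *)
Lemma nbhs0_seminorm (U : set E) : nbhs 0 U ->
  exists q, [/\ seminorm q, continuous q & forall x, q x < 1 -> U x].
Proof.
move=> U0; have [B Bconv [Bo Bb]] := @locally_convex R E.
have [C [BC C0] CU] := Bb 0 U U0.
pose S := C `&` [set x | C (- x)].
have Cconv x y (t : R) : 0 <= t <= 1 -> C x -> C y -> C (t *: x + (1 - t) *: y).
  move=> /andP[t0 t1] Cx Cy; have := Bconv C (mem_set BC) x y (Itv01 t0 t1).
  by move=> /(_ (mem_set Cx) (mem_set Cy)) /set_mem.
have nC : nbhs 0 C by apply: open_nbhs_nbhs; split=> //; exact: Bo.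
have nS : nbhs 0 S.
  apply: filterI => //; have := @opp_continuous E 0; rewrite /continuous_at oppr0.
  by apply.
have SN x : S x -> S (- x) by move=> [Cx CNx]; split=> //=; rewrite opprK.
have Sconv x y (t : R) : 0 <= t <= 1 -> S x -> S y -> S (t *: x + (1 - t) *: y).
  move=> t01 [Cx CNx] [Cy CNy]; split; first exact: Cconv.
  by rewrite /= opprD -!scalerN; exact: Cconv.
exists (gauge S); split; [exact: gauge_seminorm|exact: gauge_continuous|].
by move=> x /(gauge_lt1 nS Sconv)[+ _]; exact: CU.
Qed.

Lemma dual_separates : lctvs_separated E ->
  forall x y, (forall l, continuous l -> l x = l y) -> x = y.
Proof.
move=> sep x y lxy; apply/subr0_eq/sep => q sq cq.
have [qD qZ] := sq; have [l [lq lxy']] := Hahn_Banach qD qZ (x - y).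
rewrite -lxy' linearB /= lxy ?subrr//; exact: dominated_continuous sq cq lq.
Qed.

(* Sliding hump with signs: the functional [sum_n +-3^-n l_n], where [l_n] norms
   [x n], has absolute value at least [3^-n q (x n) / 2] at [x n]. *)
Lemma weakly_bounded_seminorm_bounded (B : set E) q : seminorm q -> continuous q ->
  (forall l, continuous l -> exists M : R, forall x, B x -> `|l x| <= M) ->
  exists M : R, forall x, B x -> q x <= M.
Proof.
move=> sq cq Bw; have [qD qZ] := sq; apply: contrapT => qunb.
have q0 := seminorm_ge0 qD qZ.
(* Against the weight [3^-n], the size [6 ^+ n] still leaves growth [2 ^+ n]. *)
have /choice[x Bx] : forall n : nat, exists x, B x /\ 6 ^+ n < q x.
  move=> n; apply: contrapT => nx; apply: qunb; exists (6 ^+ n) => x Bx.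
  by rewrite leNgt; apply/negP => qx; apply: nx; exists x.
have /choice[l Hl] := fun n => Hahn_Banach qD qZ (x n).
pose e n : R := 3^-1 ^+ n.
have e0 n : 0 < e n by rewrite exprn_gt0// invr_gt0.
(* The sign agrees with that of the partial sum at [x m], so the new term cannot be cancelled
   there. *)
pose fix S (n : nat) (y : E) {struct n} : R := if n is m.+1 then
  S m y + (if 0 <= S m (x m) then 1 else -1) * (e m * l m y) else 0.
have SD n a y z : S n (a *: y + z) = a * S n y + S n z.
  elim: n => [|n IH] /=; first by rewrite mulr0 addr0.
  by rewrite IH linearP /= /GRing.scale /=; ring.
have Sx n : e n * q (x n) <= `|S n.+1 (x n)|.
  rewrite /=; have [_ ->] := Hl n; case: ifPn => [S0|]; last rewrite -ltNge => S0.
    by rewrite mul1r ger0_norm ?lerDr// addr_ge0// mulr_ge0// ltW.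
  have h0 : 0 <= e n * q (x n) by rewrite mulr_ge0// ltW.
  rewrite mulN1r ler0_norm; lra.
have Sincr y n : `|S n.+1 y - S n y| <= q y * 3^-1 ^+ n.
  rewrite /= addrC addKr normrM.
  have -> : `|if 0 <= S n (x n) then 1 else -1| = 1 :> R.
    by case: ifP => _; rewrite ?normrN normr1.
  rewrite mul1r normrM gtr0_norm// mulrC ler_wpM2r ?(ltW (e0 n))//.
  by have [lq _] := Hl n.
have s0 : 0 < 3^-1 :> R by lra.
have s1 : 3^-1 < 1 :> R by lra.
have Sc y : cvgn (S ^~ y) := geometric_increments_cvg s0 s1 (Sincr y).
pose L (y : E) : R^o := lim (S ^~ y @ \oo).
have Sd y n : `|L y - S n y| <= q y * (3 / 2) * e n.
  have LS : `|S m y - S n y| @[m --> \oo] --> `|L y - S n y|.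
    by apply: cvg_norm; apply: cvgB (Sc y) _; exact: cvg_cst.
  apply: (cvgr_to_le LS); exists n => // m /= nm; rewrite -(subnKC nm).
  have := geometric_increments_bound s0 s1 (Sincr y) n (m - n).
  by have -> : q y / (1 - 3^-1) = q y * (3 / 2) by field.
have L_linear : linear L.
  move=> a y z; apply/cvg_lim => //.
  under eq_cvg do rewrite SD.
  by apply: cvgD; [apply: cvgMl_tmp; exact: Sc|exact: Sc].
pose lM := GRing.isLinear.Build _ _ _ _ _ L_linear.
pose ll : {linear E -> R^o} := HB.pack L lM.
have cl : continuous ll.
  pose q' y := q y * (3 / 2).
  have sq' : seminorm q'.
    split=> [y z|a y]; first by rewrite -mulrDl ler_wpM2r.
    by rewrite /q' qZ -mulrA.
  apply: (dominated_continuous sq').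
    by move=> y; apply: cvgMr_tmp; exact: cq.
  by move=> y; have := Sd y 0%N; rewrite /= subr0 /e expr0 mulr1.
have [M lM'] := Bw ll cl.
have [n Mn] : exists n : nat, 2 * M < 2 ^+ n.
  exists (Num.bound `|2 * M|); apply: le_lt_trans (ler_norm _) _.
  apply: lt_le_trans (archi_boundP (normr_ge0 _)) _.
  by rewrite -natrX ler_nat ltnW// ltn_expl.
have [Bxn qxn] := Bx n.
have H1 : `|L (x n)| <= M := lM' _ Bxn.
have H2 := Sd (x n) n.+1; have H3 := Sx n.
have H4 : `|S n.+1 (x n)| <= `|L (x n)| + `|L (x n) - S n.+1 (x n)|.
  apply: le_trans (ler_normB (L (x n) : R) _).
  by rewrite le_eqVlt subKr eqxx.
have H5 : 2 ^+ n <= e n * q (x n).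
  have -> : 2 ^+ n = e n * 6 ^+ n by rewrite -exprMn; congr (_ ^+ _); field.
  by rewrite ler_wpM2l ?(ltW (e0 n))// ltW.
(* The tail of the series after the term [n] weighs half of that term, so at least
   [e n * q (x n) / 2] remains. *)
have H6 : q (x n) * (3 / 2) * e n.+1 = e n * q (x n) / 2.
  by rewrite /e exprS; field.
rewrite H6 in H2; lra.
Qed.

End LocallyConvexSpaces.

(** * Weakly smooth curves *)

Section WeaklySmoothCurves.
Context {R : realType}.
Variable E : tvsType R.
Implicit Types (l : {linear E -> R^o}) (c : R -> E) (I : set R).

Definition weakly_smooth I c : Prop :=
  forall l, continuous l -> smooth_on (I : set R^o) ((l \o c) : R^o -> R^o).

Definition weak_derivative c (t : R) (y : E) : Prop :=
  forall l, continuous l -> l y = (fun s => l (c s) : R)^`() t.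

Definition weakly_differentiable_space : Prop :=
  forall I c, open I -> weakly_smooth I c ->
    forall t, I t -> exists y, weak_derivative c t y.

Lemma curve_slope_is_derive c t y l : continuous l ->
  curve_slope c t h @[h --> 0^'] --> y ->
  is_derive t 1 (fun s => l (c s) : R) (l y).
Proof.
move=> cl cy.
have ly : h^-1 *: ((fun s => l (c s) : R) (h *: (1 : R) + t) - l (c t))
    @[h --> (0 : R)^'] --> (l y : R).
  have : (l \o curve_slope c t) h @[h --> 0^'] --> (l y : R).
    exact: (cvg_comp _ _ cy (cl y)).
  apply: cvg_trans; apply: near_eq_cvg; near=> h.
  by rewrite /= /curve_slope linearZ /= linearB /= [h *: 1]mulr1 [t + h]addrC.
by split; [apply/cvg_ex; exists (l y)|exact/cvg_lim].
Unshelve. all: by end_near. Qed.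

Lemma curve_derivative_cvg c t : curve_differentiable c t ->
  curve_slope c t h @[h --> 0^'] --> curve_derivative c t.
Proof. by move=> [y cy]; rewrite /curve_derivative; case: xgetP => [z _|/(_ y)]. Qed.

Lemma smooth_curve_weakly_smooth I c : open I -> smooth_curve I c -> weakly_smooth I c.
Proof.
move=> oI sc l cl; pose P (f : R -> R) :=
  exists k, f = fun s => l (iter k (@curve_derivative R E) c s) : R.
have PS f : P f -> exists f', P f' /\ forall t, I t -> is_derive t 1 f (f' t).
  move=> [k ->]; exists (fun s => l (iter k.+1 (@curve_derivative R E) c s) : R).
  split; first by exists k.+1.
  by move=> t /(sc k)/curve_derivative_cvg; exact: curve_slope_is_derive.
by apply: (smooth_on_coind1 oI PS); exists 0%N.
Qed.

(* The second-order remainders of [c] at [t] are weakly bounded, hence bounded. *)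
Lemma weak_derivative_cvg I c t y : open I -> weakly_smooth I c -> I t ->
  weak_derivative c t y -> curve_slope c t h @[h --> 0^'] --> y.
Proof.
move=> oI sc It wy.
have /nbhs_ballP[r0 /= r00 rI] : nbhs t I by exact: open_nbhs_nbhs.
pose r := r0 / 2; have r_gt0 : 0 < r by rewrite divr_gt0.
have {}rI s : t - r <= s <= t + r -> I s.
  move=> /andP[s1 s2]; apply: rI; rewrite -ball_normE /= ltr_norml.
  by move: r00 s1 s2; rewrite /r => ? ? ?; apply/andP; split; lra.
(* On such a point [l] is the Taylor remainder of [l \o c] at [t] divided by [h ^+ 2]. *)
pose B := [set x : E | exists h, [/\ h != 0, `|h| <= r &
  x = h^-1 *: (curve_slope c t h - y)]].
have Bw l : continuous l -> exists M : R, forall x, B x -> `|l x| <= M.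
  move=> cl; pose f : R -> R := fun s => l (c s).
  have sl : smooth_on (I : set R^o) (f : R^o -> R^o) := sc l cl.
  have tr : t - r < t + r by lra.
  have [s _ sM] := smooth_on_bounded tr rI (smooth_on_derive1n 2 oI sl).
  exists `|f^`(2) s| => _ [h [h0 hr ->]].
  have := @smooth_on_taylor _ I f t (t + h) `|f^`(2) s| oI sl.
  rewrite [t + h]addrC addrK => T.
  have {}T : `|f (h + t) - f t - h * f^`() t| <=
      `|f^`(2) s| * h ^+ 2.
    apply: T => x xt.
    have xr : t - r <= x <= t + r.
      move: hr; rewrite ler_norml => /andP[? ?].
      by case: xt => /andP[? ?]; apply/andP; split; lra.
    by split; [exact: rI|exact: sM].
  have -> : l (h^-1 *: (curve_slope c t h - y)) =
      h ^- 2 * (f (h + t) - f t - h * f^`() t) :> R.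
    rewrite /curve_slope linearZ /= linearB /= linearZ /= linearB /= (wy l cl).
    by rewrite [t + h]addrC /GRing.scale /=; field; exact: h0.
  rewrite normrM normfV ler_pdivrMl ?normr_gt0 ?expf_neq0//.
  by rewrite [leRHS]mulrC; apply: le_trans T _; rewrite ler_wpM2l// ler_norm.
move=> U Uy.
have U0 : nbhs (0 : E) [set x | U (x + y)].
  have := @add_continuous E (0, y); rewrite /continuous_at /= add0r => cadd.
  have cx : (fun x : E => x + y) x @[x --> (0 : E)] --> y.
    rewrite -[X in _ --> X](add0r y).
    apply: (@continuous_comp _ _ _ (fun x : E => (x, y)) (fun z : E * E => z.1 + z.2)).
      by apply: cvg_pair => /=; [exact: cvg_id|exact: cvg_cst].
    exact: add_continuous.
  exact: cx.
have [q [sq cq qU]] := nbhs0_seminorm U0.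
have [M qM] := weakly_bounded_seminorm_bounded sq cq Bw; have [qD qZ] := sq.
suff : \forall h \near 0^', U (curve_slope c t h) by [].
near=> h.
have h0 : h != 0 by near: h; exact: nbhs_dnbhs_neq.
have hr : `|h| <= r by near: h; exact: dnbhs0_le.
(* The quotient minus [y] is [h] times a point of [B], so [q] of it is at most [|h| * M], which
   becomes less than 1. *)
have hM : `|h| <= 1 / 2 / (`|M| + 1).
  by near: h; apply: dnbhs0_le; rewrite !divr_gt0// ltr_wpDl.
rewrite -(subrK y (curve_slope c t h)); apply: qU.
have -> : curve_slope c t h - y = h *: (h^-1 *: (curve_slope c t h - y)).
  by rewrite scalerA divff// scale1r.
rewrite qZ; apply: (@le_lt_trans _ _ (1 / 2)); last by lra.
apply: (@le_trans _ _ (`|h| * (`|M| + 1))); last by rewrite -ler_pdivlMr// ltr_wpDl.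
rewrite ler_wpM2l//; apply: (@le_trans _ _ M); first by apply: qM; exists h.
by rewrite (le_trans (ler_norm _))// lerDl.
Unshelve. all: by end_near. Qed.

Lemma weakly_smooth_derivative I c c' : open I -> weakly_smooth I c ->
  (forall t, I t -> weak_derivative c t (c' t)) -> weakly_smooth I c'.
Proof.
move=> oI sc cc' l cl.
apply: (smooth_on_eq _ _ (smooth_on_derive1 oI (sc l cl))) => // t It.
exact: esym (cc' t It l cl).
Qed.

(** Weak derivatives are limits of slopes, and the derivative of a weakly smooth curve is weakly
    smooth again; iterate. *)
Lemma weakly_smooth_smooth_curve I c :
  weakly_differentiable_space -> open I -> weakly_smooth I c -> smooth_curve I c.
Proof.
move=> wd oI sc.
have diff c1 t : weakly_smooth I c1 -> I t -> curve_differentiable c1 t.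
  move=> sc1 It; have [y wy] := wd I c1 oI sc1 t It.
  by exists y; exact: weak_derivative_cvg oI sc1 It wy.
have sck k : weakly_smooth I (iter k (@curve_derivative R E) c).
  elim: k => [//|k IH]; apply: (weakly_smooth_derivative oI IH) => t It l cl /=.
  have := curve_slope_is_derive cl (curve_derivative_cvg (diff _ _ IH It)).
  by rewrite derive1E => D; rewrite derive_val.
by move=> k t It; exact: diff.
Qed.

(** Read through the coordinate of ['rV_1], a weakly smooth curve is a plot of [Pi_dual], hence of
    [Dc]; testing that plot on [t *: const_mx 1] gives the curve back. *)
Lemma convenient_weakly_differentiable : convenient E -> weakly_differentiable_space.
Proof.
move=> /diffeology_eqP conv I c oI sc t It.
have oU : open [set u : 'rV[R]_1 | I (u 0 0)].
  have := open_smooth_preimage (@openT 'rV[R]_1) oI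
    (smooth_on_lin (L := coordL 0) setT (@coordL_continuous R 1 0)).
  by rewrite setTI.
have pp : plot (@Pi_dual R E) [set u : 'rV[R]_1 | I (u 0 0)] (fun u => c (u 0 0)).
  split=> // l cl.
  apply: (@smooth_on_comp1 R 'rV[R]_1 R^o _ I (coordL 0) (l \o c)) => //.
    by apply: smooth_on_lin; exact: coordL_continuous.
  exact: sc.
have [_ Dp] := (conv _ _ _).2 pp.
have sr : smooth_on (I : set R^o) ((fun t : R^o => t *: const_mx 1) : R^o -> 'rV[R]_1).
  apply: (@smooth_on_scale R R^o) => //; last exact: smooth_on_cst.
  by apply: (@smooth_on_lin R R^o R^o idfun) => z; exact: cvg_id.
have E1 s : (s *: const_mx 1 : 'rV[R]_1) 0 0 = s by rewrite !mxE mulr1.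
have sc' : smooth_curve I c.
  apply: (smooth_curve_eq oI (c := (fun u : 'rV[R]_1 => c (u 0 0)) \o
    (fun t : R => t *: const_mx 1))) => [s _|]; first by rewrite /= E1.
  by apply: Dp => // s Is; rewrite /= E1.
have [y cy] := sc' 0%N t It; exists y => l cl.
by have := curve_slope_is_derive cl cy; rewrite derive1E => D; rewrite derive_val.
Qed.

Lemma weakly_differentiable_convenient :
  weakly_differentiable_space -> convenient E.
Proof.
move=> wd; apply/diffeology_eqP => n U p; split=> -[oU pU]; split=> //.
  move=> l cl; apply: (Boman (f := fun u => l (p u) : R)) => // I c oI sc cU.
  exact: (smooth_curve_weakly_smooth oI (pU I c oI sc cU) cl).
move=> I c oI sc cU; apply: weakly_smooth_smooth_curve => // l cl.
exact: (smooth_on_comp oI oU cU sc (pU l cl)).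
Qed.

End WeaklySmoothCurves.

(** * Tangent vectors *)

Local Arguments plot_dom {R X D} p _ : rename.
Local Arguments plot_map {R X D} p _ : rename.

Section TangentClasses.
Context {R : realType}.

Lemma is_diff_ray (V : normedModType R) (b w : V) (s v : 'rV[R]_1) :
  differentiable (fun s : 'rV[R]_1 => b + s 0 0 *: w) s /\
  'd (fun s : 'rV[R]_1 => b + s 0 0 *: w) s v = v 0 0 *: w.
Proof.
have dc : differentiable (coordL 0 : 'rV[R]_1 -> R^o) s.
  exact/linear_differentiable/coordL_continuous.
have [ds sE] := is_diff_scale dc (differentiable_cst w s).
have db := differentiable_cst b s.
split; first exact: (differentiableD db ds).
have := diffD db ds => /(congr1 (fun f => f v)) /= ->.
rewrite sE !diff_cst [LHS]add0r scaler0 add0r diff_lin //.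
exact: coordL_continuous.
Qed.

Lemma smooth_on_ray (V : normedModType R) (U : set 'rV[R]_1) (b w : V) : open U ->
  smooth_on U (fun s : 'rV[R]_1 => b + s 0 0 *: w).
Proof.
move=> oU; apply: smooth_onD => //; first exact: smooth_on_cst.
apply: smooth_on_scale => //; last exact: smooth_on_cst.
by apply: (smooth_on_lin (L := coordL 0)); exact: coordL_continuous.
Qed.

(** Target point and vector are prescribed through equations, whereas [TangentStep] imposes the
    literal forms [f u] and ['d f u v]. *)
Lemma tangent_class_push (X : Type) (D : diffeology R X) (p p' : plots D)
    (f : 'rV[R]_(plot_dim p) -> 'rV[R]_(plot_dim p'))
    u (pu : plot_dom p u) v u' (pu' : plot_dom p' u') v' :
  smooth_on (plot_dom p) f ->
  (forall w, plot_dom p w -> plot_dom p' (f w)) ->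
  (forall w, plot_dom p w -> plot_map p w = plot_map p' (f w)) ->
  f u = u' -> 'd f u v = v' ->
  tangent_class (mkpretangent pu v) = tangent_class (mkpretangent pu' v').
Proof.
move=> sf fdom fmap fu <-; subst u'.
apply/tangent_classP; apply: rst_step; exact: TangentStep.
Qed.

End TangentClasses.

Section TangentOfTvs.
Context {R : realType}.
Variable E : tvsType R.
Implicit Types (l : {linear E -> R^o}).

Notation D := (Pi_dual E).

Definition base_point (a : pretangent D) : E := plot_map (projT1 a) (sval (projT2 a).1).

Definition weak_velocity l (a : pretangent D) : R :=
  'd ((fun w => l (plot_map (projT1 a) w)) : _ -> R^o) (sval (projT2 a).1) (projT2 a).2.

(** Chain rule for [l \o p = (l \o p') \o f] near [u]. *)
Lemma tangent_step_invariant l (a b : pretangent D) : continuous l ->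
  tangent_step a b ->
  base_point a = base_point b /\ weak_velocity l a = weak_velocity l b.
Proof.
move=> cl [p p' f u pu pfu v sf fdom fmap]; split; first exact: fmap.
rewrite /weak_velocity /=.
have [oU sp] := plot_mapP p; have [oU' sp'] := plot_mapP p'.
have df : differentiable f u by have [+ _] := sf 1%N; apply.
have dp' : differentiable ((fun w => l (plot_map p' w)) : _ -> R^o) (f u).
  by have [+ _] := sp' l cl 1%N; apply.
have dc := differentiable_comp df dp'.
have N : {near u, ((fun w => l (plot_map p' w)) : _ -> R^o) \o f =1
    (fun w => l (plot_map p w))}.
  by apply: filterS (open_nbhs_nbhs (conj oU pu)) => w /fmap /= ->.
have [_ /(congr1 (fun g => g v)) <-] := near_eq_differentiable N dc.
by rewrite (diff_comp df dp').
Qed.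

Lemma tangent_class_invariant l (a b : pretangent D) : continuous l ->
  tangent_class a = tangent_class b ->
  base_point a = base_point b /\ weak_velocity l a = weak_velocity l b.
Proof.
move=> cl /tangent_classP; elim=> {a b} [a b|a|a b _ [-> ->]|a b c _ [-> ->] _ [-> ->]] //.
exact: tangent_step_invariant.
Qed.

Definition ell_pre (z : E * E) : pretangent D :=
  @mkpretangent _ _ D (Plots (plot_line D z.1 z.2)) 0 I (const_mx 1).

Lemma base_point_ell z : base_point (ell_pre z) = z.1.
Proof. by rewrite /base_point /= mxE scale0r addr0. Qed.

Lemma weak_velocity_ell l z : continuous l -> weak_velocity l (ell_pre z) = l z.2.
Proof.
move=> cl; rewrite /weak_velocity /=.
have -> : (fun w : 'rV[R]_1 => l (z.1 + w 0 0 *: z.2)) =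
    (fun w : 'rV[R]_1 => (l z.1 : R^o) + w 0 0 *: (l z.2 : R^o)).
  by apply/funext => w; rewrite linearD linearZ.
by have [_ ->] := is_diff_ray (l z.1 : R^o) (l z.2 : R^o) 0 (const_mx 1); rewrite mxE scale1r.
Qed.

(** Write the class of [c] at [t] with unit vector as [ell (x, y)]; comparing weak velocities yields
    [l y = (l \o c)' t] for all [l]. *)
Lemma ell_surjective_weakly_differentiable :
  (forall z, exists w, ell D w = z) -> weakly_differentiable_space E.
Proof.
move=> surj I c oI sc t It.
pose U := [set u : 'rV[R]_1 | I (u 0 0)].
have pp : plot D U (fun u => c (u 0 0)).
  have oU : open U.
    have := open_smooth_preimage (@openT 'rV[R]_1) oI
      (smooth_on_lin (L := coordL 0) setT (@coordL_continuous R 1 0)).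
    by rewrite setTI.
  split=> // l cl.
  apply: (@smooth_on_comp1 R 'rV[R]_1 R^o _ I (coordL 0) (l \o c)) => //.
    by apply: smooth_on_lin; exact: coordL_continuous.
  exact: sc.
have Ut : plot_dom (Plots pp) (const_mx t) by rewrite /= /U /= mxE.
have [[x y] E1] := surj (tangent_class (mkpretangent Ut (const_mx 1))).
exists y => l cl; have [_] := tangent_class_invariant cl E1.
rewrite -/(ell_pre (x, y)) weak_velocity_ell// => ->.
rewrite /weak_velocity /=.
have dl : derivable (fun s => l (c s) : R) ((const_mx t : 'rV[R]_1) 0 0) 1.
  have sl : smooth_on (I : set R^o) ((fun s => l (c s) : R) : R^o -> R^o) := sc l cl.
  by rewrite mxE; exact: smooth_on_derivable sl It.
have dl' := proj1 (derivable1_diffP _ _) dl.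
have dc : differentiable (coordL 0 : 'rV[R]_1 -> R^o) (const_mx t).
  exact/linear_differentiable/coordL_continuous.
have H := congr1 (fun f => f (const_mx 1)) (diff_comp dc dl').
rewrite (diff_lin _ (@coordL_continuous R 1 0)) in H.
apply: (etrans H); rewrite /= (diff_derive1 _ dl) !mxE.
exact: scale1r.
Qed.

End TangentOfTvs.

(** * Existence of weak derivatives implies tangent stability *)

Section TangentStability.
Context {R : realType}.
Variable E : tvsType R.
Implicit Types (l : {linear E -> R^o}) (c : R -> E).

Notation D := (Pi_dual E).

Hypothesis wd : weakly_differentiable_space E.

(** At 0 the remainder [h] is set to half the second weak derivative, which exists because [c'] is
    weakly smooth; then [l \o h] is [taylor2 (l \o c)], smooth by Hadamard's lemma. *)
Lemma weak_taylor2 c (r : R) : 0 < r -> weakly_smooth [set t | `|t| < r] c ->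
  exists y h, [/\ weak_derivative c 0 y, weakly_smooth [set t | `|t| < r] h &
    forall t, c t = c 0 + t *: y + t ^+ 2 *: h t].
Proof.
move=> r0 sc; set J := [set t | `|t| < r].
have oJ : open J.
  rewrite (_ : J = ball 0 r); first exact: ball_open.
  by apply/seteqP; split=> s; rewrite /J -ball_normE /= sub0r normrN.
have J0 : J 0 by rewrite /J /= normr0.
have /choice[c' Hc'] : forall t, exists y, J t -> weak_derivative c t y.
  move=> t; have [Jt|nJt] := pselect (J t); last by exists 0.
  by have [y wy] := wd oJ sc Jt; exists y.
have sc' := weakly_smooth_derivative oJ sc Hc'.
have [y2 wy2] := wd oJ sc' J0.
pose h t := if t == 0 then 2^-1 *: y2 else t ^- 2 *: (c t - c 0 - t *: c' 0).
exists (c' 0), h; split; first exact: Hc'.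
- move=> l cl; pose f : R -> R := fun s => l (c s).
  have sf : smooth_on (J : set R^o) (f : R^o -> R^o) := sc l cl.
  apply: smooth_on_eq (smooth_on_taylor2 r0 sf) => // t Jt.
  rewrite /taylor2 /h /=; case: ifPn => [_|t0].
    rewrite linearZ /= (wy2 l cl) mulrC /GRing.scale /=; congr (_ * _).
    exact: (eq_derive1n 1 oJ (fun s Js => esym (Hc' s Js l cl)) J0).
  have -> : l (t ^- 2 *: (c t - c 0 - t *: c' 0)) =
      t ^- 2 * (l (c t) - l (c 0) - t * l (c' 0)) :> R.
    have lB x z : l (x - z) = l x - l z by exact: linearB.
    have lZ a x : l (a *: x) = a * l x by exact: linearZ.
    by rewrite lZ !lB lZ.
  by rewrite (Hc' 0 J0 l cl).
- move=> t; rewrite /h; case: ifPn => [/eqP ->|t0].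
    by rewrite expr0n scale0r scale0r !addr0.
  by rewrite scalerA divff ?expf_neq0// scale1r -[c t - c 0 - _]addrA -opprD [RHS]addrC subrK.
Qed.

(* With [c t = x + t *: y + t ^+ 2 *: h t] and [q (b, s) = x + s *: y + b *: h s],
   both [c t = q (t ^+ 2, t)] and the line [x + t *: y = q (0, t)] leave the origin
   with velocity [(0, 1)]. *)
Lemma tangent_class_ell (a : pretangent D) : exists y,
  (forall l, continuous l -> l y = weak_velocity l a) /\
  tangent_class a = ell D (base_point a, y).
Proof.
case: a => p [[u pu] w]; rewrite /weak_velocity /base_point /=.
have [oU sp] := plot_mapP p.
have oI : open [set t : R | plot_dom p (u + t *: w)] := open_line oU.
have /nbhs_ballP[r /= r0 rI] : nbhs (0 : R) [set t : R | plot_dom p (u + t *: w)].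
  by apply: open_nbhs_nbhs; split=> //=; rewrite scale0r addr0.
pose J := [set t : R | `|t| < r].
have JE : J = ball 0 r.
  by apply/seteqP; split=> s; rewrite /J -ball_normE /= sub0r normrN.
have oJ : open J by rewrite JE; exact: ball_open.
have J0 : J 0 by rewrite /J /= normr0.
have Jp t : J t -> plot_dom p (u + t *: w) by rewrite JE => /rI.
pose c t := plot_map p (u + t *: w).
have sc : weakly_smooth J c.
  move=> l cl; apply: (@smooth_on_comp R R^o R^o _ J (plot_dom p) (fun t => u + t *: w)
    (fun z => l (plot_map p z))) => //; first exact: smooth_on_line.
  exact: sp.
have [y [h [wy sh ch]]] := weak_taylor2 r0 sc.
have c0 : c 0 = plot_map p u by rewrite /c scale0r addr0.
exists y; split.
  move=> l cl; rewrite (wy l cl).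
  have sf : arc_smooth (plot_dom p) (fun z => l (plot_map p z) : R).
    by move=> I g oI' sg gp; exact: (smooth_on_comp oI' oU gp sg (sp l cl)).
  by have [_ ->] := arc_smooth_differentiable oU sf pu.
rewrite -c0.
have oU1 : open [set s : 'rV[R]_1 | J (s 0 0)].
  have := open_smooth_preimage (@openT 'rV[R]_1) oJ
    (smooth_on_lin (L := coordL 0) setT (@coordL_continuous R 1 0)).
  by rewrite setTI.
have oU2 : open [set z : 'rV[R]_2 | J (z 0 1)].
  have := open_smooth_preimage (@openT 'rV[R]_2) oJ
    (smooth_on_lin (L := coordL 1) setT (@coordL_continuous R 2 1)).
  by rewrite setTI.
have pc : plot D [set s : 'rV[R]_1 | J (s 0 0)] (fun s => c (s 0 0)).
  split=> // l cl; apply: (@smooth_on_comp1 R 'rV[R]_1 R^o _ J (coordL 0) (l \o c)) => //.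
    by apply: smooth_on_lin; exact: coordL_continuous.
  exact: sc.
have pq : plot D [set z : 'rV[R]_2 | J (z 0 1)]
    (fun z => c 0 + z 0 1 *: y + z 0 0 *: h (z 0 1)).
  split=> // l cl.
  have -> : l \o (fun z : 'rV[R]_2 => c 0 + z 0 1 *: y + z 0 0 *: h (z 0 1)) =
      (fun z : 'rV[R]_2 => (l (c 0) : R^o) + coordL 1 z *: (l y : R^o) +
        coordL 0 z *: ((l \o h) \o coordL 1) z).
    by apply/funext => z; rewrite /= !linearD !linearZ.
  apply: smooth_onD => //.
    apply: smooth_onD => //; first exact: smooth_on_cst.
    apply: smooth_on_scale => //; last exact: smooth_on_cst.
    by apply: smooth_on_lin; exact: coordL_continuous.
  apply: smooth_on_scale => //.
    by apply: smooth_on_lin; exact: coordL_continuous.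
  apply: (@smooth_on_comp1 R 'rV[R]_2 R^o _ J (coordL 1) (l \o h)) => //.
    by apply: smooth_on_lin; exact: coordL_continuous.
  exact: sh.
have pl : plot D [set s : 'rV[R]_1 | J (s 0 0)] (fun s => c 0 + s 0 0 *: y).
  exact: plot_sub (plot_line D (c 0) y).
have J0' : [set s : 'rV[R]_1 | J (s 0 0)] 0 by rewrite /= mxE.
have J0'' : [set z : 'rV[R]_2 | J (z 0 1)] 0 by rewrite /= mxE.
pose e0 : 'rV[R]_2 := delta_mx 0 0; pose e1 : 'rV[R]_2 := delta_mx 0 1.
(* From [a] to the curve [c], to the two-parameter plot at the origin in the direction [e1], to the
   tangent line over [J], and to the whole tangent line. *)
transitivity (tangent_class (@mkpretangent _ _ _ (Plots pc) 0 J0' (const_mx 1))).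
  symmetry; apply: (@tangent_class_push _ _ D (Plots pc) p
    (fun s : 'rV[R]_1 => u + s 0 0 *: w)) => /=.
  - exact: smooth_on_ray.
  - by move=> s; exact: Jp.
  - by [].
  - by rewrite mxE scale0r addr0.
  - by have [_ ->] := is_diff_ray u w 0 (const_mx 1); rewrite mxE scale1r.
transitivity (tangent_class (@mkpretangent _ _ _ (Plots pq) 0 J0'' e1)).
  (* The map is [s |-> (s ^+ 2, s)], the square part being a scalar times a ray so that
     [is_diff_scale] and [is_diff_ray] give its differential. *)
  apply: (@tangent_class_push _ _ D (Plots pc) (Plots pq) (fun s : 'rV[R]_1 =>
    s 0 0 *: (0 + s 0 0 *: e0) + (0 + s 0 0 *: e1))) => /=.
  - apply: smooth_onD => //; last exact: smooth_on_ray.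
    apply: smooth_on_scale => //; last exact: smooth_on_ray.
    by apply: (smooth_on_lin (L := coordL 0)); exact: coordL_continuous.
  - by move=> s Js; rewrite !mxE /= !(mulr0, mulr1, add0r).
  - by move=> s Js; rewrite !mxE /= !(mulr0, mulr1, add0r, addr0) -expr2; exact: ch.
  - by rewrite !mxE !(scale0r, addr0).
  - have [d0 _] := is_diff_ray 0 e0 0 (const_mx 1).
    have [d1 d1E] := is_diff_ray 0 e1 0 (const_mx 1).
    have dc : differentiable (coordL 0 : 'rV[R]_1 -> R^o) 0.
      exact/linear_differentiable/coordL_continuous.
    have [ds dsE] := is_diff_scale dc d0.
    have c00 : coordL 0 (0 : 'rV[R]_1) = 0 by exact: linear0.
    have ds0 : 'd (fun s : 'rV[R]_1 => coordL 0 s *: (0 + s 0 0 *: e0)) 0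
        (const_mx 1) = 0.
      by rewrite dsE c00 scale0r add0r mxE scale0r addr0 scaler0.
    have d1' : 'd (fun s : 'rV[R]_1 => 0 + s 0 0 *: e1) 0 (const_mx 1) = e1.
      by rewrite d1E mxE scale1r.
    apply: (etrans (congr1 (fun f => f (const_mx 1)) (diffD ds d1))).
    by rewrite -[RHS]add0r; congr (_ + _).
transitivity (tangent_class (@mkpretangent _ _ _ (Plots pl) 0 J0' (const_mx 1))).
  symmetry; apply: (@tangent_class_push _ _ D (Plots pl) (Plots pq)
    (fun s : 'rV[R]_1 => 0 + s 0 0 *: e1)) => /=.
  - exact: smooth_on_ray.
  - by move=> s Js; rewrite !mxE /= !(mulr0, mulr1, add0r).
  - by move=> s Js; rewrite !mxE /= !(mulr0, mulr1, add0r, addr0) scale0r addr0.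
  - by rewrite !mxE !(scale0r, addr0).
  - by have [_ ->] := is_diff_ray 0 e1 0 (const_mx 1); rewrite mxE scale1r.
apply: (@tangent_class_push _ _ D (Plots pl) (Plots (plot_line D (c 0) y)) idfun) => //=.
  by apply: smooth_on_lin => x; exact: cvg_id.
by rewrite diff_val.
Qed.

(** In finite dimension a linear map is a sum of coordinates times constant vectors, so its
    continuity need not be assumed. *)
Lemma smooth_on_rV_linear (W : normedModType R) n (L : {linear 'rV[R]_n -> W})
    (U : set 'rV[R]_n) : open U -> smooth_on U L.
Proof.
move=> oU; have -> : (L : 'rV[R]_n -> W) =
    (fun w => \sum_(j <- index_enum 'I_n) (coordL j w : R^o) *: L (delta_mx 0 j)).
  by apply/funext => w; rewrite {1}lin_row.
move=> k; apply: diff_upto_sum => // j; apply: diff_upto_scale => //.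
  by apply: diff_upto_lin; exact: coordL_continuous.
exact: diff_upto_cst.
Qed.

(* [ell (p w)] is the class of [(w, t) |-> (p w).1 + t *: (p w).2] at [(w, 0)] and
   [(0, 1)]. *)
Lemma ell_smooth : smooth_map (prod_diffeology D D) (tangent_diffeology D) (ell D).
Proof.
move=> n U p [[oU s1] [_ s2]]; split=> // u0 Uu0.
pose V := [set z : 'rV[R]_(n + 1) | U (lsubmx z)].
have sl W : open W -> smooth_on W (@lsubmx R 1 n 1).
  exact: smooth_on_rV_linear.
have sr W : open W -> smooth_on W (@rsubmx R 1 n 1).
  exact: smooth_on_rV_linear.
have oV : open V.
  by have := open_smooth_preimage openT oU (sl _ openT); rewrite setTI.
have pP : plot D V (fun z => (p (lsubmx z)).1 + rsubmx z 0 0 *: (p (lsubmx z)).2).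
  split=> // l cl.
  have -> : l \o (fun z => (p (lsubmx z)).1 + rsubmx z 0 0 *: (p (lsubmx z)).2) =
      (fun z : 'rV[R]_(n + 1) => ((l \o (fst \o p)) \o lsubmx) z +
        ((coordL 0 \o rsubmx) z : R^o) *: ((l \o (snd \o p)) \o lsubmx) z).
    by apply/funext => z; rewrite /= linearD linearZ.
  have sV : smooth_on V lsubmx := sl V oV.
  apply: smooth_onD => //; first exact: smooth_on_comp sV (s1 l cl).
  apply: smooth_on_scale => //; last exact: smooth_on_comp sV (s2 l cl).
  apply: (smooth_on_comp oV openT _ (sr V oV)) => //.
  by apply: smooth_on_lin; exact: coordL_continuous.
pose f (w : 'rV[R]_n) : 'rV[R]_(n + 1) := w *m row_mx 1%:M 0.
have fE w : f w = row_mx w 0 by rewrite /f mul_mx_row mulmx1 mulmx0.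
pose e : 'rV[R]_(n + 1) := row_mx 0 (const_mx 1).
have fV w : U w -> plot_dom (Plots pP) (f w).
  by rewrite /= /V /= fE row_mxKl.
(* A plot is a total function, so the lift needs points of the domain for [w] outside [U] too;
   [f u0] serves there. *)
have /choice[pt ptE] : forall w, exists z : {z | plot_dom (Plots pP) z},
    U w -> sval z = f w.
  move=> w; have [Uw|nUw] := pselect (U w); first by exists (exist _ (f w) (fV w Uw)).
  by exists (exist _ (f u0) (fV u0 Uu0)).
exists U, (fun w => existT (fun p : plots D =>
  ({u | plot_dom p u} * 'rV[R]_(plot_dim p))%type) (Plots pP) (pt w, e)); split=> //.
  split=> // w Uw; exists U, (Plots pP), (fun w => (pt w, e)); split=> //.
  split; last exact: plot_cst.
  split=> //; apply: (@smooth_on_eq R _ _ U f) => // [v /ptE -> //|].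
  exact: (smooth_on_rV_linear (mulmxr (row_mx 1%:M 0)) oU).
move=> w Uw; case: (pt w) (ptE w Uw) => z Vz /= zE; subst z.
apply: (@tangent_class_push _ _ D (Plots (plot_line D (p w).1 (p w).2)) (Plots pP)
  (fun s : 'rV[R]_1 => f w + s 0 0 *: e)) => /=.
- exact: smooth_on_ray openT.
- move=> s _; rewrite /V /= fE /e scale_row_mx add_row_mx row_mxKl scaler0 addr0.
  exact: Uw.
- move=> s _; rewrite fE /e scale_row_mx add_row_mx row_mxKl row_mxKr.
  by rewrite scaler0 addr0 add0r !mxE mulr1.
- by rewrite mxE scale0r addr0.
- by have [_ ->] := is_diff_ray (f w) e 0 (const_mx 1); rewrite mxE scale1r.
Qed.

(** Expanding [b w] in the canonical basis turns the differential into a sum of coordinates of [b]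
    times partial derivatives composed with [a]. *)
Lemma weak_velocity_smooth l m (p : plots D) (U : set 'rV[R]_m)
    (a b : 'rV[R]_m -> 'rV[R]_(plot_dim p)) : continuous l -> open U ->
  smooth_on U a -> smooth_on U b -> (forall w, U w -> plot_dom p (a w)) ->
  smooth_on U (fun w => 'd ((fun z => l (plot_map p z)) : _ -> R^o) (a w) (b w)).
Proof.
move=> cl oU sa sb aU; have [oV sp] := plot_mapP p.
pose F (z : 'rV[R]_(plot_dim p)) : R^o := l (plot_map p z).
have sF : smooth_on (plot_dom p) F := sp l cl.
have -> : (fun w => 'd F (a w) (b w)) = (fun w => \sum_(j <- index_enum 'I_(plot_dim p))
    ((coordL j \o b) w : R^o) *: ((fun z => 'd F z (delta_mx 0 j)) \o a) w).
  by apply/funext => w; exact: (lin_row ('d F (a w)) (b w)).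
move=> k; apply: diff_upto_sum => // j; apply: diff_upto_scale => //.
  apply: (diff_upto_comp oU openT _ (sb k)) => //.
  by apply: diff_upto_lin; exact: coordL_continuous.
by apply: (diff_upto_comp oU oV aU (sa k)); have [_] := sF k.+1; apply.
Qed.

(** The inverse [g] sends a class to its base point and to the vector that represents its weak
    velocities, well defined since functionals separate points. On a local lift of a plot both
    components are smooth against every functional. *)
Lemma weakly_differentiable_tangent_stable : lctvs_separated E -> tangent_stable D.
Proof.
move=> sep.
have /choice[g Hg] : forall z : tangent D, exists xy, ell D xy = z.
  move=> z; have [a <-] := tangent_class_surj z.
  by have [y [_ Ey]] := tangent_class_ell a; exists (base_point a, y).
(* Invariance of base points is stated together with a functional; the zero functional serves to
   extract it. *)
have cz : continuous (\0%R : {linear E -> R^o}) by exact: cst_continuous.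
have ell_inj : injective (ell D).
  move=> [x y] [x' y'] Exy.
  have inv l (cl : continuous l) := tangent_class_invariant (a := ell_pre (x, y))
    (b := ell_pre (x', y')) cl Exy.
  congr pair.
    by have [+ _] := inv _ cz; rewrite !base_point_ell.
  apply: (dual_separates sep) => l cl.
  by have [_] := inv _ cl; rewrite !weak_velocity_ell.
exists g; split=> //; first by move=> xy; apply: ell_inj.
  exact: ell_smooth.
have gE a : (g (tangent_class a)).1 = base_point a /\
    forall l, continuous l -> l (g (tangent_class a)).2 = weak_velocity l a.
  have ga := Hg (tangent_class a); split.
    have [] := tangent_class_invariant (a := ell_pre (g (tangent_class a))) cz ga.
    by rewrite base_point_ell.
  move=> l cl.
  have [_] := tangent_class_invariant (a := ell_pre (g (tangent_class a))) cl ga.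
  by rewrite weak_velocity_ell.
move=> n U z [oU zloc]; apply: plot_loc => // u /zloc[U1 [q [U1u U1U [oU1 qloc] zq]]].
have [U2 [p [r [U2u U21 [[oU2 sa] [_ sb]] qr]]]] := qloc u U1u.
exists U2; split=> //; first by move=> w /U21/U1U.
pose a w := sval (r w).1; pose b w := (r w).2.
have zE w : U2 w -> g (z w) = g (tangent_class (existT _ p (r w))).
  by move=> U2w; rewrite zq ?qr//; exact: U21.
have aU w : U2 w -> plot_dom p (a w) by move=> _; exact: (svalP (r w).1).
split.
  apply: (plot_eq (p := plot_map p \o a)).
    by move=> w U2w /=; rewrite zE//; have [-> _] := gE (existT _ p (r w)).
  exact: plot_comp oU2 sa aU (plot_mapP p).
split=> // l cl.
apply: smooth_on_eq (weak_velocity_smooth cl oU2 sa sb aU) => // w U2w /=.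
by rewrite zE//; have [_ ->] := gE (existT _ p (r w)).
Qed.

End TangentStability.

Theorem mainTheorem2 (R : realType) (E : tvsType R)
    (E_separated : lctvs_separated E) (E_bornological : bornological E) :
  convenient E <-> tangent_stable (Pi_dual E).
Proof.
split=> [/convenient_weakly_differentiable wd|[g [_ gK _ _]]].
  exact: weakly_differentiable_tangent_stable.
apply: weakly_differentiable_convenient.
by apply: ell_surjective_weakly_differentiable => z; exists (g z).
Qed.
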